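(* Let $\frac12<s<1$, $1-s\leqslant r\leqslant s$, $1\leqslant p\leqslant\infty$, and suppose $u=G\ast f$ with $f\in L^p_r(B_1)$. Then: 1. If $p=1$, then for any $q$ satisfying $1\leqslant q<\frac{n}{n-2s+1}$, $|\nabla u|\in L^q_r(B_1)$ with $\||\nabla u|\|_{L^q_r(B_1)}\leqslant C\|f\|_{L^1_r(B_1)}$, where $C$ is a positive constant depending only on $n,s,q$. 2. If $1<p<\frac{n}{2s-1}$, then $|\nabla u|\in L^{\frac{np}{n-(2s-1)p}}_r(B_1)$ with $\||\nabla u|\|_{L^{\frac{np}{n-(2s-1)p}}_r(B_1)}\leqslant C\|f\|_{L^p_r(B_1)}$, where $C$ is a positive constant depending only on $n,s,p$. 3. If $p>\frac{n}{2s-1}$, then $|\nabla u|\in L^\infty_r(B_1)$ with $\||\nabla u|\|_{L^\infty_r(B_1)}\leqslant C\|f\|_{L^p_r(B_1)}$, where $C$ is a positive constant depending only on $n,s,p$.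
   Context: $B_1$ is the open unit ball of $\mathbb{R}^n$ and $\delta(x)=\operatorname{dist}(x,\mathbb{R}^n\setminus B_1)$, so $\delta(x)=1-|x|$ for $x\in B_1$. For $1\leqslant p\leqslant\infty$, $L^p_r(B_1)=\{f\in L^1_{\mathrm{loc}}(B_1):\|f\|_{L^p_r(B_1)}:=\|\delta^rf\|_{L^p(B_1)}<\infty\}$. $\nabla u$ is the weak gradient of $u$ in $B_1$. The Green's function of the fractional Laplacian $(-\Delta)^s$ in $B_1$ is, for $x\ne y$ in $B_1$, $$G(x,y)=\frac{\kappa(n,s)}{|x-y|^{n-2s}}\int_0^{\rho(x,y)}\frac{t^{s-1}}{(1+t)^{n/2}}dt,\qquad \rho(x,y)=\frac{(1-|x|^2)(1-|y|^2)}{|x-y|^2},$$ with the standard normalization constant $\kappa(n,s)=\frac{\Gamma(n/2)}{2^{2s}\pi^{n/2}\Gamma(s)^2}$. The Green potential is $G\ast f(x)=\int_{B_1}G(x,y)f(y)\,dy$ for (a.e.) $x\in B_1$, and $G\ast f(x)=0$ for $x\in\mathbb{R}^n\setminus B_1$. *)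

(* Defs.v *)
From HB Require Import structures.
From mathcomp Require Import all_boot all_order all_algebra.
From mathcomp Require Import all_classical all_reals all_analysis.
From mathcomp Require Import measurable_realfun ess_sup_inf.

Set Implicit Arguments.
Unset Strict Implicit.
Unset Printing Implicit Defensive.
Import Order.TTheory GRing.Theory Num.Theory.
Import numFieldNormedType.Exports.

Local Open Scope classical_set_scope.
Local Open Scope ring_scope.

(* Row vectors carry the product sigma-algebra; for real entries it is the
   Borel sigma-algebra, see measurable_rowE. *)
Definition measure_row_display : measure_display -> measure_display.
Proof. exact. Qed.

Section measurable_row.
Context {d} {T : measurableType d}.

Section row_sigma_algebra.
Variable n : nat.

Let coord (i : 'I_n) (x : 'rV[T]_n) : T := x ord0 i.

Let row_set0 : g_sigma_preimage coord set0.
Proof. exact: sigma_algebra0. Qed.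

Let row_setC A : g_sigma_preimage coord A -> g_sigma_preimage coord (~` A).
Proof. exact: sigma_algebraC. Qed.

Let row_bigcup (F : _^nat) : (forall i, g_sigma_preimage coord (F i)) ->
  g_sigma_preimage coord (\bigcup_i (F i)).
Proof. exact: sigma_algebra_bigcup. Qed.

HB.instance Definition _ := @isMeasurable.Build (measure_row_display d)
  'rV[T]_n (g_sigma_preimage coord) row_set0 row_setC row_bigcup.

End row_sigma_algebra.

Lemma measurable_coord n (i : 'I_n) :
  measurable_fun [set: 'rV[T]_n] (fun x : 'rV[T]_n => x ord0 i).
Proof.
move=> _ Y mY; rewrite setTI; apply: sub_sigma_algebra => /=.
rewrite -bigcup_seq/=; exists i => /=; first by rewrite mem_index_enum.
by exists Y => //; rewrite setTI.
Qed.

Lemma measurable_fun_rowP d1 (T1 : measurableType d1) n (f : T1 -> 'rV[T]_n) :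
  measurable_fun [set: T1] f <->
  forall i, measurable_fun [set: T1] (fun x => f x ord0 i).
Proof.
split=> [mf i|mf]; first exact: (measurableT_comp (measurable_coord i) mf).
suff : g_sigma_preimage (fun i => (fun x : 'rV[T]_n => x ord0 i) \o f)
    `<=` measurable.
  by rewrite g_sigma_preimage_comp => prefS _ A mA; apply: prefS; exists A.
apply: smallest_sub; first exact: sigma_algebra_measurable.
rewrite -bigcup_seq => A [i _ [B mB <-]].
exact: mf.
Qed.

Definition row_cons n (p : T * 'rV[T]_n) : 'rV[T]_n.+1 :=
  \row_i (if unlift ord0 i is Some j then p.2 ord0 j else p.1).

Definition row_uncons n (x : 'rV[T]_n.+1) : T * 'rV[T]_n :=
  (x ord0 ord0, \row_j x ord0 (lift ord0 j)).

Lemma row_consK n : cancel (@row_cons n) (@row_uncons n).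
Proof.
case=> t y; rewrite /row_uncons mxE unlift_none; congr pair.
by apply/rowP => j; rewrite !mxE liftK.
Qed.

Lemma measurable_row_cons n : measurable_fun setT (@row_cons n).
Proof.
apply/measurable_fun_rowP => i; rewrite /row_cons.
under eq_fun do rewrite mxE.
case: unliftP => [j _|_]; last exact: measurable_fst.
exact: (measurableT_comp (measurable_coord j) measurable_snd).
Qed.

Lemma measurable_row_uncons n : measurable_fun setT (@row_uncons n).
Proof.
apply: measurable_fun_pair; first exact: measurable_coord.
apply/measurable_fun_rowP => i.
under eq_fun do rewrite mxE.
exact: measurable_coord.
Qed.

End measurable_row.

Lemma measurable_row_box d (T : measurableType d) n (A : 'I_n -> set T) :
  (forall i, measurable (A i)) ->
  measurable [set x : 'rV[T]_n | forall i, A i (x ord0 i)].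
Proof.
move=> mA; have -> : [set x : 'rV[T]_n | forall i, A i (x ord0 i)] =
    \big[setI/setT]_(i < n) ((fun x : 'rV[T]_n => x ord0 i) @^-1` A i).
  rewrite -bigcap_seq; apply/seteqP; split => x /= Ax i; first by move=> _; exact: Ax.
  by apply: Ax => /=; rewrite mem_index_enum.
apply: bigsetI_measurable => i _.
by rewrite -[X in measurable X]setTI; exact: measurable_coord.
Qed.

Section lebesgue_measure_row.
Context {R : realType}.

Section step.
Variables (n : nat) (m : {sigma_finite_measure set 'rV[R]_n -> \bar R}).

Definition row_prod_measure : set 'rV[R]_n.+1 -> \bar R :=
  pushforward (@lebesgue_measure R \x m)%E (@row_cons _ R n).

Let m0 : row_prod_measure set0 = 0%E.
Proof. by rewrite /row_prod_measure /pushforward preimage_set0 measure0. Qed.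

Let m_ge0 A : (0 <= row_prod_measure A)%E.
Proof. by rewrite /row_prod_measure /pushforward measure_ge0. Qed.

Let m_sigma_additive : semi_sigma_additive row_prod_measure.
Proof.
move=> F mF tF mUF; rewrite /row_prod_measure /pushforward preimage_bigcup.
apply: measure_semi_sigma_additive.
- by move=> k; rewrite -[_ @^-1` _]setTI; exact: (@measurable_row_cons _ R).
- apply/trivIsetP => /= i j _ _ ij; rewrite -preimage_setI.
  by move/trivIsetP : tF => /(_ _ _ _ _ ij) ->//; rewrite preimage_set0.
- rewrite -preimage_bigcup -[_ @^-1` _]setTI.
  exact: (@measurable_row_cons _ R).
Qed.

HB.instance Definition _ := isMeasure.Build _ _ _
  row_prod_measure m0 m_ge0 m_sigma_additive.

Let m_sigma_finite : sigma_finite setT row_prod_measure.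
Proof.
have /sigma_finiteP[F [TF ndF Foo]] := sigma_finiteT (@lebesgue_measure R).
have /sigma_finiteP[G [TG ndG Goo]] := sigma_finiteT m.
exists (fun k => @row_uncons _ R n @^-1` (F k `*` G k)).
  rewrite -preimage_bigcup -[LHS](preimage_setT (@row_uncons _ R n)).
  congr (_ @^-1` _); rewrite -setXTT TF TG predeqE => -[x y]; split.
    move=> [/= [k _ Fkx] [l _ Gly]]; exists (maxn k l) => //; split.
    - by move: x Fkx; exact/subsetPset/ndF/leq_maxl.
    - by move: y Gly; exact/subsetPset/ndG/leq_maxr.
  by move=> [k _ []/= ? ?]; split; exists k.
move=> k; have [mF Fkoo] := Foo k; have [mG Gkoo] := Goo k; split.
  rewrite -[_ @^-1` _]setTI; apply: (@measurable_row_uncons _ R) => //.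
  exact: measurableX.
rewrite /row_prod_measure /pushforward -comp_preimage.
rewrite (_ : _ \o _ = id) ?preimage_id.
  by rewrite product_measure1E// lte_mul_pinfty// ge0_fin_numE.
by apply/funext => p /=; rewrite row_consK.
Qed.

HB.instance Definition _ := Measure_isSigmaFinite.Build _ _ _
  row_prod_measure m_sigma_finite.

End step.

Fixpoint lebesgue_rV n : {sigma_finite_measure set 'rV[R]_n -> \bar R} :=
  if n is k.+1 then row_prod_measure (lebesgue_rV k)
  else @dirac _ 'rV[R]_0 0 R.

Lemma lebesgue_rV_box n (A : 'I_n -> set R) : (forall i, measurable (A i)) ->
  lebesgue_rV n [set x | forall i, A i (x ord0 i)] =
  (\prod_(i < n) lebesgue_measure (A i))%E.
Proof.
elim: n A => [|n IH] A mA.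
  by rewrite big_ord0 /= diracE mem_set// => -[].
rewrite big_ord_recl -IH//=.
rewrite /row_prod_measure /pushforward.
rewrite -product_measure1E; first last.
- exact: (@measurable_row_box _ R _ (fun i => A (lift ord0 i))).
- exact: mA.
congr (product_measure1 _ _ _); apply/seteqP; split => -[t y]/=.
  move=> Ax; split => [|i].
    by have := Ax ord0; rewrite mxE unlift_none.
  by have := Ax (lift ord0 i); rewrite mxE liftK.
by move=> [At Ay] i; rewrite mxE; case: unliftP => [j ->|->].
Qed.

End lebesgue_measure_row.

Lemma measurable_rowE {R : realType} n :
  @measurable _ 'rV[R]_n = <<s @open 'rV[R]_n >>.
Proof.
apply/seteqP; split.
  apply: smallest_sub; first exact: smallest_sigma_algebra.
  rewrite -bigcup_seq => A [i _ [B mB <-]].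
  have mcoord : measurable_fun [set: g_sigma_algebraType (@open 'rV[R]_n)]
      (fun x : 'rV[R]_n => x ord0 i).
    apply: (measurability _ (RGenOpens.measurableE R)) => _ [_ [a [b ->]] <-].
    apply: sub_sigma_algebra; rewrite setTI.
    by apply: open_comp => [x _|]; [exact: coord_continuous|exact: interval_open].
  exact: (mcoord measurableT B mB).
apply: smallest_sub; first exact: sigma_algebra_measurable.
move=> U oU.
pose box (c : 'rV[rat]_n * nat) : set 'rV[R]_n :=
  [set x | forall i, ball (ratr (c.1 ord0 i) : R) c.2.+1%:R^-1 (x ord0 i)].
have -> : U = \bigcup_c (if `[< box c `<=` U >] then box c else set0).
  apply/seteqP; split => [x Ux|x [c _]]; last first.
    by case: asboolP => // cU; exact: cU.
  have /nbhs_ballP[e /= e0 xeU] : nbhs x U by exact: open_nbhs_nbhs.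
  have [k ke] : exists k, k.+1%:R^-1 < e / 2 :> R.
    by exists (Num.truncn (e / 2)^-1); rewrite invf_plt ?posrE ?divr_gt0// truncnS_gt.
  have /choice[q qx] : forall i, exists q : rat,
      ball (ratr q : R) k.+1%:R^-1 (x ord0 i).
    move=> i.
    have /rat_in_itvoo[q /itvP qx] : x ord0 i - k.+1%:R^-1 < x ord0 i + k.+1%:R^-1.
      by rewrite ltrBlDr -addrA ltrDl addr_gt0.
    by exists q; rewrite /ball /= ltr_distl !qx.
  exists (\row_i q i, k) => //.
  have cx : box (\row_i q i, k) x by move=> i; rewrite /= mxE; exact: qx.
  case: asboolP => // -[] y cy; apply: xeU; split => // i j.
  rewrite ord1 [e]splitr.
  have xq : ball (x ord0 j) (e / 2) (ratr (q j) : R).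
    by apply: (le_ball (ltW ke)); apply: ball_sym; exact: qx.
  have qy : ball (ratr (q j) : R) (e / 2) (y ord0 j).
    by apply: (le_ball (ltW ke)); have := cy j; rewrite /= mxE.
  exact: ball_triangle xq qy.
apply: countable_bigcupT_measurable; first exact: countableP.
move=> c; case: ifP => // _.
apply: (@measurable_row_box _ R n
  (fun i => ball (ratr (c.1 ord0 i) : R) c.2.+1%:R^-1)) => i.
exact: measurable_ball.
Qed.

Section euclidean_ball.
Context {R : realType} {n : nat}.
Local Notation E := 'rV[R]_n.
Implicit Types (x y : E) (f u : E -> R).

(* The library norm on 'rV[R]_n is the sup norm; it is only used here for its
   topology. *)
Definition enorm x : R := Num.sqrt (\sum_i x ord0 i ^+ 2).

Definition unit_ball : set E := [set x | enorm x < 1].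

(* Euclidean distance to the complement of the unit ball. *)
Definition bdist x : R := inf [set enorm (x - y) | y in ~` unit_ball].

Definition loc_integrable (D : set E) f : Prop :=
  measurable_fun D f /\
  forall K, K `<=` D -> compact K ->
    (lebesgue_rV n).-integrable K (EFin \o f).

Definition wnorm (p : \bar R) (r : R) f : \bar R :=
  'N[lebesgue_rV n]_p[EFin \o ((fun x => (bdist x `^ r * f x)%R) \_ unit_ball)]%E.

(* Membership in the space L^p_r of the unit ball; values of f outside the ball
   are irrelevant. *)
Definition wLfun (p : \bar R) (r : R) f : Prop :=
  loc_integrable unit_ball f /\ (wnorm p r f < +oo)%E.

Definition pderiv (i : 'I_n) f : E -> R := 'D_(delta_mx ord0 i) f.

Fixpoint Ck (k : nat) f : Prop :=
  continuous f /\
  if k is k'.+1 then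
    forall i : 'I_n, (forall x, derivable f x (delta_mx ord0 i)) /\
                    Ck k' (pderiv i f)
  else True.

(* Elements of C_c^infty(D), extended by 0 to the whole space. *)
Definition test_function (D : set E) (phi : E -> R) : Prop :=
  (forall k, Ck k phi) /\
  exists K, [/\ compact K, K `<=` D & forall x, ~ K x -> phi x = 0].

(* v is a weak gradient of u in the unit ball; it is unique up to negligible
   sets. *)
Definition weak_gradient u (v : E -> E) : Prop :=
  [/\ loc_integrable unit_ball u,
      forall i, loc_integrable unit_ball (fun x => v x ord0 i) &
      forall phi, test_function unit_ball phi -> forall i,
        \int[lebesgue_rV n]_(x in unit_ball) (u x * pderiv i phi x) =
        - \int[lebesgue_rV n]_(x in unit_ball) (v x ord0 i * phi x)].

End euclidean_ball.

Section green_function.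
Context {R : realType} {n : nat}.
Local Notation E := 'rV[R]_n.
Local Notation leb := (@lebesgue_measure R).
Implicit Types (x y : E) (s z : R).

Definition Gamma z : R := \int[leb]_(t in `]0, +oo[) (t `^ (z - 1) * expR (- t)).

Definition kappa s : R :=
  Gamma (n%:R / 2) / (2 `^ (2 * s) * pi `^ (n%:R / 2) * Gamma s ^+ 2).

Definition rho x y : R :=
  (1 - enorm x ^+ 2) * (1 - enorm y ^+ 2) / enorm (x - y) ^+ 2.

(* Meaningful for distinct x and y in the unit ball only; for 0 < n the
   diagonal is negligible in the integral defining green_potential. *)
Definition green s x y : R :=
  kappa s / enorm (x - y) `^ (n%:R - 2 * s) *
  \int[leb]_(t in `[0, rho x y]) (t `^ (s - 1) / (1 + t) `^ (n%:R / 2)).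

(* The integral converges absolutely for almost every x under the integrability
   assumptions considered on f; elsewhere Rintegral returns an arbitrary real,
   on a negligible set. *)
Definition green_potential s (f : E -> R) : E -> R :=
  (fun x => \int[lebesgue_rV n]_(y in unit_ball) (green s x y * f y))
    \_ unit_ball.

End green_function.

(* Main.v *)
(* Write d(x) = 1 - |x| and z = x - y. For 1 - s <= r <= s, both the Green function
   and its gradient in x are dominated by a weighted Riesz kernel,
     d(x)^r |G(x,y)|, d(x)^r |grad_x G(x,y)| <= C |z|^(2s-1-n) d(y)^r,
   so d^r |grad u| is bounded by the Riesz potential of order 2s - 1 of d^r |f|.
   The three cases are then Young's inequality, the Hardy-Littlewood-Sobolev
   inequality and Hoelder's inequality for this potential.
   That grad_x G gives the weak gradient is seen by replacing |z|^2 with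
   |z|^2 + e, for which the kernel is differentiable in x across the diagonal
   and an integration by parts applies; e tends to 0 by dominated convergence,
   and Fubini's theorem integrates the identity against f(y). *)

Require Import Defs.
From HB Require Import structures.
From mathcomp Require Import all_boot all_order all_algebra.
From mathcomp Require Import all_classical all_reals all_analysis.
From mathcomp Require Import measurable_realfun ess_sup_inf ring lra.

Set Implicit Arguments.
Unset Strict Implicit.
Unset Printing Implicit Defensive.
Import Order.TTheory GRing.Theory Num.Theory.
Import numFieldNormedType.Exports.
Local Open Scope classical_set_scope.
Local Open Scope ring_scope.

(** * Kernels on upper regular spaces *)

Section dyadic_shells.
Context {d} {T : measurableType d} {R : realType}.
Variable mu : {measure set T -> \bar R}.
Implicit Types (h : T -> R) (f : T -> \bar R).

(** The kernel bounds rest on two regimes. If lam = |z| is small against a boundary distance, d(x)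
    is at most a multiple of d(y); otherwise both distances are O(lam), and the decay of the profile
    pays for the weight. The condition r >= 1 - s comes from differentiating 1 - |x|^2, which costs
    d(x)^(s-1); r <= s comes from the decay of order d(y)^s. Beyond lam >= |z| these bounds use only
    |d(x) - d(y)| <= lam, so they hold for lam = sqrt(|z|^2 + e) uniformly in e, and this supplies
    the dominating function. The obstacle is n = 1: as s > 1/2, the profile integral diverges at
    infinity. The estimates therefore go through the combination [green_radial], bounded for every
    n, from which the profile is recovered because s differs from n/2. Since 0 <= r <= 1, factors
    c^r are replaced by c, so no constant depends on r. The inequalities for potentials need only an
    upper bound on the measure of balls; the Hardy-Littlewood-Sobolev one is proved by a level-set
    argument, without interpolation or maximal functions. *)

Lemma powRE (x y : R) : 0 < x -> x `^ y = expR (y * ln x).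
Proof. by move=> x0; rewrite /powR gt_eqF. Qed.

(** At each point of [S] where [f] is positive, a single term of the series of [c m] times the
    indicator of [h < th m] already dominates [f]; termwise integration leaves a geometric series of
    ratio [q]. *)
Lemma le_integral_shells h f (S : set T) (th c : nat -> R) (a q : R) :
  measurable S -> measurable_fun setT h -> measurable_fun S f ->
  (forall z, S z -> (0 <= f z)%E) ->
  0 <= q -> q < 1 -> (forall m, 0 < c m) ->
  (forall m, mu [set z | (h z < th m)%R] <= (a * q ^+ m / c m)%:E)%E ->
  0 <= a ->
  (forall z, S z -> (0 < f z)%E -> exists m, h z < th m /\ (f z <= (c m)%:E)%E) ->
  (\int[mu]_(z in S) f z <= (a / (1 - q))%:E)%E.
Proof.
move=> mS mh mf f0 q0 q1 cp muE a0 ex.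
have mE m : measurable [set z | h z < th m].
  rewrite -[X in measurable X]setTI.
  have -> : [set z | h z < th m] = h @^-1` `]-oo, th m[.
    by apply/seteqP; split => z /=; rewrite in_itv.
  exact: mh.
pose g m z := ((c m)%:E * (\1_[set z | h z < th m] z)%:E)%E : \bar R.
have mg m : measurable_fun S (g m).
  by apply: measurable_funeM; apply/measurable_EFinP; exact: measurable_indic.
have g0 m z : (0 <= g m z)%E by rewrite mule_ge0 ?lee_fin ?(ltW (cp _)).
apply: (@le_trans _ _ (\int[mu]_(z in S) (\sum_(m <oo) g m z))%E).
  apply: ge0_le_integral => //.
  - by apply: ge0_emeasurable_sum => // m z *; exact: g0.
  - move=> z Sz; have [fz|] := ltP 0%E (f z); last first.
      by move=> /le_trans; apply; apply: nneseries_ge0 => *; exact: g0.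
    have [m [hm fm]] := ex z Sz fz.
    rewrite (le_trans fm)//.
    apply: (@le_trans _ _ (\sum_(0 <= i < m.+1) g i z)%E).
      rewrite big_nat_recr//= -[leLHS]add0e leeD ?sume_ge0//.
      by rewrite /g indicE mem_set// mule1.
    exact: nneseries_lim_ge.
rewrite integral_nneseries//.
apply: (@le_trans _ _ (\sum_(m <oo) (geometric a q m)%:E)%E).
  apply: lee_nneseries => m _.
    by move=> _; apply: integral_ge0 => z _; exact: g0.
  rewrite /g ge0_integralZl_EFin ?(ltW (cp m))//; last first.
    by apply/measurable_EFinP; exact: measurable_indic.
  rewrite integral_indic//.
  apply: (@le_trans _ _ ((c m)%:E * (a * q ^+ m / c m)%:E)%E); last first.
    by rewrite -EFinM lee_fin mulrCA divff ?gt_eqF// mulr1.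
  rewrite lee_pmul2l ?lte_fin//.
  rewrite (le_trans _ (muE m))// le_measure ?inE//.
  exact: measurableI.
rewrite le_eqVlt; apply/orP; left; apply/eqP.
apply: (@cvg_lim _ _) => //.
under eq_fun do rewrite sumEFin.
apply: cvg_EFin; first by near=> k.
by apply: cvg_geometric_series; rewrite ger0_norm.
Unshelve. all: by end_near. Qed.

(** The upper half of Ahlfors regularity of dimension [D], with [h] in the role of the distance to a
    fixed centre. *)
Definition upper_regular h (A D : R) := forall rho : R, 0 < rho ->
  (mu [set z | (h z < rho)%R] <= (A * rho `^ D)%:E)%E.

Lemma exp2_bracket (x : R) : 1 <= x -> exists m : nat, 2 ^+ m <= x < 2 ^+ m.+1.
Proof.
move=> x1.
have ex : exists k, x < 2 ^+ k.
  exists (Num.truncn x).+1; apply: (lt_trans (truncnS_gt x)).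
  by rewrite -natrX ltr_nat ltn_expl.
have := ex_minnP ex => -[[|m]] xm min.
  by move: xm; rewrite expr0 ltNge x1.
exists m; rewrite xm andbT leNgt; apply/negP => /min.
by rewrite ltnn.
Qed.

(** Dyadic shells shrink to the centre, and the [m]-th contributes a multiple of 2^(m (a - D)). [C]
    is chosen before [h], because [h] will be the distance to a varying centre. *)
Lemma integral_kernel_near (A D a : R) : 0 < A -> a < D ->
  exists2 C : R, 0 < C & forall h, measurable_fun setT h ->
    upper_regular h A D ->
    forall rho, 0 < rho ->
    (\int[mu]_(z in [set z | (0 < h z < rho)%R]) (h z `^ (- a))%:E <=
     (C * rho `^ (D - a))%:E)%E.
Proof.
move=> A0 aD; exists (A * (2 `^ D * 2 `^ `|a|) / (1 - 2 `^ (a - D))).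
  rewrite divr_gt0 ?mulr_gt0 ?powR_gt0// subr_gt0 powRE//.
  by rewrite expR_lt1 nmulr_rlt0 ?subr_lt0// ln_gt0// ltr1n.
move=> h mh muh rho rho0.
rewrite [leRHS](_ : _ = ((A * (2 `^ D * 2 `^ `|a|) * rho `^ (D - a)) /
  (1 - 2 `^ (a - D)))%:E); last by rewrite mulrAC.
have mS : measurable [set z | (0 < h z < rho)%R].
  rewrite -[X in measurable X]setTI.
  have -> : [set z | (0 < h z < rho)%R] = h @^-1` `]0, rho[.
    by apply/seteqP; split => z /=; rewrite in_itv.
  exact: mh.
(* The factor 2 in the threshold makes the inequality on [h] strict; the factor 2^|a| bounds h^(-a)
   across a shell for either sign of [a]. *)
apply: (@le_integral_shells h _ _ (fun m => 2 * 2 ^- m * rho)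
  (fun m => 2 `^ `|a| * (2 ^- m * rho) `^ (- a))) => //.
- apply/measurable_EFinP.
  apply: measurable_funTS; exact: (measurableT_comp (measurable_powR _) mh).
- by move=> z _; rewrite lee_fin powR_ge0.
- by rewrite powRE// expR_lt1 nmulr_rlt0 ?subr_lt0// ln_gt0// ltr1n.
- by move=> m; rewrite mulr_gt0 ?powR_gt0// mulr_gt0// invr_gt0 exprn_gt0.
- move=> m; apply: (le_trans (muh _ _)).
    by rewrite !mulr_gt0// invr_gt0 exprn_gt0.
  have p0 : 0 < 2 ^- m :> R by rewrite invr_gt0 exprn_gt0.
  rewrite lee_fin ler_pdivlMr; last by rewrite mulr_gt0 ?powR_gt0// mulr_gt0.
  rewrite le_eqVlt; apply/orP; left; apply/eqP.
  rewrite -!mulrA; congr (_ * _).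
  rewrite !powRM ?mulr_ge0 ?(ltW p0) ?(ltW rho0)//.
  rewrite -[2 ^- m]powR_invn//.
  rewrite !powRE ?expR_gt0// -expRM_natl -!expRD !expRK; congr expR; ring.
- by rewrite !mulr_ge0// ?ltW ?powR_gt0.
- move=> z /= /andP[hz0 hzr] _.
  have [|m /andP[m1 m2]] := @exp2_bracket (rho / h z).
    by rewrite ler_pdivlMr// mul1r ltW.
  exists m; split.
    apply: (@le_lt_trans _ _ (2 ^- m * rho)).
      rewrite mulrC ler_pdivlMr ?exprn_gt0//.
      by move: m1; rewrite ler_pdivlMr// mulrC.
    by rewrite -mulrA ltr_pMl ?ltr1n// mulr_gt0// invr_gt0 exprn_gt0.
  have p0 : 0 < 2 ^- m * rho by rewrite mulr_gt0// invr_gt0 exprn_gt0.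
  rewrite lee_fin !(powRE _ p0) !(powRE _ hz0) powRE// -expRD ler_expR.
  have {p0} -> : ln (2 ^- m * rho) = - (ln 2 *+ m) + ln rho.
    by rewrite lnM ?posrE ?invr_gt0 ?exprn_gt0// lnV ?posrE ?exprn_gt0// lnXn.
  have l1 : ln (2 ^+ m) <= ln (rho / h z) by rewrite ler_ln ?posrE ?exprn_gt0 ?divr_gt0.
  have l2 : ln (rho / h z) <= ln (2 ^+ m.+1).
    by rewrite ler_ln ?posrE ?exprn_gt0 ?divr_gt0// ltW.
  move: l1 l2; rewrite !lnXn// lnM ?posrE ?invr_gt0// lnV ?posrE// (mulrS (ln 2)).
  set L := ln 2; set M := L *+ m => l1 l2.
  have e : - M + ln rho - ln (h z) <= L by lra.
  have e' : 0 <= - M + ln rho - ln (h z) by lra.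
  rewrite -subr_ge0.
  rewrite (_ : _ - _ = `|a| * L - a * (- M + ln rho - ln (h z))); last by ring.
  rewrite subr_ge0 (le_trans (ler_norm _))// normrM (ger0_norm e').
  by rewrite ler_wpM2l.
Qed.

(** The shells now grow outwards, and the series converges because [D < b]. As [b >= 0], the kernel
    on a shell is at most its value at the inner radius. *)
Lemma integral_kernel_far (A D b : R) : 0 < A -> D < b -> 0 <= b ->
  exists2 C : R, 0 < C & forall h, measurable_fun setT h ->
    upper_regular h A D ->
    forall rho, 0 < rho ->
    (\int[mu]_(z in [set z | (rho <= h z)%R]) (h z `^ (- b))%:E <=
     (C * rho `^ (D - b))%:E)%E.
Proof.
move=> A0 aD b0; exists (A * 2 `^ D / (1 - 2 `^ (D - b))).
  rewrite divr_gt0 ?mulr_gt0 ?powR_gt0// subr_gt0 powRE//.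
  by rewrite expR_lt1 nmulr_rlt0 ?subr_lt0// ln_gt0// ltr1n.
move=> h mh muh rho rho0.
rewrite [leRHS](_ : _ = ((A * 2 `^ D * rho `^ (D - b)) /
  (1 - 2 `^ (D - b)))%:E); last by rewrite mulrAC.
have mS : measurable [set z | (rho <= h z)%R].
  rewrite -[X in measurable X]setTI.
  have -> : [set z | (rho <= h z)%R] = h @^-1` `[rho, +oo[.
    by apply/seteqP; split => z /=; rewrite in_itv/= andbT.
  exact: mh.
have p0 m : 0 < 2 ^+ m * rho by rewrite mulr_gt0// exprn_gt0.
apply: (@le_integral_shells h _ _ (fun m => 2 * (2 ^+ m * rho))
  (fun m => (2 ^+ m * rho) `^ (- b))) => //.
- apply/measurable_EFinP.
  apply: measurable_funTS; exact: (measurableT_comp (measurable_powR _) mh).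
- by move=> z _; rewrite lee_fin powR_ge0.
- by rewrite powRE// expR_lt1 nmulr_rlt0 ?subr_lt0// ln_gt0// ltr1n.
- by move=> m; rewrite powR_gt0.
- move=> m; apply: (le_trans (muh _ _)); first by rewrite mulr_gt0.
  rewrite lee_fin ler_pdivlMr; last by rewrite powR_gt0.
  rewrite le_eqVlt; apply/orP; left; apply/eqP.
  have q0 : 0 < 2 ^+ m :> R by rewrite exprn_gt0.
  rewrite -!mulrA; congr (_ * _).
  rewrite !powRM ?mulr_ge0 ?(ltW q0) ?(ltW rho0)//.
  rewrite -[2 ^+ m]powR_mulrn//.
  rewrite !powRE ?expR_gt0// -expRM_natl -!expRD !expRK; congr expR; ring.
- by rewrite !mulr_ge0// ?ltW ?powR_gt0.
- move=> z /= rh _; have hz0 := lt_le_trans rho0 rh.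
  have [|m /andP[m1 m2]] := @exp2_bracket (h z / rho).
    by rewrite ler_pdivlMr// mul1r.
  exists m; split.
    by rewrite mulrA -ltr_pdivrMr// -exprS.
  rewrite lee_fin !powRN lef_pV2 ?posrE ?powR_gt0//.
  rewrite ge0_ler_powR ?nnegrE ?(ltW (p0 _)) ?(ltW hz0)//.
  by rewrite -ler_pdivlMr.
Qed.

End dyadic_shells.

(** * Young, Hoelder and Hardy-Littlewood-Sobolev inequalities *)

Section potentials.
Context {d} {T : measurableType d} {R : realType}.

Lemma eq_lee (x y : \bar R) : x = y -> (x <= y)%E.
Proof. by move=> ->. Qed.

Lemma lee_poweR (x y : \bar R) (r : R) : 0 <= r -> (0 <= x)%E -> (x <= y)%E ->
  (x `^ r <= y `^ r)%E.
Proof.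
move=> r0 x0 xy; apply: gt0_ler_poweR => //; rewrite in_itv/= leey andbT//.
exact: le_trans xy.
Qed.

Lemma ge0_hoelder (mu : {measure set T -> \bar R}) (u v : T -> R) (p q : R) :
  measurable_fun setT u -> measurable_fun setT v ->
  (forall x, 0 <= u x) -> (forall x, 0 <= v x) ->
  0 < p -> 0 < q -> p^-1 + q^-1 = 1 ->
  (\int[mu]_x (u x * v x)%:E <=
   (\int[mu]_x (u x `^ p)%:E) `^ p^-1 * (\int[mu]_x (v x `^ q)%:E) `^ q^-1)%E.
Proof.
move=> mu_ mv u0 v0 p0 q0 pq.
have := hoelder mu mu_ mv p0 q0 pq.
have LE (w : T -> R) r : (forall x, 0 <= w x) -> ('N[mu]_(r%:E)[EFin \o w] =
    (\int[mu]_x (w x `^ r)%:E) `^ r^-1)%E.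
  move=> w0; rewrite unlock /=.
  apply: (congr1 (fun z => z `^ r^-1)%E).
  by apply: eq_integral => x _; rewrite ger0_norm.
rewrite (LE u)// (LE v)// Lnorm1; apply: le_trans; apply: eq_lee.
by apply: eq_integral => x _ /=; rewrite ger0_norm ?mulr_ge0.
Qed.

Variable mu : {sigma_finite_measure set T -> \bar R}.

(** Tonelli: integrating in [x] first leaves only the column integrals of [w], which are at most
    [K]. *)
Lemma le_integral_potential (w : T * T -> R) (F : T -> R) (K : \bar R) :
  measurable_fun setT w -> (forall z, 0 <= w z) ->
  measurable_fun setT F -> (forall y, 0 <= F y) -> (0 <= K)%E ->
  (forall y, \int[mu]_x (w (x, y))%:E <= K)%E ->
  (\int[mu]_x \int[mu]_y (w (x, y) * F y)%:E <= K * \int[mu]_y (F y)%:E)%E.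
Proof.
move=> mw w0 mF F0 K0 wK.
have mwF : measurable_fun setT (fun z : T * T => (w z * F z.2)%:E).
  apply/measurable_EFinP; apply: measurable_funM => //.
  exact: (measurableT_comp mF measurable_snd).
rewrite (fubini_tonelli (fun z => (w z * F z.2)%:E))//; last first.
  by move=> z; rewrite lee_fin mulr_ge0.
rewrite -ge0_integralZl//; last 2 first.
- exact/measurable_EFinP.
- by move=> y _; rewrite lee_fin.
apply: ge0_le_integral => //.
- by move=> y _; apply: integral_ge0 => x _; rewrite lee_fin mulr_ge0.
- apply: (measurable_fun_fubini_tonelli_G (fun z => (w z * F z.2)%:E)) => //.
  by move=> z; rewrite lee_fin mulr_ge0.
- by apply: measurable_funeM; exact/measurable_EFinP.
move=> y _ /=.
under eq_integral do rewrite mulrC EFinM.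
rewrite ge0_integralZl_EFin//; last 2 first.
- by move=> x _; rewrite lee_fin.
- apply/measurable_EFinP.
  exact: (measurableT_comp mw (pair2_measurable y)).
by rewrite muleC lee_wpmul2r// lee_fin.
Qed.

(** Hoelder's inequality for the factorization w F = (w F^(1/q)) F^(1/q') bounds g^q by I^(q-1)
    times the potential of [F] with kernel w^q, where [I] is the integral of [F];
    [le_integral_potential] then integrates in [x]. *)
Lemma young_potential (w : T * T -> R) (F g : T -> R) (K : \bar R) (q : R) :
  measurable_fun setT w -> (forall z, 0 <= w z) ->
  measurable_fun setT F -> (forall y, 0 <= F y) ->
  measurable_fun setT g -> (forall y, 0 <= g y) -> (0 <= K)%E ->
  1 <= q -> (forall y, \int[mu]_x (w (x, y) `^ q)%:E <= K)%E ->
  (forall x, (g x)%:E <= \int[mu]_y (w (x, y) * F y)%:E)%E ->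
  (\int[mu]_y (F y)%:E < +oo)%E ->
  (\int[mu]_x (g x `^ q)%:E <= K * (\int[mu]_y (F y)%:E) `^ q)%E.
Proof.
move=> mw w0 mF F0 mg g0 K0 q1 wK gw Foo.
have I0 : (0 <= \int[mu]_y (F y)%:E)%E.
  by apply: integral_ge0 => y _; rewrite lee_fin.
have mwF : measurable_fun setT (fun z : T * T => (w z * F z.2)%:E).
  apply/measurable_EFinP; apply: measurable_funM => //.
  exact: (measurableT_comp mF measurable_snd).
have mwq : measurable_fun setT (fun z : T * T => w z `^ q).
  exact: (measurableT_comp (measurable_powR q) mw).
have mwqF : measurable_fun setT (fun z : T * T => (w z `^ q * F z.2)%:E).
  apply/measurable_EFinP; apply: measurable_funM => //.
  exact: (measurableT_comp mF measurable_snd).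
have wqK := le_integral_potential mwq (fun z => powR_ge0 _ _) mF F0 K0 wK.
(* For [q = 1] the conjugate exponent is infinite, and [le_integral_potential] alone suffices. *)
have [qe|q_gt1] := eqVneq q 1.
  rewrite qe poweRe1//; rewrite qe in wqK.
  apply: le_trans wqK; apply: ge0_le_integral => //.
  - by move=> x _; rewrite lee_fin powR_ge0.
  - by apply/measurable_EFinP; exact: (measurableT_comp (measurable_powR _) mg).
  - apply: (measurable_fun_fubini_tonelli_F (fun z => (w z `^ 1 * F z.2)%:E)).
      by rewrite -qe.
    by move=> z; rewrite lee_fin mulr_ge0// powR_ge0.
  move=> x _; rewrite powRr1//.
  by under eq_integral do rewrite powRr1//.
have {q_gt1}q1' : 1 < q by rewrite lt_neqAle eq_sym q_gt1.
have q0 : 0 < q by lra.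
pose I := fine (\int[mu]_y (F y)%:E)%E.
have IE : (\int[mu]_y (F y)%:E)%E = I%:E by rewrite fineK// ge0_fin_numE.
have I_ge0 : 0 <= I by rewrite -lee_fin -IE.
pose q' := q / (q - 1).
have q'0 : 0 < q' by rewrite divr_gt0// subr_gt0.
have qq' : q^-1 + q'^-1 = 1.
  by rewrite /q' invf_div; field; rewrite ?gt_eqF//= subr_gt0.
have gq x : ((g x `^ q)%:E <=
    (I `^ (q - 1))%:E * \int[mu]_y (w (x, y) `^ q * F y)%:E)%E.
  have wx : measurable_fun setT (fun y => w (x, y)).
    exact: (measurableT_comp mw (pair1_measurable x)).
  have := ge0_hoelder mu (measurable_funM wx (measurableT_comp (measurable_powR q^-1) mF))
    (measurableT_comp (measurable_powR q'^-1) mF) _ _ q0 q'0 qq'.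
  move=> /= H.
  have {}H := H (fun y => mulr_ge0 (w0 _) (powR_ge0 _ _)) (fun y => powR_ge0 _ _).
  have {}H : ((g x)%:E <= (\int[mu]_y (w (x, y) `^ q * F y)%:E) `^ q^-1 *
      (I%:E) `^ q'^-1)%E.
    apply: (le_trans (gw x)); apply: le_trans (le_trans H _).
      apply: eq_lee; apply: eq_integral => y _ /=.
      rewrite -mulrA -powRD; last by rewrite qq' oner_eq0.
      by rewrite qq' powRr1.
    apply: eq_lee; congr (_ * _)%E; congr (_ `^ _)%E.
      apply: eq_integral => y _.
      by rewrite powRM ?powR_ge0// -powRrM mulVf ?gt_eqF// powRr1.
    rewrite -IE; apply: eq_integral => y _.
    by rewrite -powRrM mulVf ?gt_eqF// powRr1.
  rewrite -poweR_EFin.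
  apply: (@le_trans _ _ (((\int[mu]_y (w (x, y) `^ q * F y)%:E) `^ q^-1 *
      (I%:E) `^ q'^-1) `^ q)%E).
    by rewrite lee_poweR ?(ltW q0) ?lee_fin.
  rewrite poweRM ?poweR_ge0// -!poweRrM mulVf ?gt_eqF// poweRe1; last first.
    by apply: integral_ge0 => y _; rewrite lee_fin mulr_ge0// powR_ge0.
  rewrite muleC poweR_EFin /q' invf_div.
  by rewrite -mulrA mulVf ?gt_eqF// mulr1.
apply: (@le_trans _ _ (\int[mu]_x ((I `^ (q - 1))%:E * \int[mu]_y (w (x, y) `^ q * F y)%:E))%E).
  apply: ge0_le_integral => //.
  - by move=> x _; rewrite lee_fin powR_ge0.
  - by apply/measurable_EFinP; exact: (measurableT_comp (measurable_powR _) mg).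
  - apply: measurable_funeM.
    apply: (measurable_fun_fubini_tonelli_F (fun z => (w z `^ q * F z.2)%:E)) => //.
    by move=> z; rewrite lee_fin mulr_ge0// powR_ge0.
rewrite ge0_integralZl_EFin ?powR_ge0//; last 2 first.
- move=> x _; apply: integral_ge0 => y _; by rewrite lee_fin mulr_ge0 ?powR_ge0.
- apply: (measurable_fun_fubini_tonelli_F (fun z => (w z `^ q * F z.2)%:E)) => //.
  by move=> z; rewrite lee_fin mulr_ge0// powR_ge0.
apply: (@le_trans _ _ ((I `^ (q - 1))%:E * (K * I%:E))%E).
  by rewrite lee_wpmul2l ?lee_fin ?powR_ge0// -IE.
by rewrite IE poweR_EFin muleCA -EFinM mulrC mulr_powRB1.
Qed.

Lemma measurable_bool_natr d' (T' : measurableType d') (D : set T') (b : T' -> bool) :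
  measurable_fun D b -> measurable_fun D (fun x => (b x)%:R : R).
Proof.
move=> mb; apply: (@measurableT_comp _ _ _ _ _ _ (fun c : bool => c%:R : R) D b _ mb).
by [].
Qed.

Lemma powR_div (c e x : R) : 0 < c -> 0 < e -> (c / e) `^ x = c `^ x * e `^ (- x).
Proof.
move=> c0 e0; rewrite powRM ?invr_ge0 ?ltW//; congr (_ * _).
by rewrite -powR_inv1 ?ltW// -powRrM mulN1r.
Qed.

Lemma powRV (c x : R) : 0 < c -> c^-1 `^ x = (c `^ x)^-1.
Proof.
by move=> c0; rewrite -powR_inv1 ?ltW// powRAC powR_inv1// powR_ge0.
Qed.

(** * Riesz potentials for a symmetric, upper regular distance function *)

Section riesz.
Variables (dd : T * T -> R) (A D a : R).
Hypothesis mdd : measurable_fun setT dd.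
Hypothesis dd0 : forall z, 0 <= dd z.
Hypothesis ddC : forall x y, dd (x, y) = dd (y, x).
Hypothesis regdd : forall x, upper_regular mu (fun y => dd (x, y)) A D.
Hypotheses (A0 : 0 < A) (a0 : 0 < a) (aD : a < D).

Let mdd1 x : measurable_fun setT (fun y => dd (x, y)).
Proof. exact: (measurableT_comp mdd (pair1_measurable x)). Qed.

Let mdd2 y : measurable_fun setT (fun x => dd (x, y)).
Proof. by under eq_fun do rewrite ddC; exact: mdd1. Qed.

Lemma riesz_near (b : R) : 0 < b -> b < D -> exists2 C : R, 0 < C & forall x (rho : R), 0 < rho ->
  (\int[mu]_y (dd (x, y) `^ (- b) * (dd (x, y) < rho)%R%:R)%:E
    <= (C * rho `^ (D - b))%:E)%E.
Proof.
move=> b0 bD; have [C C0 HC] := integral_kernel_near mu A0 bD; exists C => // x rho rho0.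
apply: le_trans (HC _ (mdd1 x) (regdd x) _ rho0).
rewrite [leRHS]integral_mkcond; apply: eq_lee; apply: eq_integral => y _.
rewrite patchE; case: ifPn => [|/negP].
  by rewrite inE/= => /andP[_ ->]; rewrite mulr1.
rewrite inE/= => h; case: ltP => [h2|]; last by rewrite mulr0.
(* Points at distance 0 lie outside the shell, but the kernel is 0 there, since 0 to a nonzero power
   is 0. *)
rewrite (_ : dd (x, y) = 0); first by rewrite powR0 ?mul0r// oppr_eq0 gt_eqF.
apply/eqP; rewrite eq_le dd0 andbT leNgt; apply/negP => h3.
by apply: h; rewrite h3.
Qed.

Lemma riesz_far (b : R) : D < b -> exists2 C : R, 0 < C & forall x (rho : R), 0 < rho ->
  (\int[mu]_y (dd (x, y) `^ (- b) * (rho <= dd (x, y))%R%:R)%:E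
    <= (C * rho `^ (D - b))%:E)%E.
Proof.
move=> Db; have b0 : 0 <= b by rewrite ltW// (lt_trans _ Db)// (lt_trans a0).
have [C C0 HC] := integral_kernel_far mu A0 Db b0; exists C => // x rho rho0.
apply: le_trans (HC _ (mdd1 x) (regdd x) _ rho0).
rewrite [leRHS]integral_mkcond; apply: eq_lee; apply: eq_integral => y _.
rewrite patchE; case: ifPn => [|/negP].
  by rewrite inE/= => ->; rewrite mulr1.
by rewrite inE/= => /negP/negbTE ->; rewrite mulr0.
Qed.

(** For the conjugate exponent p' the condition D < (D - a) p reads a p' < D, so the truncated
    kernel lies in L^p' uniformly in the centre. *)
Lemma riesz_hoelder (p rho : R) : 0 < rho -> 1 < p -> D < (D - a) * p ->
  exists2 C : R, 0 < C & forall F : T -> R,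
  measurable_fun setT F -> (forall y, 0 <= F y) -> forall x,
  (\int[mu]_y (dd (x, y) `^ (- a) * (dd (x, y) < rho)%R%:R * F y)%:E <=
   C%:E * (\int[mu]_y (F y `^ p)%:E) `^ p^-1)%E.
Proof.
move=> rho0 p1 Dp.
have p0 : 0 < p by lra.
pose p' := p / (p - 1).
have p'0 : 0 < p' by rewrite divr_gt0// subr_gt0.
have pp' : p'^-1 + p^-1 = 1.
  by rewrite /p' invf_div; field; rewrite ?gt_eqF//= subr_gt0.
have bD : a * p' < D.
  by rewrite /p' mulrA ltr_pdivrMr ?subr_gt0//; lra.
have b0 : 0 < a * p' by rewrite mulr_gt0.
have [C C0 HC] := riesz_near b0 bD.
exists ((C * rho `^ (D - a * p')) `^ p'^-1).
  by rewrite powR_gt0// mulr_gt0// powR_gt0.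
move=> F mF F0 x.
have mk : measurable_fun setT (fun y => dd (x, y) `^ (- a) * (dd (x, y) < rho)%R%:R).
  apply: measurable_funM; first exact: (measurableT_comp (measurable_powR _) (mdd1 x)).
  by apply: measurable_bool_natr; apply: measurable_fun_ltr.
apply: (le_trans (ge0_hoelder mu mk mF _ F0 p'0 p0 pp')).
  by move=> y; rewrite mulr_ge0// powR_ge0.
rewrite lee_wpmul2r ?poweR_ge0// -poweR_EFin lee_poweR ?invr_ge0 ?(ltW p'0)//.
  by apply: integral_ge0 => y _; rewrite lee_fin powR_ge0.
apply: le_trans (HC x _ rho0); apply: eq_lee; apply: eq_integral => y _.
congr EFin; case: ltP => _; rewrite ?mulr1 ?mulr0 ?powR0 ?gt_eqF//.
by rewrite -powRrM mulNr.
Qed.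

(** Now a p' > D, so the kernel lies in L^p' away from its centre; the power of [rho] is (D - a p')
    / p'. *)
Lemma riesz_far_hoelder (p : R) : 1 < p -> (D - a) * p < D ->
  exists2 C : R, 0 < C & forall F : T -> R,
  measurable_fun setT F -> (forall y, 0 <= F y) ->
  (\int[mu]_y (F y `^ p)%:E <= 1)%E -> forall x (rho : R), 0 < rho ->
  (\int[mu]_y (dd (x, y) `^ (- a) * (rho <= dd (x, y))%R%:R * F y)%:E <=
   (C * rho `^ (D - a - D / p))%:E)%E.
Proof.
move=> p1 Dp.
have p0 : 0 < p by lra.
pose p' := p / (p - 1).
have p10 : 0 < p - 1 by rewrite subr_gt0.
have p'0 : 0 < p' by rewrite divr_gt0.
have pp' : p'^-1 + p^-1 = 1.
  by rewrite /p' invf_div; field; rewrite ?gt_eqF//= subr_gt0.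
have bD : D < a * p'.
  by rewrite /p' mulrA ltr_pdivlMr ?subr_gt0//; lra.
have [C C0 HC] := riesz_far bD.
exists (C `^ p'^-1); first by rewrite powR_gt0.
move=> F mF F0 F1 x rho rho0.
have mk : measurable_fun setT (fun y => dd (x, y) `^ (- a) * (rho <= dd (x, y))%R%:R).
  apply: measurable_funM; first exact: (measurableT_comp (measurable_powR _) (mdd1 x)).
  by apply: measurable_bool_natr; apply: measurable_fun_ler.
apply: (le_trans (ge0_hoelder mu mk mF _ F0 p'0 p0 pp')).
  by move=> y; rewrite mulr_ge0// powR_ge0.
rewrite -[leRHS]mule1; apply: lee_pmul; rewrite ?poweR_ge0//.
  rewrite (_ : C `^ _ * _ = (C * rho `^ (D - a * p')) `^ p'^-1).
    rewrite -poweR_EFin lee_poweR ?invr_ge0 ?(ltW p'0)//.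
      by apply: integral_ge0 => y _; rewrite lee_fin powR_ge0.
    apply: le_trans (HC x _ rho0); apply: eq_lee; apply: eq_integral => y _.
    congr EFin; case: leP => _; rewrite ?mulr1 ?mulr0 ?powR0 ?gt_eqF//.
    by rewrite -powRrM mulNr.
  rewrite powRM ?powR_ge0 ?(ltW C0)//; congr (_ * _).
  rewrite -powRrM; congr powR; rewrite /p'; field.
  by rewrite !gt_eqF.
rewrite -(poweR1r p^-1) lee_poweR ?invr_ge0 ?(ltW p0)//.
by apply: integral_ge0 => y _; rewrite lee_fin powR_ge0.
Qed.

(** With t = g x, t^q is at most 3 t^(q-1) times the contribution of the close points where [F] is
    large, and there t^(q-1) is bounded both by a power of [F y] and by a power of the inverse
    distance. [V] uses the first bound below the distance [r y] and the second above it; after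
    Tonelli both halves integrate in [x] to a multiple of F(y)^(p-1). *)
Lemma riesz_hls1 (p : R) : 1 < p -> (D - a) * p < D ->
  let q := D * p / (D - (D - a) * p) in
  exists2 C : R, 0 < C & forall F g : T -> R,
  measurable_fun setT F -> (forall y, 0 <= F y) ->
  measurable_fun setT g -> (forall y, 0 <= g y) ->
  (\int[mu]_y (F y `^ p)%:E <= 1)%E ->
  (forall x, (g x)%:E <= \int[mu]_y (dd (x, y) `^ (- a) * F y)%:E)%E ->
  (\int[mu]_x (g x `^ q)%:E <= C%:E)%E.
Proof.
move=> p1 Dp q.
pose al := D - a.
have al0 : 0 < al by rewrite subr_gt0.
have p0 : 0 < p by lra.
have D0 : 0 < D := lt_trans a0 aD.
have dn : 0 < D - al * p by rewrite subr_gt0.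
have q0 : 0 < q by rewrite divr_gt0// mulr_gt0.
have qV : q^-1 = p^-1 - al / D.
  by rewrite /q -/al invf_div; field; rewrite !gt_eqF.
have q1 : 1 < q.
  by rewrite /q -/al ltr_pdivlMr// mul1r; nra.
have [C1 C10 far1] := riesz_far_hoelder p1 Dp.
have [C2 C20 near2] := riesz_near a0 aD.
(* The distance bound on t^(q-1) turns the kernel of exponent [a] into one of exponent [b]; [D < b]
   makes it integrable at infinity. *)
pose b := a + D * (q - 1) / q.
have bE : b = D + D * (1 - p^-1).
  rewrite /b mulrBr mulr1 mulrBl mulfK ?gt_eqF// qV /al.
  by field; rewrite !gt_eqF.
have bD : D < b.
  rewrite bE ltrDl mulr_gt0// subr_gt0 invf_lt1//.
have [C3 C30 far3] := riesz_far bD.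
(* [c1] and [c2] solve the requirement that the far part and the part with small [F] come out as t/3
   each. *)
pose c1 := (3 * C1) `^ (q / D).
have c10 : 0 < c1 by rewrite powR_gt0// mulr_gt0.
pose c2 := (3 * C2 * c1 `^ al)^-1.
have c20 : 0 < c2 by rewrite invr_gt0 !mulr_gt0// powR_gt0.
pose C4 := C2 * c2 `^ (- (p * (q - 1) / q)) + c1 `^ (D * (q - 1) / q) * C3.
exists (3 * C4).
  by rewrite mulr_gt0// addr_gt0// mulr_gt0// powR_gt0.
move=> F g mF F0 mg g0 F1 gF.
have C40 : 0 <= C4 by rewrite ltW// addr_gt0// mulr_gt0// powR_gt0.
(* Up to constants, [r y] is the distance at which the two bounds on t^(q-1) balance. *)
pose r y := F y `^ (- (p / D)).
pose V (z : T * T) := (F z.2 / c2) `^ (p * (q - 1) / q) *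
      (dd z `^ (- a) * (dd z < r z.2)%R%:R) +
    c1 `^ (D * (q - 1) / q) * (dd z `^ (- b) * (r z.2 <= dd z)%R%:R).
have V0 z : 0 <= V z by rewrite addr_ge0 ?mulr_ge0 ?powR_ge0.
have mF2 : measurable_fun setT (fun z : T * T => F z.2).
  exact: (measurableT_comp mF measurable_snd).
have mr : measurable_fun setT (fun z : T * T => r z.2).
  exact: (measurableT_comp (measurable_powR _) mF2).
have mdp (e : R) : measurable_fun setT (fun z => dd z `^ e).
  exact: (measurableT_comp (measurable_powR _) mdd).
have mV : measurable_fun setT V.
  apply: measurable_funD; apply: measurable_funM.
  - apply: (measurableT_comp (measurable_powR _)).
    by apply: measurable_funM => //.
  - apply: measurable_funM => //.
    by apply: measurable_bool_natr; apply: measurable_fun_ltr.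
  - by [].
  - apply: measurable_funM => //.
    by apply: measurable_bool_natr; apply: measurable_fun_ler.
have mFV : measurable_fun setT (fun z : T * T => (F z.2 * V z)%:E).
  by apply/measurable_EFinP; apply: measurable_funM.
have FV0 z : (0 <= (F z.2 * V z)%:E)%E by rewrite lee_fin mulr_ge0.
(* The level-set argument: at height t = g x the potential outside the ball of
   radius rho ~ t^(-q/D), and the part of it due to {F <= m}, m ~ t^(q/p),
   each contribute at most t/3. *)
have key x : ((g x `^ q)%:E <= 3%:E * \int[mu]_y (F y * V (x, y))%:E)%E.
  have [gx|gx] := eqVneq (g x) 0.
    rewrite gx powR0 ?gt_eqF// mule_ge0 ?lee_fin//.
    by apply: integral_ge0 => y _; exact: (FV0 (x, y)).
  have {gx} t0 : 0 < g x by rewrite lt_neqAle eq_sym gx g0.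
  set t := g x in t0 *.
  pose rho := c1 * t `^ (- (q / D)).
  have rho0 : 0 < rho by rewrite mulr_gt0// powR_gt0.
  pose m := c2 * t `^ (q / p).
  have m0 : 0 < m by rewrite mulr_gt0// powR_gt0.
  pose k y := dd (x, y) `^ (- a).
  have mk : measurable_fun setT k.
    exact: (measurableT_comp (measurable_powR _) (mdd1 x)).
  have k0 y : 0 <= k y by rewrite powR_ge0.
  pose W y := k y * (dd (x, y) < rho)%R%:R * (m < F y)%R%:R * F y.
  have W0 y : 0 <= W y by rewrite !mulr_ge0.
  have mlt : measurable_fun setT (fun y => ((dd (x, y) < rho)%R%:R : R)).
    by apply: measurable_bool_natr; apply: measurable_fun_ltr.
  have mge : measurable_fun setT (fun y => ((rho <= dd (x, y))%R%:R : R)).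
    by apply: measurable_bool_natr; apply: measurable_fun_ler.
  have mW : measurable_fun setT W.
    apply: measurable_funM => //; apply: measurable_funM => //.
      exact: measurable_funM.
    by apply: measurable_bool_natr; apply: measurable_fun_ltr.
  have i1 : (\int[mu]_y (k y * (rho <= dd (x, y))%R%:R * F y)%:E <= (t / 3)%:E)%E.
    apply: (le_trans (far1 F mF F0 F1 x rho rho0)); rewrite lee_fin.
    rewrite le_eqVlt; apply/orP; left; apply/eqP.
    rewrite /rho -/al powRM ?powR_ge0 ?(ltW c10)// /c1 -!powRrM.
    have -> : q / D * (al - D / p) = -1.
      have -> : al - D / p = - (D / q) by rewrite qV; field; rewrite !gt_eqF.
      by field; rewrite !gt_eqF.
    have -> : - (q / D) * (al - D / p) = 1.
      have -> : al - D / p = - (D / q) by rewrite qV; field; rewrite !gt_eqF.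
      by field; rewrite !gt_eqF.
    rewrite powRr1 ?(ltW t0)// powR_inv1 ?mulr_ge0 ?(ltW C10)//.
    by field; rewrite gt_eqF.
  have i2 : (\int[mu]_y (m * (k y * (dd (x, y) < rho)%R%:R))%:E <= (t / 3)%:E)%E.
    under eq_integral do rewrite EFinM.
    rewrite ge0_integralZl_EFin ?(ltW m0)//; last 2 first.
    - by move=> y _; rewrite lee_fin mulr_ge0.
    - by apply/measurable_EFinP; exact: measurable_funM.
    apply: (@le_trans _ _ (m%:E * (C2 * rho `^ (D - a))%:E)%E).
      by rewrite lee_pmul2l ?lte_fin// near2.
    rewrite -EFinM lee_fin le_eqVlt; apply/orP; left; apply/eqP.
    rewrite -/al /rho /m powRM ?powR_ge0 ?(ltW c10)// -powRrM /c2.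
    have -> : - (q / D) * al = 1 - q / p.
      have -> : al = D * (p^-1 - q^-1) by rewrite qV; field; rewrite !gt_eqF.
      by field; rewrite !gt_eqF.
    rewrite (@powRD _ t 1); last by rewrite (gt_eqF t0) implybT.
    rewrite powRr1 ?(ltW t0)// powRN.
    by field; rewrite !gt_eqF// powR_gt0.
  have tW : (t%:E <= 3%:E * \int[mu]_y (W y)%:E)%E.
    have h : (t%:E <= (t / 3)%:E + (t / 3)%:E + \int[mu]_y (W y)%:E)%E.
      apply: (le_trans (gF x)).
      apply: (@le_trans _ _ (\int[mu]_y (k y * (rho <= dd (x, y))%R%:R * F y)%:E +
         \int[mu]_y (m * (k y * (dd (x, y) < rho)%R%:R))%:E +
         \int[mu]_y (W y)%:E)%E); last by rewrite leeD// leeD.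
      have m1 : measurable_fun setT (fun y => (k y * (rho <= dd (x, y))%R%:R * F y)%:E).
        by apply/measurable_EFinP; apply: measurable_funM => //; exact: measurable_funM.
      have m2 : measurable_fun setT (fun y => (m * (k y * (dd (x, y) < rho)%R%:R))%:E).
        by apply/measurable_EFinP; apply: measurable_funM => //; exact: measurable_funM.
      rewrite -ge0_integralD//; last 2 first.
      - by move=> y _; rewrite lee_fin !mulr_ge0.
      - by move=> y _; rewrite lee_fin (mulr_ge0 (ltW m0))// mulr_ge0.
      rewrite -ge0_integralD//; last 4 first.
      - move=> y _; rewrite -EFinD lee_fin addr_ge0//; first by rewrite !mulr_ge0.
        by rewrite (mulr_ge0 (ltW m0))// mulr_ge0.
      - exact: emeasurable_funD.
      - by move=> y _; rewrite lee_fin.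
      - exact/measurable_EFinP.
      apply: ge0_le_integral => //.
      - by move=> y _; rewrite lee_fin (mulr_ge0 (k0 y)).
      - by apply/measurable_EFinP; exact: (measurable_funM mk mF).
      - by apply: emeasurable_funD; [exact: emeasurable_funD|exact/measurable_EFinP].
      move=> y _; rewrite -!EFinD lee_fin /W -/(k y).
      case: ltP => _; rewrite ?mulr1 ?mulr0 ?mul0r ?addr0 ?add0r//.
      case: ltP => [_|Fm]; rewrite ?mulr1 ?mulr0 ?mul0r ?addr0//.
        by rewrite lerDr mulr_ge0// ltW.
      by rewrite mulrC ler_wpM2r.
    have : (0 <= \int[mu]_y (W y)%:E)%E by apply: integral_ge0 => y _; rewrite lee_fin.
    move: h; case: (\int[mu]_y (W y)%:E)%E => [w| |//].
      by rewrite -!EFinD -EFinM !lee_fin => h _; lra.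
    by move=> _ _; rewrite gt0_muley ?lte_fin// leey.
  have -> : t `^ q = t `^ (q - 1) * t by rewrite mulrC mulr_powRB1// ltW.
  rewrite EFinM.
  apply: (@le_trans _ _ ((t `^ (q - 1))%:E * (3%:E * \int[mu]_y (W y)%:E))%E).
    by rewrite lee_pmul2l ?lte_fin ?powR_gt0.
  rewrite muleCA lee_pmul2l ?lte_fin// -ge0_integralZl_EFin ?powR_ge0//; last 2 first.
  - by move=> y _; rewrite lee_fin.
  - exact/measurable_EFinP.
  apply: ge0_le_integral => //.
  - by move=> y _; rewrite -EFinM lee_fin mulr_ge0// powR_ge0.
  - by apply: measurable_funeM; exact/measurable_EFinP.
  - exact: (measurableT_comp mFV (pair1_measurable x)).
  move=> y _; rewrite -EFinM lee_fin /W.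
  case: ltP => [drho|_]; last by rewrite mulr0 !mul0r mulr0 mulr_ge0.
  case: ltP => [mFy|_]; last by rewrite mulr0 !mul0r mulr0 mulr_ge0.
  rewrite !mulr1 mulrA mulrC ler_wpM2l//.
  have Fy0 : 0 < F y := lt_trans m0 mFy.
  have tF : t `^ (q - 1) <= (F y / c2) `^ (p * (q - 1) / q).
    have : t `^ (q / p) <= F y / c2 by rewrite ler_pdivlMr// mulrC ltW.
    have e0 : 0 <= p * (q - 1) / q by rewrite ltW// divr_gt0// mulr_gt0// subr_gt0.
    move/(ge0_ler_powR e0); rewrite !nnegrE powR_ge0 divr_ge0 ?(ltW Fy0) ?(ltW c20)//.
    move=> /(_ isT isT); rewrite -powRrM.
    by congr (t `^ _ <= _); field; rewrite !gt_eqF.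
  rewrite /V /=; case: (ltP (dd (x, y)) (r y)) => _.
    by rewrite mulr1 mulr0 mulr0 addr0 ler_wpM2r.
  rewrite mulr0 mulr0 add0r mulr1.
  have [d0|d0] := eqVneq (dd (x, y)) 0.
    by rewrite /k d0 powR0 ?mulr0 ?mulr_ge0 ?powR_ge0// oppr_eq0 gt_eqF.
  have {}d0 : 0 < dd (x, y) by rewrite lt_neqAle eq_sym d0 dd0.
  rewrite (_ : dd (x, y) `^ (- b) = dd (x, y) `^ (- (D * (q - 1) / q)) * k y).
    rewrite mulrA ler_wpM2r//.
    have : t `^ (q / D) <= c1 / dd (x, y).
      rewrite ler_pdivlMr// -ler_pdivlMl ?powR_gt0// mulrC -powRN.
      exact: ltW.
    have e0 : 0 <= D * (q - 1) / q by rewrite ltW// divr_gt0// mulr_gt0// subr_gt0.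
    move/(ge0_ler_powR e0); rewrite !nnegrE powR_ge0 divr_ge0 ?(ltW d0) ?(ltW c10)//.
    move=> /(_ isT isT); rewrite -powRrM.
    rewrite powR_div//.
    by congr (t `^ _ <= _); field; rewrite !gt_eqF.
  rewrite /k -powRD; last by rewrite (gt_eqF d0) implybT.
  by congr powR; rewrite /b; lra.
apply: (@le_trans _ _ (3%:E * \int[mu]_x \int[mu]_y (F y * V (x, y))%:E)%E).
  rewrite -ge0_integralZl_EFin//; last 2 first.
  - by move=> x _; apply: integral_ge0 => y _; exact: (FV0 (x, y)).
  - exact: (measurable_fun_fubini_tonelli_F (fun z => (F z.2 * V z)%:E)).
  apply: ge0_le_integral => //.
  - by move=> x _; rewrite lee_fin powR_ge0.
  - by apply/measurable_EFinP; exact: (measurableT_comp (measurable_powR _) mg).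
  - apply: measurable_funeM.
    exact: (measurable_fun_fubini_tonelli_F (fun z => (F z.2 * V z)%:E)).
rewrite EFinM lee_pmul2l ?lte_fin//.
rewrite (fubini_tonelli (fun z => (F z.2 * V z)%:E))//=.
apply: (@le_trans _ _ (\int[mu]_y (C4%:E * (F y `^ p)%:E))%E); last first.
  rewrite ge0_integralZl_EFin//; last 2 first.
  - by move=> y _; rewrite lee_fin powR_ge0.
  - by apply/measurable_EFinP; exact: (measurableT_comp (measurable_powR _) mF).
  by rewrite -[leRHS]mule1 lee_wpmul2l.
apply: ge0_le_integral => //.
- by move=> y _; apply: integral_ge0 => x _; exact: (FV0 (x, y)).
- exact: (measurable_fun_fubini_tonelli_G (fun z => (F z.2 * V z)%:E)).
- apply: measurable_funeM.
  by apply/measurable_EFinP; exact: (measurableT_comp (measurable_powR _) mF).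
move=> y _.
have [Fy|Fy] := eqVneq (F y) 0.
  rewrite (eq_integral (fun=> 0%E)); last by move=> x _; rewrite Fy mul0r.
  by rewrite integral0 mule_ge0// lee_fin// powR_ge0.
have {Fy} v0 : 0 < F y by rewrite lt_neqAle eq_sym Fy F0.
have r0 : 0 < r y by rewrite powR_gt0.
under eq_integral do rewrite EFinM.
rewrite ge0_integralZl_EFin ?(ltW v0)//; last 2 first.
- by move=> x _; rewrite lee_fin.
- by apply/measurable_EFinP; exact: (measurableT_comp mV (pair2_measurable y)).
have mn : measurable_fun setT (fun x => (dd (x, y) `^ (- a) * (dd (x, y) < r y)%R%:R)%:E).
  apply/measurable_EFinP; apply: measurable_funM.
    exact: (measurableT_comp (measurable_powR _) (mdd2 y)).
  by apply: measurable_bool_natr; apply: measurable_fun_ltr.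
have mf : measurable_fun setT (fun x => (dd (x, y) `^ (- b) * (r y <= dd (x, y))%R%:R)%:E).
  apply/measurable_EFinP; apply: measurable_funM.
    exact: (measurableT_comp (measurable_powR _) (mdd2 y)).
  by apply: measurable_bool_natr; apply: measurable_fun_ler.
rewrite /V /=; under eq_integral do rewrite EFinD EFinM [X in (_ + X)%E]EFinM.
rewrite ge0_integralD//; last 4 first.
- by move=> x _; rewrite -EFinM lee_fin !mulr_ge0// powR_ge0.
- exact: measurable_funeM.
- by move=> x _; rewrite -EFinM lee_fin !mulr_ge0// powR_ge0.
- exact: measurable_funeM.
rewrite !ge0_integralZl_EFin ?powR_ge0//; last 2 first.
- by move=> x _; rewrite lee_fin !mulr_ge0// powR_ge0.
- by move=> x _; rewrite lee_fin !mulr_ge0// powR_ge0.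
have n2 := near2 y _ r0; have f3 := far3 y _ r0.
under [X in (_ * X + _)%E]eq_integral do rewrite ddC.
under [X in (_ + _ * X)%E]eq_integral do rewrite ddC.
apply: (@le_trans _ _ ((F y)%:E *
   (((F y / c2) `^ (p * (q - 1) / q))%:E * (C2 * r y `^ (D - a))%:E +
   (c1 `^ (D * (q - 1) / q))%:E * (C3 * r y `^ (D - b))%:E))%E).
  by rewrite lee_pmul2l ?lte_fin// leeD// lee_wpmul2l// lee_fin powR_ge0.
rewrite -!EFinM lee_fin le_eqVlt; apply/orP; left; apply/eqP.
clearbody c1 c2; rewrite /r powR_div// -!powRrM.
rewrite -(@mulr_powRB1 _ (F y) p) ?(ltW v0)// [RHS]mulrCA; congr (_ * _).
have -> : - (p / D) * (D - b) = p - 1 by rewrite bE; field; rewrite !gt_eqF.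
have e2 : p - 1 = p * (q - 1) / q + - (p / D) * (D - a).
  rewrite -/al.
  have -> : al = D * (p^-1 - q^-1) by rewrite qV; field; rewrite !gt_eqF.
  by field; rewrite !gt_eqF.
have -> : F y `^ (p - 1) = F y `^ (p * (q - 1) / q) * F y `^ (- (p / D) * (D - a)).
  by rewrite e2 powRD// (gt_eqF v0) implybT.
by rewrite /C4; ring.
Qed.

(** By homogeneity: [riesz_hls1] is applied to F / M and g / (C0 M). *)
Lemma riesz_hls (C0 p : R) : 0 < C0 -> 1 < p -> (D - a) * p < D ->
  let q := D * p / (D - (D - a) * p) in
  exists2 C : R, 0 < C & forall F g : T -> R,
  measurable_fun setT F -> (forall y, 0 <= F y) ->
  measurable_fun setT g -> (forall y, 0 <= g y) ->
  (\int[mu]_y (F y `^ p)%:E < +oo)%E ->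
  (forall x, (g x)%:E <= C0%:E * \int[mu]_y (dd (x, y) `^ (- a) * F y)%:E)%E ->
  ((\int[mu]_x (g x `^ q)%:E) `^ q^-1 <=
   C%:E * (\int[mu]_y (F y `^ p)%:E) `^ p^-1)%E.
Proof.
move=> C00 p1 Dp q.
have p0 : 0 < p by lra.
have D0 : 0 < D := lt_trans a0 aD.
have q0 : 0 < q by rewrite divr_gt0 ?mulr_gt0// subr_gt0.
have [C C_gt0 H] := riesz_hls1 p1 Dp; rewrite -/q in H.
exists (C `^ q^-1 * C0); first by rewrite mulr_gt0// powR_gt0.
move=> F g mF F0 mg g0 Foo gF.
have Ip0 : (0 <= \int[mu]_y (F y `^ p)%:E)%E.
  by apply: integral_ge0 => y _; rewrite lee_fin powR_ge0.
pose n := fine ((\int[mu]_y (F y `^ p)%:E) `^ p^-1)%E.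
have nE : ((\int[mu]_y (F y `^ p)%:E) `^ p^-1 = n%:E)%E.
  by rewrite fineK// fin_num_poweR// ge0_fin_numE.
have n0 : 0 <= n by rewrite -lee_fin -nE poweR_ge0.
have C'0 : 0 < C `^ q^-1 * C0 by rewrite mulr_gt0// powR_gt0.
rewrite nE -(lee_pdivrMl _ _ C'0); apply/lee_addgt0Pr => e e0.
rewrite (lee_pdivrMl _ _ C'0).
(* [M] exceeds the norm by [e], so that it can be divided by even when [F] is null; since [e] is
   arbitrary, nothing is lost. *)
pose M := n + e.
have M0 : 0 < M by rewrite ltr_wpDl.
have {}H := H (fun y => M^-1 * F y) (fun x => C0^-1 * (M^-1 * g x)).
have mMF : measurable_fun setT (fun y => M^-1 * F y) by exact: measurable_funM.
have Mi0 : 0 <= M^-1 by rewrite invr_ge0 ltW.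
have Ci0 : 0 <= C0^-1 by rewrite invr_ge0 ltW.
have scal (u : T -> R) (l r : R) : 0 <= l -> measurable_fun setT u -> (forall x, 0 <= u x) ->
    (\int[mu]_x ((l * u x) `^ r)%:E = (l `^ r)%:E * \int[mu]_x (u x `^ r)%:E)%E.
  move=> l0 mu_ u0; under eq_integral do rewrite powRM// EFinM.
  rewrite ge0_integralZl_EFin ?powR_ge0//.
  - by move=> x _; rewrite lee_fin powR_ge0.
  - by apply/measurable_EFinP; exact: (measurableT_comp (measurable_powR _) mu_).
have {}H := H mMF (fun y => mulr_ge0 Mi0 (F0 y)).
have mMg : measurable_fun setT (fun y => M^-1 * g y) by exact: measurable_funM.
have Mg0 y : 0 <= M^-1 * g y by rewrite mulr_ge0.
have {}H := H (measurable_funM (measurable_cst _) mMg) (fun y => mulr_ge0 Ci0 (Mg0 y)).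
have F1 : (\int[mu]_y ((M^-1 * F y) `^ p)%:E <= 1)%E.
  rewrite scal// powRV//.
  rewrite lee_pdivrMl ?powR_gt0// mule1.
  have -> : (\int[mu]_y (F y `^ p)%:E = (n `^ p)%:E)%E.
    rewrite -poweR_EFin -nE -poweRrM mulVf ?gt_eqF// poweRe1//.
  by rewrite lee_fin ge0_ler_powR ?nnegrE// ?ltW// ltrDl.
have gF1 x : ((C0^-1 * (M^-1 * g x))%:E <=
    \int[mu]_y (dd (x, y) `^ (- a) * (M^-1 * F y))%:E)%E.
  rewrite EFinM lee_pdivrMl//.
  under eq_integral do rewrite mulrCA EFinM.
  rewrite ge0_integralZl_EFin//; last 2 first.
  - by move=> y _; rewrite lee_fin mulr_ge0// powR_ge0.
  - apply/measurable_EFinP; apply: measurable_funM => //.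
    exact: (measurableT_comp (measurable_powR _) (mdd1 x)).
  by rewrite muleCA EFinM lee_wpmul2l.
have {}H := H F1 gF1.
have -> : (n%:E + e%:E)%E = M%:E by [].
rewrite [leRHS](_ : _ = ((C * (C0 * M) `^ q) `^ q^-1)%:E); last first.
  rewrite -EFinM powRM ?powR_ge0 ?(ltW C_gt0)// -powRrM divff ?gt_eqF//.
  by rewrite powRr1 ?mulr_ge0 ?(ltW C00) ?(ltW M0)// mulrA.
rewrite -poweR_EFin; apply: lee_poweR; first by rewrite invr_ge0 ltW.
  by apply: integral_ge0 => y _; rewrite lee_fin powR_ge0.
move: H; rewrite scal// scal// muleA -EFinM.
have -> : C0^-1 `^ q * M^-1 `^ q = ((C0 * M) `^ q)^-1.
  by rewrite -powRM// -invfM powRV// mulr_gt0.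
by rewrite lee_pdivrMl ?powR_gt0 ?mulr_gt0// -EFinM mulrC.
Qed.

End riesz.

End potentials.

(** * The Euclidean norm and Lebesgue measure on row vectors *)

Section euclidean_norm.
Context {R : realType} {n : nat}.
Local Notation E := 'rV[R]_n.
Implicit Types x y : E.

Lemma enorm_ge0 x : 0 <= enorm x.
Proof. exact: sqrtr_ge0. Qed.

Lemma enorm_sqr x : enorm x ^+ 2 = \sum_i x ord0 i ^+ 2.
Proof. by rewrite sqr_sqrtr// sumr_ge0// => i _; rewrite sqr_ge0. Qed.

Lemma enorm0 : enorm (0 : E) = 0.
Proof. by rewrite /enorm big1 ?sqrtr0// => i _; rewrite mxE expr0n. Qed.

Lemma enormN x : enorm (- x) = enorm x.
Proof. by rewrite /enorm; congr Num.sqrt; apply: eq_bigr => i _; rewrite mxE sqrrN. Qed.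

Lemma enormBC x y : enorm (x - y) = enorm (y - x).
Proof. by rewrite -enormN opprB. Qed.

Lemma ler_coord_enorm x i : `|x ord0 i| <= enorm x.
Proof.
rewrite -(@ler_pXn2r _ 2) ?nnegrE ?enorm_ge0// enorm_sqr real_normK ?num_real//.
by rewrite (bigD1 i)//= lerDl sumr_ge0// => j _; rewrite sqr_ge0.
Qed.

Lemma enorm_eq0 x : enorm x = 0 -> x = 0.
Proof.
move=> x0; apply/rowP => i; rewrite mxE; apply/eqP.
by rewrite -normr_le0 -x0 ler_coord_enorm.
Qed.

Lemma enormZ (a : R) x : enorm (a *: x) = `|a| * enorm x.
Proof.
rewrite /enorm -sqrtr_sqr -sqrtrM ?sqr_ge0//; congr Num.sqrt.
by rewrite mulr_sumr; apply: eq_bigr => i _; rewrite mxE exprMn.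
Qed.

(** In each coordinate 2 u v <= (Y/X) u^2 + (X/Y) v^2, weighted by the two norms X and Y. *)
Lemma dot_le_enorm x y : \sum_i x ord0 i * y ord0 i <= enorm x * enorm y.
Proof.
have [x0|xn0] := eqVneq (enorm x) 0.
  rewrite x0 mul0r (enorm_eq0 x0) big1// => i _; by rewrite mxE mul0r.
have [y0|yn0] := eqVneq (enorm y) 0.
  rewrite y0 mulr0 (enorm_eq0 y0) big1// => i _; by rewrite mxE mulr0.
set X := enorm x in xn0 *; set Y := enorm y in yn0 *.
have X0 : 0 < X by rewrite lt_neqAle eq_sym xn0 enorm_ge0.
have Y0 : 0 < Y by rewrite lt_neqAle eq_sym yn0 enorm_ge0.
suff : 2 * \sum_i x ord0 i * y ord0 i <= 2 * (X * Y) by rewrite ler_pM2l.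
rewrite mulr_sumr.
apply: (@le_trans _ _ (\sum_i (Y / X * x ord0 i ^+ 2 + X / Y * y ord0 i ^+ 2))).
  apply: ler_sum => i _; rewrite -subr_ge0.
  set u := x ord0 i; set v := y ord0 i.
  have -> : Y / X * u ^+ 2 + X / Y * v ^+ 2 - 2 * (u * v) =
      (Y * u - X * v) ^+ 2 / (X * Y) by field; rewrite xn0 yn0.
  by rewrite divr_ge0 ?sqr_ge0// mulr_ge0// ltW.
rewrite big_split/= -!mulr_sumr -!enorm_sqr -/X -/Y.
rewrite le_eqVlt; apply/orP; left; apply/eqP.
by field; rewrite xn0 yn0.
Qed.

Lemma ler_enormD x y : enorm (x + y) <= enorm x + enorm y.
Proof.
rewrite -(@ler_pXn2r _ 2) ?nnegrE ?addr_ge0 ?enorm_ge0// enorm_sqr.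
under eq_bigr do rewrite mxE sqrrD.
rewrite !big_split/= -!enorm_sqr sqrrD.
by rewrite lerD2r lerD2l mulr2n lerD// dot_le_enorm.
Qed.

Lemma ler_enorm_dist x y : `|enorm x - enorm y| <= enorm (x - y).
Proof.
rewrite ler_norml; apply/andP; split.
  by rewrite lerNl opprB lerBlDr enormBC -[leLHS]/(enorm y) -{1}(subrK x y) ler_enormD.
by rewrite lerBlDr -{1}(subrK y x) ler_enormD.
Qed.

Lemma continuous_enorm : continuous (@enorm R n).
Proof.
have cs (s : seq 'I_n) : continuous (fun x : E => \sum_(i <- s) x ord0 i ^+ 2).
  elim: s => [|i s IH] x.
    rewrite (_ : (fun y : E => _) = cst 0); first exact: cst_continuous.
    by apply/funext => y; rewrite big_nil.
  rewrite (_ : (fun y : E => _) =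
      (fun y => y ord0 i * y ord0 i) \+ (fun y => \sum_(j <- s) y ord0 j ^+ 2)).
    have ci := @coord_continuous R 1 n ord0 i x.
    by apply: continuousD; [exact: continuousM|exact: IH].
  by apply/funext => y; rewrite big_cons expr2.
move=> x; rewrite /enorm.
apply: (continuous_comp (f := fun x : E => \sum_i x ord0 i ^+ 2)); first exact: cs.
exact: sqrt_continuous.
Qed.

Lemma row_open_measurable (U : set E) : open U -> measurable U.
Proof. by rewrite measurable_rowE => oU; exact: sub_sigma_algebra. Qed.

Lemma row_closed_measurable (U : set E) : closed U -> measurable U.
Proof.
by move=> cU; rewrite -(setCK U); apply: measurableC; apply: row_open_measurable; exact: closed_openC.
Qed.

Lemma row_compact_measurable (U : set E) : compact U -> measurable U.
Proof. by move=> cU; apply: row_closed_measurable; exact: compact_closed. Qed.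

Lemma row_continuous_measurable (f : E -> R) : continuous f -> measurable_fun setT f.
Proof.
move=> cf; apply: (measurability _ (RGenOpens.measurableE R)) => _ [_ [a [b ->]] <-].
rewrite setTI; apply: row_open_measurable; apply: open_comp; last exact: interval_open.
by move=> x _; exact: cf.
Qed.

Lemma measurable_enorm : measurable_fun setT (@enorm R n).
Proof. exact: row_continuous_measurable continuous_enorm. Qed.

Lemma measurable_row_sub : measurable_fun setT (fun z : E * E => z.1 - z.2).
Proof.
apply/measurable_fun_rowP => i.
under eq_fun do rewrite !mxE.
by apply: measurable_funB;
  [exact: (measurableT_comp (measurable_coord i) measurable_fst)|
   exact: (measurableT_comp (measurable_coord i) measurable_snd)].
Qed.

Lemma measurable_edist : measurable_fun setT (fun z : E * E => enorm (z.1 - z.2)).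
Proof. exact: (measurableT_comp measurable_enorm measurable_row_sub). Qed.

Lemma open_unit_ball : open (@unit_ball R n).
Proof.
have -> : @unit_ball R n = @enorm R n @^-1` `]-oo, 1[.
  by apply/seteqP; split => x; rewrite /unit_ball/= in_itv.
by apply: open_comp; [move=> x _; exact: continuous_enorm|exact: interval_open].
Qed.

Lemma measurable_unit_ball : measurable (@unit_ball R n).
Proof. exact: row_open_measurable open_unit_ball. Qed.

(** The Euclidean ball sits in a cube of side 2 rho. *)
Lemma upper_regular_lebesgue_rV x :
  upper_regular (@lebesgue_rV R n) (fun y => enorm (x - y)) (2 ^+ n) n%:R.
Proof.
move=> rho rho0.
apply: (@le_trans _ _ (lebesgue_rV n [set y : E | forall i, ball (x ord0 i) rho (y ord0 i)])).
  apply: le_measure; rewrite ?inE.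
  - rewrite -[X in measurable X]setTI.
    have -> : [set z : E | enorm (x - z) < rho] = (fun z => enorm (x - z)) @^-1` `]-oo, rho[.
      by apply/seteqP; split => z /=; rewrite in_itv.
    exact: (measurableT_comp measurable_edist (pair1_measurable x)).
  - apply: (@measurable_row_box _ R _ (fun i => ball (x ord0 i) rho)) => i.
    exact: measurable_ball.
  - move=> y /= xy i; rewrite /ball/=; apply: le_lt_trans xy.
    by have := ler_coord_enorm (x - y) i; rewrite !mxE.
rewrite (@lebesgue_rV_box R n (fun i => ball (x ord0 i) rho)); last first.
  by move=> i; exact: measurable_ball.
under eq_bigr do rewrite lebesgue_measure_ball ?ltW//.
rewrite -[X in (X <= _)%E](_ : (\prod_(i < n) (rho *+ 2))%:E = _); last first.
  by elim/big_rec2 : _ => // i a b _ <-.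
by rewrite lee_fin prodr_const card_ord -[rho *+ 2]mulr_natl exprMn powR_mulrn// ltW.
Qed.

Hypothesis n0 : (0 < n)%N.

Let e0 : E := delta_mx ord0 (Ordinal n0).

Lemma enorm_delta (i : 'I_n) : enorm (delta_mx ord0 i : E) = 1.
Proof.
rewrite /enorm (bigD1 i)//= big1 ?addr0; last first.
  by move=> j ji; rewrite mxE/= eq_sym eq_sym (negbTE ji) expr0n.
by rewrite mxE !eqxx expr1n sqrtr1.
Qed.

(** The nearest point of the complement is x / |x|, or any unit vector when x = 0; [0 < n]
    guarantees that one exists. *)
Lemma bdistE x : unit_ball x -> bdist x = 1 - enorm x.
Proof.
move=> x1; apply/eqP; rewrite eq_le; apply/andP; split.
  pose u := if x == 0 then e0 else (enorm x)^-1 *: x.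
  have u1 : enorm u = 1.
    rewrite /u; case: ifPn => [_|x0]; first exact: enorm_delta.
    have xn0 : enorm x != 0 by apply: contra x0 => /eqP/enorm_eq0 ->.
    by rewrite enormZ ger0_norm ?invr_ge0 ?enorm_ge0// mulVf.
  have xu : x = enorm x *: u.
    rewrite /u; case: ifPn => [/eqP ->|x0]; first by rewrite enorm0 scale0r.
    have xn0 : enorm x != 0 by apply: contra x0 => /eqP/enorm_eq0 ->.
    by rewrite scalerA mulfV// scale1r.
  have -> : 1 - enorm x = enorm (x - u).
    rewrite {2}xu -{2}(scale1r u) -scalerBl enormZ u1 mulr1 distrC ger0_norm//.
    by rewrite subr_ge0 ltW.
  apply: ge_inf; last by exists u => //=; rewrite /unit_ball/= u1 ltxx.
  by exists 0 => _ [y _ <-]; exact: enorm_ge0.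
apply: lb_le_inf.
  by exists (enorm (x - e0)); exists e0 => //=; rewrite /unit_ball/= enorm_delta ltxx.
move=> _ [y /= y1 <-].
rewrite /unit_ball/= in y1; move/negP : y1; rewrite -leNgt => y1.
by rewrite enormBC lerBlDr (le_trans y1)// -{1}(subrK x y) ler_enormD.
Qed.

Lemma lebesgue_rV_set1 x : lebesgue_rV n [set x] = 0%E.
Proof.
have -> : [set x] = [set y : E | forall i, [set x ord0 i] (y ord0 i)].
  apply/seteqP; split => y /=; first by move=> ->.
  by move=> H; apply/rowP => i; exact: H.
rewrite (@lebesgue_rV_box R n (fun i => [set x ord0 i]))//.
rewrite (bigD1 (Ordinal n0))//= lebesgue_measure_set1 mul0e//.
Qed.

Lemma lebesgue_rV_ball_lty : (lebesgue_rV n (@unit_ball R n) < +oo)%E.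
Proof.
have := @upper_regular_lebesgue_rV 0 1 ltr01.
have -> : [set z : E | enorm (0 - z) < 1] = @unit_ball R n.
  by apply/seteqP; split => z /=; rewrite sub0r enormN.
by move=> /le_lt_trans; apply; rewrite ltry.
Qed.

End euclidean_norm.

(** * Translation invariance of Lebesgue measure on row vectors *)

Section translation.
Context {R : realType}.

Lemma lebesgue_measure_translation (v : R) (A : set R) : measurable A ->
  lebesgue_measure ((fun t => t + v) @^-1` A) = lebesgue_measure A.
Proof.
move=> mA.
have mf : measurable_fun setT ((fun t => t + v) : measurableTypeR R -> measurableTypeR R).
  by apply: measurable_funD.
have := @lebesgue_measure_unique R (pushforward (@lebesgue_measure R)
  ((fun t => t + v) : measurableTypeR R -> measurableTypeR R)).
rewrite /pushforward => H; apply/esym; apply: H => //.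
move=> X [[a b]] _ <- /=; rewrite /pushforward.
have -> : (+%R^~ v) @^-1` `]a, b]%classic = `]a - v, b - v]%classic.
  by apply/seteqP; split => x /=; rewrite !in_itv/= ltrBlDr lerBrDr.
rewrite !lebesgue_measure_itv/= !lte_fin ltrD2r; case: ifP => // _.
by rewrite -!EFinB; congr EFin; ring.
Qed.

Lemma measurable_row_translation n (v : 'rV[R]_n) :
  measurable_fun setT (fun x : 'rV[R]_n => x + v).
Proof.
apply/measurable_fun_rowP => i; under eq_fun do rewrite mxE.
by apply: measurable_funD => //; exact: measurable_coord.
Qed.

(** Induction on the dimension: through [row_cons] the translation acts on each factor separately,
    and a product measure is determined by rectangles. *)
Lemma lebesgue_rV_translation n (v : 'rV[R]_n) (A : set 'rV[R]_n) : measurable A ->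
  lebesgue_rV n ((fun x => x + v) @^-1` A) = lebesgue_rV n A.
Proof.
elim: n v A => [|n IH] v A mA.
  congr (lebesgue_rV 0 _); apply/seteqP.
  by split => x /=; rewrite (_ : x + v = x)//; apply/rowP; case.
rewrite /= /row_prod_measure /pushforward.
set m := (lebesgue_measure \x _)%E.
pose v' : 'rV[R]_n := \row_j v ord0 (lift ord0 j).
pose tau (p : measurableTypeR R * 'rV[R]_n) : measurableTypeR R * 'rV[R]_n :=
  (p.1 + v ord0 ord0, p.2 + v').
have mtau : measurable_fun setT tau.
  apply: measurable_fun_pair.
    by apply: measurable_funD => //; exact: measurable_fst.
  exact: (measurableT_comp (measurable_row_translation v') measurable_snd).
have e p : @row_cons _ R n p + v = @row_cons _ R n (tau p).
  apply/rowP => i; rewrite !mxE; case: unliftP => [j ->|->] //=.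
  by rewrite !mxE.
have mB : measurable (@row_cons _ R n @^-1` A).
  by rewrite -[X in measurable X]setTI; exact: (@measurable_row_cons _ R).
have -> : @row_cons _ R n @^-1` ((fun x => x + v) @^-1` A) =
    tau @^-1` (@row_cons _ R n @^-1` A).
  by apply/seteqP; split => p /=; rewrite e.
have := @product_measure_unique _ _ _ _ _ (@lebesgue_measure R) (lebesgue_rV n)
  (pushforward m tau).
rewrite /pushforward => H; apply/esym; apply: H => // B C mB' mC.
change (m (((fun t => t + v ord0 ord0) @^-1` B) `*` ((fun x => x + v') @^-1` C)) =
  (lebesgue_measure B * lebesgue_rV n C)%E).
rewrite /m product_measure1E; last 2 first.
- rewrite -[X in measurable X]setTI.
  have mD : measurable_fun setT (fun t : R => t + v ord0 ord0) by apply: measurable_funD.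
  exact: mD.
- rewrite -[X in measurable X]setTI; exact: measurable_row_translation.
congr (_ * _)%E; first exact: lebesgue_measure_translation.
exact: IH.
Qed.

Lemma pushforward_translation n (v : 'rV[R]_n) (g : 'rV[R]_n -> \bar R) :
  (\int[pushforward (lebesgue_rV n) (fun x => x + v)%R]_x g x = \int[lebesgue_rV n]_x g x)%E.
Proof.
have mt := measurable_row_translation v.
have mN : forall A, measurable A ->
    pushforward (lebesgue_rV n) (fun x => x + v) A = lebesgue_rV n A.
  by move=> A mA; exact: lebesgue_rV_translation.
by apply: eq_measure_integral => A mA _; exact: mN.
Qed.

Lemma integrable_translation n (v : 'rV[R]_n) (f : 'rV[R]_n -> \bar R) :
  (lebesgue_rV n).-integrable setT f ->
  (lebesgue_rV n).-integrable setT (fun x => f (x + v)%R).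
Proof.
move=> intf; have mf : measurable_fun setT f by case/integrableP : intf.
have mt := measurable_row_translation v.
apply/integrableP; split; first exact: (measurableT_comp mf mt).
case/integrableP : intf => _; apply: le_lt_trans.
rewrite -(pushforward_translation v (fun x => `|f x|%E)) ge0_integral_pushforward//=.
exact: measurableT_comp.
Qed.

Lemma integral_translation n (v : 'rV[R]_n) (f : 'rV[R]_n -> \bar R) :
  (lebesgue_rV n).-integrable setT f ->
  (\int[lebesgue_rV n]_x f (x + v)%R = \int[lebesgue_rV n]_x f x)%E.
Proof.
move=> intf; have mf : measurable_fun setT f by case/integrableP : intf.
have mt := measurable_row_translation v.
rewrite -(pushforward_translation v f) integral_pushforward//.
exact: integrable_translation.
Qed.

End translation.

(** * The radial profile of the Green function *)

Section radial_profile.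
Context {R : realType}.
Variables s nu : R.
Hypotheses (s_gt : 2^-1 < s) (s_lt : s < 1) (nu_ge : 2^-1 <= nu).
Local Notation leb := (@lebesgue_measure R).

Local Ltac slra := have ? := s_gt; have ? := s_lt; have ? := nu_ge; lra.

Let s0 : 0 < s. Proof. slra. Qed.
Let nu0 : 0 < nu. Proof. slra. Qed.

Definition green_density (t : R) : R := t `^ (s - 1) / (1 + t) `^ nu.

Definition green_profile (z : R) : R := \int[leb]_(t in `[0, z]) green_density t.

Lemma powR_ge1 (x y : R) : 1 <= x -> 0 <= y -> 1 <= x `^ y.
Proof. by move=> x1 y0; have := ler_powR x1 y0; rewrite powRr0. Qed.

(* [(2 nu - 2 s) H + 2 z H'] is what remains of the radial derivative of
   [w^(s - nu) H (c / w)]; unlike H itself it stays bounded when [nu = 1/2]. *)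
Definition green_radial (z : R) : R :=
  2 * (nu - s) * green_profile z + 2 * (z * green_density z).

Lemma green_density_ge0 t : 0 <= green_density t.
Proof. by rewrite divr_ge0// powR_ge0. Qed.

Lemma measurable_green_density : measurable_fun setT green_density.
Proof.
apply: measurable_funM; first exact: measurable_powR.
rewrite (_ : (fun x => _) = (fun t => (1 + t) `^ (- nu))); last first.
  by apply/funext => t; rewrite powRN.
by apply: (measurableT_comp (measurable_powR _)); exact: measurable_funD.
Qed.

(** Dropping the denominator, which is at least 1, leaves |t|^(s-1) on the line, an upper regular
    space of dimension 1. *)
Lemma green_profile_integral_le : exists2 C : R, 0 < C & forall z : R, 0 < z ->
  (\int[leb]_(t in `[0%R, z]) (green_density t)%:E <= (C * z `^ s)%:E)%E.
Proof.
have s1 : 1 - s < 1 by slra.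
have [C C0 HC] := integral_kernel_near (@lebesgue_measure R) (ltr0n R 2) s1.
exists (C * 2 `^ s); first by rewrite mulr_gt0// powR_gt0.
move=> z z0.
have reg : upper_regular (@lebesgue_measure R) (fun t : R => `|t|) 2 1.
  move=> rho rho0; rewrite powRr1 ?(ltW rho0)//.
  have -> : [set t : R | `|t| < rho] = ball 0 rho.
    by apply/seteqP; split => t; rewrite /ball/= sub0r normrN.
  by apply: (le_trans (eq_lee (lebesgue_measure_ball 0 (ltW rho0)))); rewrite lee_fin mulr_natl.
(* Radius 2 z fits the closed interval into the strict inequality of [integral_kernel_near]. *)
have z20 : 0 < 2 * z by rewrite mulr_gt0.
have := HC _ (@normr_measurable R setT) reg _ z20.
rewrite (_ : 1 - (1 - s) = s); last by slra.
rewrite powRM ?(ltW z0)// mulrA; apply: le_trans.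
rewrite [leLHS]integral_mkcond [leRHS]integral_mkcond.
have mk : measurable_fun setT (fun t : R => (`|t| `^ (- (1 - s)))%:E).
  by apply/measurable_EFinP; apply: (measurableT_comp (measurable_powR _)); exact: normr_measurable.
have mS : measurable [set t : R | (0 < `|t| < 2 * z)%R].
  rewrite -[X in measurable X]setTI.
  have -> : [set t : R | (0 < `|t| < 2 * z)%R] = (fun t : R => `|t|) @^-1` `]0, 2 * z[.
    by apply/seteqP; split => t /=; rewrite in_itv.
  exact: normr_measurable.
apply: ge0_le_integral => //.
- by move=> t _; rewrite patchE; case: ifP => // _; rewrite lee_fin green_density_ge0.
- apply: (measurable_restrictT _ _).1 => //.
  by apply/measurable_EFinP; apply: measurable_funTS; exact: measurable_green_density.
- by apply: (measurable_restrictT _ _).1 => //; exact: measurable_funTS.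
move=> t _; rewrite !patchE; case: ifPn => [|_]; last first.
  by case: ifP => // _; rewrite lee_fin powR_ge0.
rewrite inE/= in_itv/= => /andP[t0 tz].
have [->|tn0] := eqVneq t 0.
  rewrite /green_density powR0 ?mul0r; last by slra.
  by case: ifP => // _; rewrite lee_fin powR_ge0.
rewrite ifT; last first.
  by rewrite inE/= normr_gt0 tn0 ger0_norm// (le_lt_trans tz)//; slra.
rewrite lee_fin /green_density ger0_norm// opprB ler_pdivrMr ?powR_gt0//; last by slra.
rewrite ler_peMr ?powR_ge0//.
by rewrite powR_ge1//; slra.
Qed.

Lemma integrable_green_density z : leb.-integrable `[0, z] (EFin \o green_density).
Proof.
apply/integrableP; split.
  by apply/measurable_EFinP; apply: measurable_funTS; exact: measurable_green_density.
have [C _ HC] := green_profile_integral_le.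
pose M : R := Num.max z 1.
have z0 : 0 < M by rewrite lt_max ltr01 orbT.
under eq_integral => x _ do rewrite /= ger0_norm ?green_density_ge0//.
apply: (@le_lt_trans _ _ (\int[leb]_(t in `[0%R, M]) (green_density t)%:E)%E).
  apply: ge0_subset_integral => //.
  - by apply/measurable_EFinP; apply: measurable_funTS; exact: measurable_green_density.
  - by move=> t _; rewrite lee_fin green_density_ge0.
  - by apply: subset_itvl; rewrite bnd_simp le_max lexx.
by rewrite (le_lt_trans (HC _ z0))// ltry.
Qed.

Lemma green_profile_ge0 z : 0 <= green_profile z.
Proof. by apply: Rintegral_ge0 => t _; exact: green_density_ge0. Qed.

Lemma EFin_green_profile z :
  (green_profile z)%:E = (\int[leb]_(t in `[0%R, z]) (green_density t)%:E)%E.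
Proof.
rewrite /green_profile /Rintegral fineK//.
exact: integrable_fin_num (integrable_green_density z).
Qed.

Lemma green_profile_le : exists2 C : R, 0 < C & forall z : R, 0 < z ->
  green_profile z <= C * z `^ s.
Proof.
have [C C0 H] := green_profile_integral_le; exists C => // z z0.
by rewrite -lee_fin EFin_green_profile H.
Qed.

Lemma green_profile_nd : {homo green_profile : x y / x <= y}.
Proof.
move=> x y xy; rewrite -lee_fin !EFin_green_profile.
apply: ge0_subset_integral => //.
- by apply/measurable_EFinP; apply: measurable_funTS; exact: measurable_green_density.
- by move=> t _; rewrite lee_fin green_density_ge0.
- by apply: subset_itvl; rewrite bnd_simp.
Qed.

Lemma measurable_green_profile : measurable_fun setT green_profile.
Proof. exact: nondecreasing_measurable green_profile_nd. Qed.

Lemma is_derive_green_density (z : R) : 0 < z -> is_derive z 1 green_density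
  ((s - 1) * z `^ (s - 2) * (1 + z) `^ (- nu) - nu * z `^ (s - 1) * (1 + z) `^ (- nu - 1)).
Proof.
move=> z0.
have -> : green_density = (fun t : R => t `^ (s - 1)) \* ((fun u : R => u `^ (- nu)) \o (fun t : R => 1 + t)).
  by apply/funext => t /=; rewrite /green_density powRN.
have z1 : 0 < 1 + z by slra.
have d1 := is_derive1_powR (s - 1) z0.
have d2 := is_derive1_powR (- nu) z1.
have d3 : is_derive z 1 (fun t : R => 1 + t) 1.
  by have := is_deriveD (is_derive_cst (1 : R) z (1 : R)) (is_derive_id z (1 : R)); rewrite add0r.
have d4 := @is_derive1_comp _ _ _ _ _ _ d2 d3.
apply: (is_derive_eq (is_deriveM d1 d4)); rewrite /= /GRing.scale/=.
rewrite (_ : s - 1 - 1 = s - 2); last by slra.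
ring.
Qed.

Lemma continuous_green_density (z : R) : 0 < z -> {for z, continuous green_density}.
Proof.
move=> z0; have [d _] := is_derive_green_density z0.
exact/differentiable_continuous/derivable1_diffP.
Qed.

Lemma is_derive_green_profile (z : R) : 0 < z ->
  is_derive z 1 green_profile (green_density z).
Proof.
move=> z0.
have zz : z < z + 1 by slra.
have [d e] := continuous_FTC1_closed zz (integrable_green_density _) z0 (continuous_green_density z0).
split; first exact: d.
rewrite -derive1E; exact: e.
Qed.

(** The terms carrying [s] cancel. What remains decays like z^(s-nu-2) and is integrable at
    infinity, whereas the density decays only like z^(s-1-nu). *)
Lemma is_derive_green_radial (z : R) : 0 < z ->
  is_derive z 1 green_radial (2 * nu * z `^ (s - 1) * (1 + z) `^ (- nu - 1)).
Proof.
move=> z0.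
have d1 := is_derive_green_profile z0.
have d2 := is_derive_green_density z0.
have -> : green_radial = (2 * (nu - s)) \*: green_profile + 2 \*: (id \* green_density).
  by apply/funext => t.
apply: (is_derive_eq (is_deriveD (is_deriveZ (2 * (nu - s)) d1)
  (is_deriveZ 2 (is_deriveM (is_derive_id z 1) d2)))); rewrite /= /GRing.scale/= /green_density -powRN.
have -> : z `^ (s - 1) = z `^ (s - 2) * z.
  rewrite -{3}(powRr1 (ltW z0)) -powRD; last by rewrite (gt_eqF z0) implybT.
  by congr powR; slra.
have -> : (1 + z) `^ (- nu) = (1 + z) `^ (- nu - 1) * (1 + z).
  have z1 : 0 < 1 + z by slra.
  rewrite -{3}(powRr1 (ltW z1)) -powRD; last by rewrite (gt_eqF z1) implybT.
  by congr powR; slra.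
ring.
Qed.

Lemma green_density_le z : 0 < z -> z * green_density z <= z `^ s.
Proof.
move=> z0; rewrite /green_density mulrA ler_pdivrMr ?powR_gt0//; last by slra.
rewrite mulr_powRB1 ?(ltW z0)// ler_peMr ?powR_ge0//.
by rewrite powR_ge1//; slra.
Qed.

(** Both terms of [green_radial] are O(z^s), which settles z <= 1. Beyond 1 the function is bounded:
    it is nondecreasing, and it becomes nonincreasing once a multiple of z^(s-1) is added. *)
Lemma green_radial_le : exists2 C : R, 0 < C & forall z r : R, 0 < z -> 0 <= r -> r <= s ->
  `|green_radial z| <= C * z `^ r.
Proof.
have [C C0 HC] := green_profile_le.
pose B := 2 * `|nu - s| * C + 2.
have B0 : 0 < B by rewrite ltr_wpDl// !mulr_ge0// ltW.
have le_s (z : R) : 0 < z -> `|green_radial z| <= B * z `^ s.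
  move=> z0; rewrite (le_trans (ler_normD _ _))// /B [leRHS]mulrDl lerD//.
    rewrite !normrM (ger0_norm (green_profile_ge0 _)) ger0_norm// -!mulrA.
    rewrite ler_pM2l// ler_wpM2l// HC//.
  rewrite normrM ger0_norm// (ger0_norm (mulr_ge0 (ltW z0) (green_density_ge0 z))).
  by rewrite ler_pM2l// green_density_le.
(* Chosen so that c z^(s-1) has derivative -2 nu z^(s-2), which outweighs the derivative of
   [green_radial]. *)
pose c := 2 * nu / (1 - s).
have c0 : 0 < c by rewrite divr_gt0 ?mulr_gt0// subr_gt0.
have drad (z : R) : 0 < z -> is_derive z 1 green_radial (2 * nu * z `^ (s - 1) * (1 + z) `^ (- nu - 1)).
  exact: is_derive_green_radial.
have der (z : R) : 0 < z -> is_derive z 1 (green_radial + c \*: (fun u : R => u `^ (s - 1)))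
    (2 * nu * z `^ (s - 1) * (1 + z) `^ (- nu - 1) - 2 * nu * z `^ (s - 2)).
  move=> z0; apply: (is_derive_eq (is_deriveD (drad z z0) (is_deriveZ c (is_derive1_powR (s - 1) z0)))); rewrite /= /GRing.scale/= /c.
  rewrite (_ : s - 1 - 1 = s - 2); last by slra.
  by field; slra.
have up (z : R) : 1 <= z -> green_radial z <= B + c.
  move=> z1.
  have := @ler0_derive1_nincry R (green_radial + c \*: (fun u : R => u `^ (s - 1))) 1.
  move=> H; have {}H : (green_radial + c \*: (fun u : R => u `^ (s - 1))) z <=
      (green_radial + c \*: (fun u : R => u `^ (s - 1))) 1.
    apply: (H _ _ _ _ _ (lexx 1) z1).
    - move=> x; rewrite in_itv/= andbT => x1.
      have x0 : 0 < x by slra.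
      by have [] := der x x0.
    - move=> x; rewrite in_itv/= andbT => x1.
      have x0 : 0 < x by slra.
      rewrite derive1E; have [_ ->] := der x x0.
      rewrite subr_le0 -!mulrA ler_pM2l// ler_pM2l//.
      have -> : s - 2 = s - 1 - 1 by slra.
      rewrite [leRHS]powRB; last by rewrite (gt_eqF x0) implybT.
      rewrite ler_pM2l ?powR_gt0// powRr1 ?(ltW x0)//.
      rewrite -powR_inv1 ?(ltW x0)//.
      apply: (@le_trans _ _ ((1 + x) `^ (- 1))); first by rewrite ler_powR; slra.
      by rewrite !powR_inv1 ?lef_pV2 ?posrE; slra.
    - apply: continuous_in_subspaceT => x; rewrite inE/= in_itv/= andbT => x1.
      have x0 : 0 < x by slra.
      have [d _] := der x x0.
      exact/differentiable_continuous/derivable1_diffP.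
  have b1 := le_trans (ler_norm _) (le_s 1 ltr01); rewrite powR1 mulr1 in b1.
  have : 0 <= c * z `^ (s - 1) by rewrite mulr_ge0 ?powR_ge0// ltW.
  have {}H : green_radial z + c * z `^ (s - 1) <= green_radial 1 + c * 1 `^ (s - 1) := H.
  rewrite powR1 in H; lra.
have lo (z : R) : 1 <= z -> - B <= green_radial z.
  move=> z1.
  have H : green_radial 1 <= green_radial z.
    apply: (@ger0_derive1_ndecry R green_radial 1 _ _ _ _ _ (lexx 1) z1).
    - move=> x; rewrite in_itv/= andbT => x1.
      have x0 : 0 < x by slra.
      by have [] := drad x x0.
    - move=> x; rewrite in_itv/= andbT => x1.
      have x0 : 0 < x by slra.
      rewrite derive1E; have [_ ->] := drad x x0.
      by rewrite !mulr_ge0 ?powR_ge0// ltW.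
    - apply: continuous_in_subspaceT => x; rewrite inE/= in_itv/= andbT => x1.
      have x0 : 0 < x by slra.
      have [d _] := drad x x0.
      exact/differentiable_continuous/derivable1_diffP.
  have := le_s 1 ltr01; rewrite powR1 mulr1 ler_norml => /andP[]; slra.
exists (B + c); first by rewrite addr_gt0.
move=> z r z0 r0 rs; have [z1|z1] := lerP z 1.
  apply: (le_trans (le_s z z0)).
  apply: ler_pM; rewrite ?powR_ge0 ?(ltW B0)//; first slra.
  by apply: ger_powR => //; rewrite z0.
apply: (@le_trans _ _ ((B + c) * 1)).
  rewrite mulr1 ler_norml up ?(ltW z1)// andbT (le_trans _ (lo _ (ltW z1)))//; slra.
by apply: ler_wpM2l; [rewrite ltW// addr_gt0|apply: powR_ge1 => //; exact: ltW].
Qed.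

End radial_profile.

(** * Pointwise bounds with boundary weights *)

Section kernel_estimates.
Context {R : realType}.
Variables s nu : R.
Hypotheses (s_gt : 2^-1 < s) (s_lt : s < 1) (nu_ge : 2^-1 <= nu).
Local Ltac slra := have ? := s_gt; have ? := s_lt; have ? := nu_ge; lra.
Local Notation h := (green_density s nu).
Local Notation H := (green_profile s nu).
Local Notation Phi := (green_radial s nu).

(** Because c >= 1 and r <= 1, c^r <= c; this keeps the later constants independent of [r]. *)
Lemma ger0_powR_le (c x y : R) : 0 <= x -> x <= c * y -> 1 <= c -> 0 <= y ->
  forall r, 0 <= r -> r <= 1 -> x `^ r <= c * y `^ r.
Proof.
move=> x0 xy c1 y0 r r0 r1.
apply: (@le_trans _ _ ((c * y) `^ r)).
  by apply: ge0_ler_powR => //; rewrite nnegrE mulr_ge0//; lra.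
rewrite powRM//; last lra.
by rewrite ler_wpM2r ?powR_ge0// ler1_powR.
Qed.

(** Here [dx], [dy] stand for the boundary distances of x and y, [a], [b] for 1 - |x|^2 and 1 -
    |y|^2, and [lam] for the regularized |x - y|. *)
Lemma radial_weight_le : exists2 C : R, 0 < C &
  forall lam dx dy a b r : R, 0 < lam -> 0 < dx -> 0 < dy -> `|dx - dy| <= lam ->
    0 < a -> a <= 2 * dx -> 0 < b -> b <= 2 * dy -> 0 <= r -> r <= s ->
    dx `^ r * `|Phi (a * b / lam ^+ 2)| <= C * dy `^ r.
Proof.
have [C C0 HC] := green_radial_le s_gt s_lt nu_ge.
exists (16 * C); first by rewrite mulr_gt0.
move=> lam dx dy a b r lam0 dx0 dy0 dxy a0 a2 b0 b2 r0 rs.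
have r1 : r <= 1 by slra.
have rho0 : 0 < a * b / lam ^+ 2 by rewrite !mulr_gt0// invr_gt0 exprn_gt0.
move: dxy; rewrite ler_distl => /andP[d1 d2].
(* If lam <= dy, then dx <= 2 dy and boundedness of [Phi] (exponent 0) is enough. Otherwise dx <= 2
   lam, and decay of order [r] is used with dx rho <= 4 dx^2 dy / lam^2 <= 16 dy, where rho is the
   argument of [Phi]. *)
have [l1|l1] := lerP lam dy.
  have : `|Phi (a * b / lam ^+ 2)| <= C.
    by have := HC _ 0 rho0; rewrite powRr0 mulr1; apply; slra.
  move=> P; apply: (@le_trans _ _ ((2 * dy `^ r) * C)).
    apply: ler_pM => //; first exact: powR_ge0.
    by apply: ger0_powR_le; lra.
  rewrite mulrC [leRHS]mulrAC -mulrA mulrC -mulrA.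
  have : 0 <= dy `^ r * C by rewrite mulr_ge0 ?powR_ge0// ltW.
  lra.
apply: (@le_trans _ _ (dx `^ r * (C * (a * b / lam ^+ 2) `^ r))).
  by rewrite ler_wpM2l ?powR_ge0// HC.
rewrite mulrCA [leRHS]mulrAC mulrC ler_wpM2r//; first exact: ltW.
rewrite -powRM ?(ltW dx0) ?(ltW rho0)//.
apply: ger0_powR_le; [exact: mulr_ge0 (ltW dx0) (ltW rho0)| |lra|exact: ltW|by []|by []].
rewrite mulrA ler_pdivrMr ?exprn_gt0//.
have dl : dx <= 2 * lam by lra.
have : a * b <= (2 * dx) * (2 * dy) by apply: ler_pM; lra.
have : dx * dx <= (2 * lam) * (2 * lam) by apply: ler_pM; lra.
nra.
Qed.

(** Trading [b] for lam^2 / a times the ratio rho makes rho h(rho) appear, which is of order rho^s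
    at 0; the loss 1/a, comparable to 1/dx, is what calls for 1 - s <= r. The constant 24 = 4 * 2 *
    3 is collected when lam dominates; the other case needs 6. *)
Lemma density_weight_le : exists2 C : R, 0 < C &
  forall lam dx dy a b r : R, 0 < lam -> 0 < dx -> 0 < dy -> `|dx - dy| <= lam ->
    dx <= a -> a <= 2 * dx -> 0 < b -> b <= 2 * dy -> 1 - s <= r -> r <= s ->
    dx `^ r * (b * h (a * b / lam ^+ 2)) <= C * (lam * dy `^ r).
Proof.
exists 24 => // lam dx dy a b r lam0 dx0 dy0 dxy a1 a2 b0 b2 r0 rs.
have a0 : 0 < a := lt_le_trans dx0 a1.
have rho0 : 0 < a * b / lam ^+ 2 by rewrite !mulr_gt0// invr_gt0 exprn_gt0.
move: dxy; rewrite ler_distl => /andP[d1 d2].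
set rho := a * b / lam ^+ 2 in rho0 *.
have rhole : rho <= 4 * dx * dy / lam ^+ 2.
  rewrite /rho ler_pM2r ?invr_gt0 ?exprn_gt0//.
  have : a * b <= (2 * dx) * (2 * dy) by apply: ler_pM; lra.
  nra.
have bE : b * h rho = lam ^+ 2 / a * (rho * h rho).
  rewrite mulrA; congr (_ * _); rewrite /rho; field.
  by rewrite !gt_eqF.
have rh : rho * h rho = rho `^ s / (1 + rho) `^ nu.
  by rewrite /green_density mulrA mulr_powRB1 ?(ltW rho0)//; slra.
rewrite bE rh.
apply: (@le_trans _ _ (lam * (dx `^ r * (lam / dx * (rho `^ s / (1 + rho) `^ nu))))).
  rewrite [leRHS]mulrCA ler_wpM2l ?powR_ge0// [leRHS]mulrA ler_wpM2r//.
    by rewrite divr_ge0// powR_ge0.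
  by rewrite mulrA expr2 ler_pM2l ?mulr_gt0// lef_pV2 ?posrE.
rewrite [leRHS]mulrCA ler_pM2l//.
have rho1 : 0 < 1 + rho by lra.
(* When lam is small, dx <= 2 dy and lam / dx <= sqrt(6 / rho); the resulting rho^(s-1/2) is
   absorbed by (1 + rho)^nu, since 0 < s - 1/2 <= nu. *)
have [l1|l1] := lerP (2 * lam) dx.
  apply: (@le_trans _ _ ((2 * dy `^ r) * 3)); last first.
    by have := powR_ge0 dy r; lra.
  apply: ler_pM; rewrite ?powR_ge0//.
  - by rewrite mulr_ge0// ?divr_ge0 ?powR_ge0 ?(ltW lam0) ?(ltW dx0).
  - by clear rhole bE rh rho1; apply: ger0_powR_le; slra.
  have lr : lam / dx <= (6 / rho) `^ 2^-1.
    have -> : lam / dx = ((lam / dx) ^+ 2) `^ 2^-1.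
      by rewrite powR12_sqrt ?sqr_ge0// sqrtr_sqr ger0_norm// divr_ge0 ?(ltW lam0) ?(ltW dx0).
    apply: ge0_ler_powR; rewrite ?nnegrE ?sqr_ge0 ?invr_ge0//; first exact: divr_ge0 (ltW rho0).
    rewrite expr_div_n ler_pdivlMr// mulrC -ler_pdivlMr ?divr_gt0 ?exprn_gt0//.
    rewrite (le_trans rhole)// invf_div ler_pdivrMr ?exprn_gt0//.
    rewrite -[leRHS]mulrA divfK ?gt_eqF ?exprn_gt0//.
    nra.
  apply: (@le_trans _ _ ((6 / rho) `^ 2^-1 * (rho `^ s / (1 + rho) `^ nu))).
    by rewrite ler_wpM2r// divr_ge0// powR_ge0.
  rewrite powR_div// mulrA ler_pdivrMr ?powR_gt0//.
  have s6 : (6 : R) `^ 2^-1 <= 3.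
    rewrite powR12_sqrt// (_ : 3 = Num.sqrt (3 ^+ 2) :> R); last by rewrite sqrtr_sqr ger0_norm.
    by rewrite ler_sqrt; lra.
  rewrite -mulrA -powRD; last by rewrite (gt_eqF rho0) implybT.
  apply: ler_pM; rewrite ?powR_ge0//.
  apply: (@le_trans _ _ ((1 + rho) `^ (- 2^-1 + s))).
    by clear rhole bE rh; apply: ge0_ler_powR; rewrite ?nnegrE; slra.
  by clear rhole bE rh; apply: ler_powR; slra.
have dl : dx <= 2 * lam by lra.
have dyl : dy <= 3 * lam by lra.
have rsle : rho `^ s / (1 + rho) `^ nu <= 4 * ((dx * dy) / lam ^+ 2) `^ s.
  apply: (@le_trans _ _ (rho `^ s)).
    rewrite ler_pdivrMr ?powR_gt0// ler_peMr ?powR_ge0// powR_ge1//; slra.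
  apply: ger0_powR_le; [exact: ltW| |lra| |slra|slra].
    by move: rhole; rewrite !mulrA.
  by rewrite divr_ge0 ?mulr_ge0 ?exprn_ge0 ?(ltW dx0) ?(ltW dy0) ?(ltW lam0).
apply: (@le_trans _ _ (dx `^ r * (lam / dx * (4 * (dx * dy / lam ^+ 2) `^ s)))).
  rewrite ler_wpM2l ?powR_ge0// ler_wpM2l// divr_ge0 ?(ltW lam0) ?(ltW dx0)//.
have e1 : dx `^ r * (lam / dx * (4 * (dx * dy / lam ^+ 2) `^ s)) =
    4 * dx `^ (r + s - 1) * (lam `^ (1 - 2 * s) * dy `^ s).
  rewrite powR_div ?mulr_gt0 ?exprn_gt0// powRM ?(ltW dx0) ?(ltW dy0)//.
  rewrite -powR_mulrn ?(ltW lam0)// -powRrM.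
  have -> : dx `^ (r + s - 1) = dx `^ r * dx `^ s / dx.
    rewrite powRB; last by rewrite (gt_eqF dx0) implybT.
    rewrite powRD ?powRr1 ?(ltW dx0)//; last by rewrite (gt_eqF dx0) implybT.
  have -> : lam `^ (1 - 2 * s) = lam * lam `^ (2 * (- s)).
    rewrite powRB; last by rewrite (gt_eqF lam0) implybT.
    by rewrite powRr1 ?(ltW lam0)// mulrN powRN.
  by ring.
rewrite e1.
(* [1 - s <= r] makes the exponent of [dx] nonnegative, so that dx <= 2 lam can be inserted. *)
apply: (@le_trans _ _ (4 * (2 * lam `^ (r + s - 1)) * (lam `^ (1 - 2 * s) * dy `^ s))).
  rewrite ler_wpM2r ?mulr_ge0 ?powR_ge0// ler_pM2l//.
  by clear rhole bE rh rho1 rsle e1; apply: ger0_powR_le; slra.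
have e2 : 4 * (2 * lam `^ (r + s - 1)) * (lam `^ (1 - 2 * s) * dy `^ s) =
    8 * (lam `^ (r - s) * dy `^ (s - r)) * dy `^ r.
  have -> : lam `^ (r - s) = lam `^ (r + s - 1) * lam `^ (1 - 2 * s).
    rewrite -powRD; last by rewrite (gt_eqF lam0) implybT.
    by congr powR; lra.
  have -> : dy `^ s = dy `^ (s - r) * dy `^ r.
    rewrite -powRD; last by rewrite (gt_eqF dy0) implybT.
    by congr powR; lra.
  by ring.
rewrite e2 ler_wpM2r ?powR_ge0//.
rewrite (_ : 24 = 8 * 3); last by lra.
rewrite ler_pM2l//.
(* [r <= s] allows dy <= 3 lam to be raised to the power s - r. *)
rewrite (_ : r - s = - (s - r)); last by lra.
rewrite powRN mulrC ler_pdivrMr ?powR_gt0//.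
by clear rhole bE rh rho1 rsle e1 e2; apply: ger0_powR_le; slra.
Qed.

End kernel_estimates.

Section line_derivative.
Context {R : realType} {n : nat}.
Local Notation E := 'rV[R]_n.

Lemma line_quotient (f : E -> R) (x v : E) (t : R) :
  (fun h => h^-1 *: (((fun t => f (x + t *: v)) \o shift t) (h *: (1 : R)) - f (x + t *: v))) =
  (fun h => h^-1 *: ((f \o shift (x + t *: v)) (h *: v) - f (x + t *: v))).
Proof.
apply/funext => h /=; congr (_ *: (f _ - _)).
rewrite /shift /= -[h *: 1]/(h * 1) mulr1 scalerDl.
by rewrite addrC -!addrA; congr (_ + _); rewrite addrC.
Qed.

(** The two difference quotients are the same function. Partial derivatives thus become derivatives
    along a line, within reach of the one-variable chain rule and mean value theorem. *)
Lemma is_derive_lineP (f : E -> R) (x v : E) (t d : R) :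
  is_derive t 1 (fun t => f (x + t *: v)) d <-> is_derive (x + t *: v) v f d.
Proof.
split=> -[e1 e2]; split.
- by move: e1; rewrite /derivable line_quotient.
- by move: e2; rewrite /derive line_quotient.
- by rewrite /derivable line_quotient.
- by rewrite /derive line_quotient.
Qed.

Lemma enorm_sqr_line (x : E) (i : 'I_n) (t : R) :
  enorm (x + t *: delta_mx ord0 i) ^+ 2 = enorm x ^+ 2 + 2 * x ord0 i * t + t ^+ 2.
Proof.
rewrite !enorm_sqr (bigD1 i)//= [in RHS](bigD1 i)//= !mxE !eqxx/= mulr1.
have -> : \sum_(j < n | j != i) (x + t *: delta_mx ord0 i) ord0 j ^+ 2 =
    \sum_(j < n | j != i) x ord0 j ^+ 2.
  apply: eq_bigr => j ji; rewrite !mxE eqxx/=.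
  by rewrite (negbTE ji) mulr0 addr0.
ring.
Qed.

End line_derivative.

(** * The regularized Green kernel *)

Section green_regularization.
Context {R : realType} {n : nat}.
Local Notation E := 'rV[R]_n.
Variable s : R.
Hypotheses (n0 : (0 < n)%N) (s_gt : 2^-1 < s) (s_lt : s < 1).
Let nu : R := n%:R / 2.
Local Notation h := (green_density s nu).
Local Notation H := (green_profile s nu).
Local Notation Phi := (green_radial s nu).

Let nu_ge : 2^-1 <= nu.
Proof. by rewrite /nu ler_peMl ?invr_ge0// ler1n. Qed.

(** The power of [W] and the quotient inside [H] both contribute a term in W', and together these
    form -(1/2) W' times [green_radial]. *)
Let is_derive_profile_comp (W P : R -> R) (t W' P' : R) :
  is_derive t 1 W W' -> is_derive t 1 P P' -> 0 < W t -> 0 < P t ->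
  is_derive t 1 (fun t => W t `^ (s - nu) * H (P t / W t))
    (W t `^ (s - nu - 1) * (P' * h (P t / W t) - 2^-1 * W' * Phi (P t / W t))).
Proof.
move=> dW dP W0 P0.
have rho0 : 0 < P t / W t by rewrite divr_gt0.
have Wn0 : W t != 0 by rewrite gt_eqF.
have d1 := @is_derive1_comp _ _ _ _ _ _ (is_derive1_powR (s - nu) W0) dW.
have d2 := is_deriveM dP (is_deriveV Wn0 dW).
have d3 := @is_derive1_comp R H (fun t => P t / W t) t _ _
  (is_derive_green_profile s_gt s_lt nu_ge rho0) d2.
apply: (is_derive_eq (is_deriveM d1 d3)).
rewrite /GRing.scale/= /green_radial.
have -> : W t `^ (s - nu) = W t `^ (s - nu - 1) * W t.
  rewrite -{3}(powRr1 (ltW W0)) -powRD; last by rewrite Wn0 implybT.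
  by congr powR; lra.
set hh := h _; set HH := H _.
by field.
Qed.

Definition reg_sqdist (e : R) (x y : E) : R := enorm (x - y) ^+ 2 + e.
Definition reg_ratio (e : R) (x y : E) : R :=
  (1 - enorm x ^+ 2) * (1 - enorm y ^+ 2) / reg_sqdist e x y.

(* For [0 < e] this is smooth in x; [e = 0] gives back the Green function. *)
Definition green_reg (e : R) (x y : E) : R :=
  @kappa R n s * (reg_sqdist e x y `^ (s - nu) * H (reg_ratio e x y)).

(** The two terms come from differentiating 1 - |x|^2 and |x - y|^2 + e. At e = 0 this is the kernel
    of the weak gradient, with value 0 on the diagonal by the convention on powers of 0. *)
Definition green_dreg (e : R) (i : 'I_n) (x y : E) : R :=
  @kappa R n s * (reg_sqdist e x y `^ (s - nu - 1) *
    (- (2 * x ord0 i) * ((1 - enorm y ^+ 2) * h (reg_ratio e x y)) -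
     (x - y) ord0 i * Phi (reg_ratio e x y))).

Lemma green_regE x y : green s x y = green_reg 0 x y.
Proof.
rewrite /green /green_reg /reg_sqdist addr0 -/(reg_ratio 0 x y) -mulrA.
have -> : rho x y = reg_ratio 0 x y by rewrite /rho /reg_ratio /reg_sqdist addr0.
congr (_ * (_ * _)).
rewrite -powRN -powR_mulrn ?enorm_ge0// -powRrM /nu; congr powR.
by field.
Qed.

Lemma unit_ball_gt0 (x : E) : unit_ball x -> 0 < 1 - enorm x ^+ 2.
Proof.
rewrite /unit_ball/= => x1; have := enorm_ge0 x; rewrite subr_gt0; nra.
Qed.

Lemma is_derive_green_reg (e : R) (i : 'I_n) (x y : E) : 0 < e ->
  unit_ball x -> unit_ball y ->
  is_derive x (delta_mx ord0 i) (fun x => green_reg e x y) (green_dreg e i x y).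
Proof.
move=> e0 x1 y1.
have x0 : x = x + 0 *: delta_mx ord0 i by rewrite scale0r addr0.
rewrite [X in is_derive X]x0; apply/is_derive_lineP.
pose W t : R := enorm (x - y) ^+ 2 + 2 * (x - y) ord0 i * t + t ^+ 2 + e.
pose P t : R := (1 - (enorm x ^+ 2 + 2 * x ord0 i * t + t ^+ 2)) * (1 - enorm y ^+ 2).
have -> : (fun t => green_reg e (x + t *: delta_mx ord0 i) y) =
    (fun t => @kappa R n s * (W t `^ (s - nu) * H (P t / W t))).
  apply/funext => t; rewrite /green_reg /reg_ratio /reg_sqdist.
  by rewrite addrAC !enorm_sqr_line.
have poly (a b c : R) : is_derive (0 : R) 1 (fun t => a + b * t + t ^+ 2 + c) b.
  have dt := is_derive_id (0 : R) (1 : R).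
  have d1 := is_deriveD (is_deriveD (is_deriveD (is_derive_cst a (0 : R) (1 : R))
    (is_deriveZ b dt)) (is_deriveM dt dt)) (is_derive_cst c (0 : R) (1 : R)).
  have -> : (fun t => a + b * t + t ^+ 2 + c) = cst a + b \*: id + id * id + cst c.
    by apply/funext => t; rewrite expr2.
  apply: (is_derive_eq d1).
  by rewrite /GRing.scale/= mul0r mulr1 !addr0 add0r.
have dW : is_derive (0 : R) 1 W (2 * (x - y) ord0 i) := poly _ _ _.
have dP : is_derive (0 : R) 1 P (- (2 * x ord0 i) * (1 - enorm y ^+ 2)).
  have -> : P = (- (1 - enorm y ^+ 2)) \*: (fun t => (enorm x ^+ 2) + 2 * x ord0 i * t + t ^+ 2 + (- 1)).
    by apply/funext => t; rewrite /P /= /GRing.scale/=; ring.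
  apply: (is_derive_eq (is_deriveZ (- (1 - enorm y ^+ 2)) (poly _ _ (-1)))).
  by rewrite /GRing.scale/=; ring.
have W0 : W 0 = reg_sqdist e x y by rewrite /W /reg_sqdist mulr0 expr0n/= !addr0.
have P0 : P 0 = (1 - enorm x ^+ 2) * (1 - enorm y ^+ 2).
  by rewrite /P mulr0 expr0n/= !addr0.
have W_gt0 : 0 < W 0 by rewrite W0 /reg_sqdist ltr_wpDl// sqr_ge0.
have P_gt0 : 0 < P 0 by rewrite P0 mulr_gt0// unit_ball_gt0.
apply: (is_derive_eq (is_deriveZ (@kappa R n s) (is_derive_profile_comp dW dP W_gt0 P_gt0))).
rewrite W0 P0 -/(reg_ratio e x y) /green_dreg /GRing.scale/=.
set hh := h _; set HH := Phi _.
by field.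
Qed.

Lemma measurable_inv_ge0 d (T : measurableType d) (f : T -> R) :
  measurable_fun setT f -> (forall x, 0 <= f x) -> measurable_fun setT (fun x => (f x)^-1).
Proof.
move=> mf f0; under eq_fun do rewrite -powR_inv1//.
exact: (measurableT_comp (measurable_powR _) mf).
Qed.

Let m1 : measurable_fun setT (fun z : E * E => enorm z.1 ^+ 2).
Proof.
by apply: measurable_funX; exact: (measurableT_comp measurable_enorm measurable_fst).
Qed.

Let m2 : measurable_fun setT (fun z : E * E => enorm z.2 ^+ 2).
Proof.
by apply: measurable_funX; exact: (measurableT_comp measurable_enorm measurable_snd).
Qed.

Lemma measurable_reg_sqdist e : measurable_fun setT (fun z : E * E => reg_sqdist e z.1 z.2).
Proof.
by apply: measurable_funD => //; apply: measurable_funX; exact: measurable_edist.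
Qed.

Lemma measurable_reg_ratio e : 0 <= e ->
  measurable_fun setT (fun z : E * E => reg_ratio e z.1 z.2).
Proof.
move=> e0; apply: measurable_funM.
  by apply: measurable_funM; apply: measurable_funB.
apply: measurable_inv_ge0; first exact: measurable_reg_sqdist.
by move=> z; rewrite addr_ge0// sqr_ge0.
Qed.

Lemma measurable_green_reg e : 0 <= e ->
  measurable_fun setT (fun z : E * E => green_reg e z.1 z.2).
Proof.
move=> e0; apply: measurable_funM => //; apply: measurable_funM.
  exact: (measurableT_comp (measurable_powR _) (measurable_reg_sqdist e)).
exact: (measurableT_comp (measurable_green_profile s_gt s_lt nu_ge) (measurable_reg_ratio e0)).
Qed.

Let measurable_green_radial : measurable_fun setT Phi.
Proof.
apply: measurable_funD; apply: measurable_funM => //.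
  exact: measurable_green_profile.
by apply: measurable_funM => //; exact: measurable_green_density.
Qed.

Lemma measurable_green_dreg e i : 0 <= e ->
  measurable_fun setT (fun z : E * E => green_dreg e i z.1 z.2).
Proof.
move=> e0; apply: measurable_funM => //; apply: measurable_funM.
  exact: (measurableT_comp (measurable_powR _) (measurable_reg_sqdist e)).
apply: measurable_funB; apply: measurable_funM.
- apply: measurableT_comp => //; apply: measurable_funM => //.
  exact: (measurableT_comp (measurable_coord i) measurable_fst).
- apply: measurable_funM; first exact: measurable_funB.
  exact: (measurableT_comp (measurable_green_density s nu) (measurable_reg_ratio e0)).
- exact: (measurableT_comp (measurable_coord i) measurable_row_sub).
- exact: (measurableT_comp measurable_green_radial (measurable_reg_ratio e0)).
Qed.

Let edist_gt0 (x y : E) : x != y -> 0 < enorm (x - y).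
Proof.
move=> xy; rewrite lt_neqAle enorm_ge0 andbT eq_sym.
by apply: contra xy => /eqP/enorm_eq0/subr0_eq ->.
Qed.

Let reg_ratio_gt0 e (x y : E) : unit_ball x -> unit_ball y ->
  0 < reg_sqdist e x y -> 0 < reg_ratio e x y.
Proof. by move=> x1 y1 w0; rewrite divr_gt0// mulr_gt0// unit_ball_gt0. Qed.

Let cvg_reg_sqdist (x y : E) (e : nat -> R) : e @ \oo --> (0 : R) ->
  reg_sqdist (e k) x y @[k --> \oo] --> reg_sqdist 0 x y.
Proof. by move=> e0; apply: cvgD => //; exact: cvg_cst. Qed.

Let cvg_reg_ratio (x y : E) (e : nat -> R) : x != y -> e @ \oo --> (0 : R) ->
  reg_ratio (e k) x y @[k --> \oo] --> reg_ratio 0 x y.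
Proof.
move=> xy e0; apply: cvgM; first exact: cvg_cst.
apply: cvgV; last exact: cvg_reg_sqdist.
by rewrite /reg_sqdist addr0 gt_eqF// exprn_gt0// edist_gt0.
Qed.

Let reg_sqdist0_gt0 (x y : E) : x != y -> 0 < reg_sqdist 0 x y.
Proof. by move=> xy; rewrite /reg_sqdist addr0 exprn_gt0// edist_gt0. Qed.

Let is_derive_cvg (f : R -> R) (u : nat -> R) (a d : R) : is_derive a 1 f d ->
  u @ \oo --> a -> f (u k) @[k --> \oo] --> f a.
Proof.
move=> [df _] ua; apply: (continuous_cvg _ _ ua).
exact/differentiable_continuous/derivable1_diffP.
Qed.

Lemma cvg_green_reg (x y : E) (e : nat -> R) : x != y -> unit_ball x -> unit_ball y ->
  e @ \oo --> (0 : R) -> green_reg (e k) x y @[k --> \oo] --> green_reg 0 x y.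
Proof.
move=> xy x1 y1 e0; apply: cvgM; first exact: cvg_cst.
have w0 := reg_sqdist0_gt0 xy.
apply: cvgM.
  exact: (@is_derive_cvg (fun v => v `^ (s - nu)) (fun k => reg_sqdist (e k) x y) _ _ (is_derive1_powR (s - nu) w0) (@cvg_reg_sqdist x y e e0)).
exact: (@is_derive_cvg H _ _ _ (is_derive_green_profile s_gt s_lt nu_ge (reg_ratio_gt0 x1 y1 w0))
  (@cvg_reg_ratio x y e xy e0)).
Qed.

Lemma cvg_green_dreg (i : 'I_n) (x y : E) (e : nat -> R) : x != y ->
  unit_ball x -> unit_ball y ->
  e @ \oo --> (0 : R) -> green_dreg (e k) i x y @[k --> \oo] --> green_dreg 0 i x y.
Proof.
move=> xy x1 y1 e0; apply: cvgM; first exact: cvg_cst.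
have w0 := reg_sqdist0_gt0 xy.
have r0 := reg_ratio_gt0 x1 y1 w0.
apply: cvgM.
  exact: (@is_derive_cvg (fun v => v `^ (s - nu - 1)) (fun k => reg_sqdist (e k) x y) _ _ (is_derive1_powR (s - nu - 1) w0) (@cvg_reg_sqdist x y e e0)).
apply: cvgB; apply: cvgM.
- exact: cvg_cst.
- apply: cvgM; first exact: cvg_cst.
  exact: (@is_derive_cvg h _ _ _ (is_derive_green_density s_gt s_lt nu_ge r0) (@cvg_reg_ratio x y e xy e0)).
- exact: cvg_cst.
- exact: (@is_derive_cvg Phi _ _ _ (is_derive_green_radial s_gt s_lt nu_ge r0) (@cvg_reg_ratio x y e xy e0)).
Qed.

(** n/2 is either 1/2 or at least 1, while s lies strictly in between. Hence [green_profile] can be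
    solved for in terms of [green_radial], and 0^(s-nu) = 0. *)
Let nu_neq : nu != s.
Proof.
rewrite /nu; have [n1|n1] := leqP n 1.
  have -> : n = 1%N by apply/eqP; rewrite eqn_leq n1.
  by rewrite lt_eqF// mul1r.
rewrite gt_eqF// (lt_le_trans s_lt)// ler_pdivlMr// mul1r.
by rewrite ler_nat.
Qed.

Let weights (e : R) (x y : E) : 0 <= e -> unit_ball x -> unit_ball y -> 0 < reg_sqdist e x y ->
  let lam := Num.sqrt (reg_sqdist e x y) in
  [/\ 0 < lam, lam ^+ 2 = reg_sqdist e x y, `|(1 - enorm x) - (1 - enorm y)| <= lam,
     enorm (x - y) <= lam & 0 < 1 - enorm x /\ 0 < 1 - enorm y].
Proof.
move=> e0 x1 y1 w0 lam.
have z0 := enorm_ge0 (x - y).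
have lam0 : 0 < lam by rewrite sqrtr_gt0.
have lamE : lam ^+ 2 = reg_sqdist e x y by rewrite sqr_sqrtr// ltW.
have zl : enorm (x - y) <= lam.
  by rewrite -ler_sqr ?nnegrE ?(ltW lam0)// lamE /reg_sqdist lerDl.
split => //; last by rewrite !subr_gt0.
rewrite (le_trans _ zl)//.
rewrite (_ : _ - _ = enorm y - enorm x); last by ring.
by rewrite enormBC ler_enorm_dist.
Qed.

Let one_minus (x : E) : unit_ball x ->
  1 - enorm x <= 1 - enorm x ^+ 2 /\ 1 - enorm x ^+ 2 <= 2 * (1 - enorm x).
Proof. by rewrite /unit_ball/= => x1; have := enorm_ge0 x; split; nra. Qed.

(** The prefactor has one power of 1/lam too many, but the weighted bracket is O(lam): |2 x_i| <= 2
    meets the density bound, and |(x - y)_i| <= lam the radial one. *)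
Lemma green_dreg_le : exists2 C : R, 0 < C & forall (e r : R) (i : 'I_n) (x y : E),
  0 <= e -> unit_ball x -> unit_ball y -> 0 < reg_sqdist e x y -> 1 - s <= r -> r <= s ->
  (1 - enorm x) `^ r * `|green_dreg e i x y| <=
  C * (Num.sqrt (reg_sqdist e x y) `^ (- (n%:R + 1 - 2 * s)) * (1 - enorm y) `^ r).
Proof.
have [C1 C10 H1] := radial_weight_le s_gt s_lt nu_ge.
have [C2 C20 H2] := density_weight_le s_gt s_lt nu_ge.
have [ka ka0 kaE] : exists2 ka : R, 0 <= ka & `|@kappa R n s| = ka.
  by exists `|@kappa R n s|.
(* Adding 1 gives a positive constant without evaluating [kappa]. *)
have ka1 : 0 < ka + 1 by lra.
exists ((ka + 1) * (2 * C2 + C1)).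
  by rewrite mulr_gt0// addr_gt0 ?mulr_gt0.
move=> e r i x y e0 x1 y1 xy r1 r2.
have [] := weights e0 x1 y1 xy.
set lam := Num.sqrt _ => lam0 lamE dxy zl [dx0 dy0].
have [a1 a2] := one_minus x1; have [b1 b2] := one_minus y1.
have a0 := unit_ball_gt0 x1; have b0 := unit_ball_gt0 y1.
have r0 : 0 <= r by have := s_lt; lra.
have K1 := H1 lam _ _ _ _ r lam0 dx0 dy0 dxy a0 a2 b0 b2 r0 r2.
have K2 := H2 lam _ _ _ _ r lam0 dx0 dy0 dxy a1 a2 b0 b2 r1 r2.
rewrite lamE -/(reg_ratio e x y) in K1 K2.
set X := (1 - enorm x) `^ r in K1 K2 *; set Y := (1 - enorm y) `^ r in K1 K2 *.
have X0 : 0 <= X by rewrite powR_ge0.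
have Y0 : 0 <= Y by rewrite powR_ge0.
rewrite /green_dreg normrM kaE.
set B := (1 - enorm y ^+ 2) * h _ in K2 *.
have B0 : 0 <= B by rewrite mulr_ge0 ?green_density_ge0// ltW.
have wE : reg_sqdist e x y `^ (s - nu - 1) = lam `^ (- (n%:R + 1 - 2 * s)) / lam.
  rewrite -lamE -powR_mulrn ?(ltW lam0)// -powRrM.
  rewrite -[in RHS](powR_inv1 (ltW lam0)) -powRD; last by rewrite (gt_eqF lam0) implybT.
  by congr powR; rewrite /nu; field.
rewrite (normrM (reg_sqdist e x y `^ (s - nu - 1))) wE (@ger0_norm _ (lam `^ _ / lam)); last by rewrite divr_ge0 ?powR_ge0 ?(ltW lam0).
set L := lam `^ _; have L0 : 0 <= L by rewrite powR_ge0.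
set Q := `|_ - _|.
have QB : X * Q <= lam * ((2 * C2 + C1) * Y).
  have : Q <= 2 * B + lam * `|Phi (reg_ratio e x y)|.
    apply: (le_trans (ler_normB _ _)); apply: lerD.
      rewrite normrM (ger0_norm B0) ler_wpM2r// normrN normrM (ger0_norm (ler0n _ 2)).
      have := ler_coord_enorm x i; move: x1; rewrite /unit_ball/=; lra.
    rewrite normrM ler_wpM2r// (le_trans (ler_coord_enorm _ _))//.
  move=> /(ler_wpM2l X0) /le_trans; apply.
  rewrite (_ : X * _ = 2 * (X * B) + lam * (X * `|Phi (reg_ratio e x y)|)); last by ring.
  rewrite (_ : lam * ((2 * C2 + C1) * Y) = 2 * (C2 * (lam * Y)) + lam * (C1 * Y)); last by ring.
  by rewrite lerD// ler_pM2l.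
have k1 : ka <= ka + 1 by lra.
rewrite (_ : X * _ = ka * (L * (X * Q / lam))); last by ring.
rewrite -[leRHS]mulrA; apply: ler_pM => //.
  by rewrite mulr_ge0// mulr_ge0 ?invr_ge0 ?(ltW lam0)// mulr_ge0 ?normr_ge0.
apply: (@le_trans _ _ (L * ((2 * C2 + C1) * Y))).
  by rewrite ler_wpM2l// ler_pdivrMr// [leRHS]mulrC.
by rewrite mulrCA.
Qed.

(** The profile is estimated through 2 (nu - s) H = Phi - 2 rho h(rho). Compared with the gradient
    there is a spare factor lam: it cancels the 1/lam left by the density bound, and it is at most 3
    in front of the radial term because [e <= 1]. *)
Lemma green_reg_le : exists2 C : R, 0 < C & forall (e r : R) (x y : E),
  0 <= e -> e <= 1 -> unit_ball x -> unit_ball y -> 0 < reg_sqdist e x y -> 1 - s <= r -> r <= s ->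
  (1 - enorm x) `^ r * `|green_reg e x y| <=
  C * (Num.sqrt (reg_sqdist e x y) `^ (- (n%:R + 1 - 2 * s)) * (1 - enorm y) `^ r).
Proof.
have [C1 C10 H1] := radial_weight_le s_gt s_lt nu_ge.
have [C2 C20 H2] := density_weight_le s_gt s_lt nu_ge.
pose c := 2 * `|nu - s|.
have c0 : 0 < c by rewrite mulr_gt0// normr_gt0 subr_eq0 nu_neq.
have [ka ka0 kaE] : exists2 ka : R, 0 <= ka & `|@kappa R n s| = ka.
  by exists `|@kappa R n s|.
have ka1 : 0 < ka + 1 by lra.
exists ((ka + 1) * ((3 * C1 + 2 * C2) / c)).
  by rewrite mulr_gt0// divr_gt0// addr_gt0 ?mulr_gt0.
move=> e r x y e0 e1 x1 y1 xy r1 r2.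
have [] := weights e0 x1 y1 xy.
set lam := Num.sqrt _ => lam0 lamE dxy zl [dx0 dy0].
have [a1 a2] := one_minus x1; have [b1 b2] := one_minus y1.
have a0 := unit_ball_gt0 x1; have b0 := unit_ball_gt0 y1.
have r0 : 0 <= r by have := s_lt; lra.
have K1 := H1 lam _ _ _ _ r lam0 dx0 dy0 dxy a0 a2 b0 b2 r0 r2.
have K2 := H2 lam _ _ _ _ r lam0 dx0 dy0 dxy a1 a2 b0 b2 r1 r2.
rewrite lamE -/(reg_ratio e x y) in K1 K2.
have rE : reg_ratio e x y = (1 - enorm x ^+ 2) * (1 - enorm y ^+ 2) / lam ^+ 2.
  by rewrite lamE.
set X := (1 - enorm x) `^ r in K1 K2 *; set Y := (1 - enorm y) `^ r in K1 K2 *.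
have X0 : 0 <= X by rewrite powR_ge0.
have Y0 : 0 <= Y by rewrite powR_ge0.
have lam3 : lam <= 3.
  rewrite -ler_sqr ?nnegrE ?(ltW lam0)// lamE /reg_sqdist.
  have : enorm (x - y) <= 2.
    have := ler_enormD x (- y); rewrite enormN.
    by move: x1 y1; rewrite /unit_ball/=; lra.
  by have := enorm_ge0 (x - y); nra.
rewrite /green_reg normrM kaE.
have wE : reg_sqdist e x y `^ (s - nu) = lam `^ (- (n%:R + 1 - 2 * s)) * lam.
  rewrite -lamE -powR_mulrn ?(ltW lam0)// -powRrM.
  rewrite -[X in _ = _ * X](powRr1 (ltW lam0)) -powRD; last by rewrite (gt_eqF lam0) implybT.
  by congr powR; rewrite /nu; field.
rewrite (normrM (reg_sqdist e x y `^ (s - nu))) wE (@ger0_norm _ (lam `^ _ * lam)); last first.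
  by rewrite mulr_ge0 ?powR_ge0 ?(ltW lam0).
set L := lam `^ _; have L0 : 0 <= L by rewrite powR_ge0.
set rho := reg_ratio e x y in K1 K2 rE *.
have rho0 : 0 <= rho.
  by rewrite rE divr_ge0// ?mulr_ge0 ?exprn_ge0 ?(ltW a0) ?(ltW b0) ?(ltW lam0).
have HE : c * `|H rho| <= `|Phi rho| + 2 * (rho * h rho).
  rewrite /c -{1}(ger0_norm (ler0n R 2)) -!normrM.
  rewrite (_ : 2 * (nu - s) * H rho = Phi rho - 2 * (rho * h rho)); last first.
    by rewrite /green_radial addrK.
  rewrite (le_trans (ler_normB _ _))// lerD2l [leLHS]ger0_norm//.
  by rewrite mulr_ge0// (mulr_ge0 rho0 (green_density_ge0 _ _ _)).
have rh : X * (rho * h rho) * lam <= C2 * Y.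
  have -> : rho = (1 - enorm x ^+ 2) * (1 - enorm y ^+ 2) / lam ^+ 2 by [].
  rewrite -rE -/rho -[leRHS](mulfK (lt0r_neq0 lam0)) ler_pdivlMr//.
  apply: (@le_trans _ _ ((1 - enorm x ^+ 2) * (X * ((1 - enorm y ^+ 2) * h rho)))).
    rewrite le_eqVlt; apply/orP; left; apply/eqP.
    rewrite rE -rE; set hh := h rho; rewrite rE; field.
    by rewrite gt_eqF.
  apply: (@le_trans _ _ (1 * (C2 * (lam * Y)))).
    apply: ler_pM => //; first exact: ltW.
    - by rewrite (mulr_ge0 X0)// (mulr_ge0 (ltW b0) (green_density_ge0 _ _ _)).
    - by rewrite gerBl sqr_ge0.
  by rewrite mul1r [lam * Y]mulrC mulrA.
have QB : c * (X * (lam * `|H rho|)) <= (3 * C1 + 2 * C2) * Y.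
  apply: (@le_trans _ _ (lam * (X * (`|Phi rho| + 2 * (rho * h rho))))).
    rewrite (_ : c * _ = lam * (X * (c * `|H rho|))); last by ring.
    by rewrite ler_pM2l// ler_wpM2l.
  have : lam * (X * `|Phi rho|) <= 3 * (C1 * Y).
    by apply: ler_pM => //; rewrite ?(ltW lam0)// mulr_ge0.
  move=> lP; rewrite (_ : lam * (X * (_ + _)) = lam * (X * `|Phi rho|) + 2 * (X * (rho * h rho) * lam)); last by ring.
  rewrite (_ : (3 * C1 + 2 * C2) * Y = 3 * (C1 * Y) + 2 * (C2 * Y)); last by ring.
  by rewrite lerD// ler_pM2l.
have k1 : ka <= ka + 1 by lra.
rewrite (_ : X * _ = ka * (L * (X * (lam * `|H rho|)))); last by ring.
rewrite -[leRHS]mulrA; apply: ler_pM => //.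
  by rewrite mulr_ge0// mulr_ge0// mulr_ge0// ltW.
apply: (@le_trans _ _ (L * ((3 * C1 + 2 * C2) / c * Y))).
  by rewrite ler_wpM2l// [leRHS]mulrAC ler_pdivlMr// [leLHS]mulrC.
by rewrite mulrCA.
Qed.

(** Removing [e] increases the singular kernel. The diagonal is excluded because there the right
    side is 0 by the convention on powers. *)
Lemma sqrt_reg_sqdist_le (e : R) (x y : E) : 0 <= e -> x != y ->
  Num.sqrt (reg_sqdist e x y) `^ (- (n%:R + 1 - 2 * s)) <=
  enorm (x - y) `^ (- (n%:R + 1 - 2 * s)).
Proof.
move=> e0 xy; have z0 := edist_gt0 xy.
have zl : enorm (x - y) <= Num.sqrt (reg_sqdist e x y).
  rewrite -[leLHS](ger0_norm (ltW z0)) -sqrtr_sqr ler_sqrt.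
    by rewrite /reg_sqdist lerDl.
  by rewrite /reg_sqdist addr_ge0// sqr_ge0.
have n1 : (1 : R) <= n%:R by rewrite ler1n.
rewrite !powRN lef_pV2 ?posrE ?powR_gt0 ?(lt_le_trans z0 zl)//.
by apply: ge0_ler_powR; rewrite ?nnegrE ?enorm_ge0 ?sqrtr_ge0//; have := s_lt; lra.
Qed.

Lemma sqrt_reg_sqdist_le_eps (e : R) (x y : E) : 0 < e ->
  Num.sqrt (reg_sqdist e x y) `^ (- (n%:R + 1 - 2 * s)) <=
  Num.sqrt e `^ (- (n%:R + 1 - 2 * s)).
Proof.
move=> e0; have z0 : 0 < Num.sqrt e by rewrite sqrtr_gt0.
have zl : Num.sqrt e <= Num.sqrt (reg_sqdist e x y).
  rewrite ler_sqrt; first by rewrite /reg_sqdist lerDr sqr_ge0.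
  by rewrite /reg_sqdist addr_ge0 ?sqr_ge0// ltW.
have n1 : (1 : R) <= n%:R by rewrite ler1n.
rewrite !powRN lef_pV2 ?posrE ?powR_gt0 ?(lt_le_trans z0 zl)//.
by apply: ge0_ler_powR; rewrite ?nnegrE ?sqrtr_ge0//; have := s_lt; lra.
Qed.

Let reg_sqdist_xx (x : E) : reg_sqdist 0 x x = 0.
Proof. by rewrite /reg_sqdist subrr enorm0 expr0n addr0. Qed.

Lemma green_reg0_le : exists2 C : R, 0 < C & forall (r : R) (x y : E),
  unit_ball x -> unit_ball y -> 1 - s <= r -> r <= s ->
  (1 - enorm x) `^ r * `|green_reg 0 x y| <=
  C * (enorm (x - y) `^ (- (n%:R + 1 - 2 * s)) * (1 - enorm y) `^ r).
Proof.
have [C C0 HC] := green_reg_le; exists C => // r x y x1 y1 r1 r2.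
have [<-|xy] := eqVneq x y.
  rewrite /green_reg reg_sqdist_xx powR0; last by rewrite subr_eq0 eq_sym nu_neq.
  by rewrite mul0r mulr0 normr0 mulr0 mulr_ge0 ?(ltW C0)// mulr_ge0 ?powR_ge0.
apply: (le_trans (HC 0 r x y (lexx 0) ler01 x1 y1 (reg_sqdist0_gt0 xy) r1 r2)).
by rewrite ler_pM2l// ler_wpM2r ?powR_ge0// sqrt_reg_sqdist_le.
Qed.

Lemma green_dreg0_le : exists2 C : R, 0 < C & forall (r : R) (i : 'I_n) (x y : E),
  unit_ball x -> unit_ball y -> 1 - s <= r -> r <= s ->
  (1 - enorm x) `^ r * `|green_dreg 0 i x y| <=
  C * (enorm (x - y) `^ (- (n%:R + 1 - 2 * s)) * (1 - enorm y) `^ r).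
Proof.
have [C C0 HC] := green_dreg_le; exists C => // r i x y x1 y1 r1 r2.
have [<-|xy] := eqVneq x y.
  rewrite /green_dreg reg_sqdist_xx powR0; last first.
    by rewrite lt_eqF//; have := nu_ge; have := s_lt; lra.
  by rewrite mul0r mulr0 normr0 mulr0 mulr_ge0 ?(ltW C0)// mulr_ge0 ?powR_ge0.
apply: (le_trans (HC 0 r i x y (lexx 0) x1 y1 (reg_sqdist0_gt0 xy) r1 r2)).
by rewrite ler_pM2l// ler_wpM2r ?powR_ge0// sqrt_reg_sqdist_le.
Qed.

End green_regularization.

(** * Integration by parts *)

Section integral_of_derivative.
Context {R : realType} {n : nat}.
Local Notation E := 'rV[R]_n.
Local Notation lam := (@lebesgue_rV R n).

Let h (k : nat) : R := k.+1%:R^-1.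

Let h_gt0 k : 0 < h k. Proof. by rewrite invr_gt0. Qed.

Let cvg_h : h @ \oo --> (0 : R).
Proof. exact: cvg_harmonic. Qed.

Lemma cvg_difference_quotient (f : E -> R) (x v : E) (d : R) : is_derive x v f d ->
  (h k)^-1 * (f (x + h k *: v) - f x) @[k --> \oo] --> d.
Proof.
move=> [+ <-]; rewrite /derivable /derive => /cvgr_dnbhsP /(_ h) H.
have {}H := H (conj (fun k => lt0r_neq0 (h_gt0 k)) cvg_h).
have -> : (fun k => (h k)^-1 * (f (x + h k *: v) - f x)) =
    (fun k => (h k)^-1 *: ((f \o shift x) (h k *: v) - f x)).
  by apply/funext => k; rewrite /shift /= [_ + x]addrC.
exact: H.
Qed.

(* Translation invariance gives every difference quotient integral zero; the
   mean value theorem provides a bounded, compactly supported majorant. *)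
Lemma integral_derive_eq0 (psi dpsi : E -> R) (i : 'I_n) (L : R) :
  (forall x, is_derive x (delta_mx ord0 i) psi (dpsi x)) ->
  measurable_fun setT psi -> measurable_fun setT dpsi ->
  (forall x, `|dpsi x| <= L) -> (forall x, `|psi x| <= L) ->
  (forall x, ~ unit_ball x -> psi x = 0) ->
  (\int[lam]_x (dpsi x)%:E = 0)%E.
Proof.
move=> dp mp mdp Ldp Lp p0.
set v : E := delta_mx ord0 i in dp *.
have L0 : 0 <= L := le_trans (normr_ge0 _) (Lp 0).
(* The steps satisfy [h k <= 1], so [psi] and all the translates used vanish outside the ball of
   radius 2. *)
pose B : set E := [set x | enorm (0 - x) < 2].
have mB : measurable B.
  rewrite -[X in measurable X]setTI.
  have -> : B = (fun z : E => enorm (0 - z)) @^-1` `]-oo, 2[.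
    by apply/seteqP; split => z /=; rewrite in_itv.
  exact: (measurableT_comp measurable_edist (pair1_measurable (0 : E))).
have Boo : (lam B < +oo)%E.
  by apply: (le_lt_trans (@upper_regular_lebesgue_rV R n 0 2 _)); rewrite ?ltry.
pose g x : R := L * \1_B x.
have ig : lam.-integrable setT (EFin \o g).
  apply/integrableP; split.
    by apply/measurable_EFinP; apply: measurable_funM => //; exact: measurable_indic.
  under eq_integral => x _ do rewrite /= ger0_norm ?mulr_ge0// EFinM.
  rewrite ge0_integralZl_EFin//; last first.
    by apply/measurable_EFinP; exact: measurable_indic.
  by rewrite integral_indic// setIT lte_mul_pinfty.
have ip : lam.-integrable setT (EFin \o psi).
  apply: (le_integrable measurableT _ _ ig); first exact/measurable_EFinP.
  move=> x _; rewrite /= lee_fin /g.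
  have [x1|x1] := pselect (unit_ball x).
    rewrite indicE mem_set ?mulr1; first by rewrite (ger0_norm L0).
    by move: x1; rewrite /unit_ball /B/= sub0r enormN => /lt_trans; apply; rewrite ltr1n.
  by rewrite p0// normr0.
pose q k x : R := (h k)^-1 * (psi (x + h k *: v) - psi x).
have mpt k : measurable_fun setT (fun x : E => psi (x + h k *: v)).
  exact: (measurableT_comp mp (measurable_row_translation _)).
have mq k : measurable_fun setT (q k).
  by apply: measurable_funM => //; apply: measurable_funB.
have qg k x : `|q k x| <= g x.
  have [Bx|Bx] := pselect (B x); last first.
    have x2 : 2 <= enorm x.
      by move/negP : Bx; rewrite /B/= sub0r enormN -leNgt.
    have xh : ~ unit_ball (x + h k *: v).
      rewrite /unit_ball/=; apply/negP; rewrite -leNgt.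
      have := ler_enormD (x + h k *: v) (- (h k *: v)).
      rewrite addrK enormN enormZ enorm_delta mulr1 ger0_norm ?(ltW (h_gt0 k))//.
      have : h k <= 1 by rewrite invf_le1 // ler1n.
      lra.
    have x1 : ~ unit_ball x.
      by rewrite /unit_ball/=; apply/negP; rewrite -leNgt; lra.
    by rewrite /q !p0// subrr mulr0 normr0 mulr_ge0.
  rewrite /g indicE mem_set// mulr1.
  have dl (t : R) : is_derive t 1 (fun t => psi (x + t *: v)) (dpsi (x + t *: v)).
    exact/is_derive_lineP.
  have [|c _] := @MVT_segment R _ _ 0 (h k) (ltW (h_gt0 k)) (fun t _ => dl t).
    apply: continuous_subspaceT => t.
    have [d _] := dl t.
    exact/differentiable_continuous/derivable1_diffP.
  rewrite scale0r addr0 subr0 /q => ->.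
  by rewrite mulrC mulfK ?lt0r_neq0.
have q0 k : (\int[lam]_x (q k x)%:E = 0)%E.
  have it : lam.-integrable setT (fun x : E => (psi (x + h k *: v))%:E).
    apply: (integrable_translation _ ip).
  under eq_integral do rewrite EFinM EFinB.
  rewrite integralZl//; last exact: integrableB.
  rewrite integralB//.
  rewrite (@integral_translation R n (h k *: v) (EFin \o psi))// subee ?mule0//.
  exact: integrable_fin_num.
have H := @dominated_convergence _ _ R lam setT measurableT
  (fun k x => (q k x)%:E) (EFin \o dpsi) (EFin \o g).
have [|||||_ _ H2] := H.
- by move=> k; exact/measurable_EFinP.
- exact/measurable_EFinP.
- apply: aeW => x _.
  by apply: cvg_EFin; [near=> k|exact: cvg_difference_quotient].
- exact: ig.
- by apply: aeW => x k _; rewrite /= lee_fin.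
have : (fun k => \int[lam]_x (q k x)%:E)%E = cst 0%E by apply/funext => k; exact: q0.
move=> e; rewrite e in H2.
by apply: (cvg_unique _ H2) => //; exact: cvg_cst.
Unshelve. all: by end_near. Qed.

End integral_of_derivative.

(** * Integration by parts against the Green kernel *)

Section green_integration_by_parts.
Context {R : realType} {n : nat}.
Local Notation E := 'rV[R]_n.
Local Notation lam := (@lebesgue_rV R n).

Lemma compact_continuous_bound (K : set E) (f : E -> R) : compact K ->
  continuous f -> (forall x, ~ K x -> f x = 0) ->
  exists2 M : R, 0 <= M & forall x, `|f x| <= M.
Proof.
move=> cK cf f0; have [K0|/set0P K0] := eqVneq K set0.
  by exists 0 => // x; rewrite f0 ?normr0// K0.
have cnf : continuous (fun x => `|f x|).
  by move=> x; apply: (continuous_comp (cf x)); exact: norm_continuous.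
have [c _ Hc] := compact_EVT_max K0 cK (continuous_subspaceT cnf).
exists `|f c| => // x; have [Kx|Kx] := pselect (K x); last by rewrite f0// normr0.
by apply: Hc; rewrite inE.
Qed.

(** The norm attains its maximum on a compact set. On the support of a test function the boundary
    weights can therefore be divided out. *)
Lemma compact_ball_gap (K : set E) : compact K -> K `<=` unit_ball ->
  exists2 d : R, 0 < d & forall x, K x -> d <= 1 - enorm x.
Proof.
move=> cK KB; have [K0|/set0P K0] := eqVneq K set0.
  by exists 1 => // x; rewrite K0.
have [c Kc Hc] := compact_EVT_max K0 cK (continuous_subspaceT (@continuous_enorm R n)).
exists (1 - enorm c).
  by rewrite subr_gt0; move: Kc; rewrite inE => /KB.
by move=> x Kx; rewrite lerD2l lerN2; apply: Hc; rewrite inE.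
Qed.

Lemma test_function_data (phi : E -> R) (i : 'I_n) : test_function unit_ball phi ->
  [/\ continuous phi, continuous (pderiv i phi),
    forall x, is_derive x (delta_mx ord0 i) phi (pderiv i phi x) &
    exists K (d M : R), [/\ compact K, 0 < d, 0 <= M,
      (forall x, K x -> unit_ball x /\ d <= 1 - enorm x) &
      (forall x, ~ K x -> phi x = 0 /\ pderiv i phi x = 0) /\
      (forall x, `|phi x| <= M /\ `|pderiv i phi x| <= M)]].
Proof.
move=> [Ckphi [K [cK KB phi0]]].
have [cphi /(_ i)[dphi [cdphi _]]] := Ckphi 1%N.
split => //.
have dphi0 x : ~ K x -> pderiv i phi x = 0.
  move=> nKx; have oK : open (~` K) by apply: closed_openC; exact: compact_closed.
  rewrite /pderiv (@near_eq_derive _ _ _ _ (cst 0)).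
  - by rewrite derive_cst.
  - have : nbhs x (~` K) by apply: open_nbhs_nbhs.
    by apply: filterS => y nKy; rewrite phi0.
have [M1 M10 HM1] := compact_continuous_bound cK cphi phi0.
have [M2 M20 HM2] := compact_continuous_bound cK cdphi dphi0.
have [d d0 Hd] := compact_ball_gap cK KB.
exists K, d, (M1 + M2); split => //.
- by rewrite addr_ge0.
- by move=> x Kx; split; [exact: KB|exact: Hd].
split.
- by move=> x nKx; split; [exact: phi0|exact: dphi0].
- by move=> x; split; [rewrite (le_trans (HM1 x))// lerDl|rewrite (le_trans (HM2 x))// lerDr].
Qed.

Variable s : R.
Hypotheses (n0 : (0 < n)%N) (s_gt : 2^-1 < s) (s_lt : s < 1).
Local Ltac slra := have ? := s_gt; have ? := s_lt; lra.

(** The bounds with r = s, divided by the weight on the support of phi, show that the product and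
    its derivative are bounded: for fixed e > 0 the kernel is at most its value at distance
    sqrt(e). *)
Let integral_green_reg (e : R) (phi : E -> R) (i : 'I_n) (y : E) :
  0 < e -> e <= 1 -> unit_ball y -> test_function unit_ball phi ->
  (\int[lam]_x (green_reg s e x y * pderiv i phi x + green_dreg s e i x y * phi x)%:E = 0)%E.
Proof.
move=> e0 e1 y1 tphi.
have [cphi cdphi dphi [K [d [M [cK d0 M0 KB [phi0 phiM]]]]]] := test_function_data i tphi.
have [C1 C10 H1] := green_reg_le n0 s_gt s_lt.
have [C2 C20 H2] := green_dreg_le n0 s_gt s_lt.
have mphi := row_continuous_measurable cphi.
have mdphi := row_continuous_measurable cdphi.
have mG : measurable_fun setT (fun x => green_reg s e x y).
  exact: (measurableT_comp (measurable_green_reg n0 s_gt s_lt (ltW e0)) (pair2_measurable y)).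
have mdG : measurable_fun setT (fun x => green_dreg s e i x y).
  exact: (measurableT_comp (measurable_green_dreg n0 s_gt s_lt i (ltW e0)) (pair2_measurable y)).
pose P := Num.sqrt e `^ (- (n%:R + 1 - 2 * s)).
have P0 : 0 <= P by rewrite powR_ge0.
have gen (C g : R) (x : E) : 0 < C -> K x ->
    (1 - enorm x) `^ s * `|g| <=
      C * (Num.sqrt (reg_sqdist e x y) `^ (- (n%:R + 1 - 2 * s)) * (1 - enorm y) `^ s) ->
    `|g| <= (d `^ s)^-1 * (C * P).
  move=> C0 Kx; have [x1 dx] := KB x Kx.
  move=> H; rewrite ler_pdivlMl ?powR_gt0//.
  apply: (@le_trans _ _ ((1 - enorm x) `^ s * `|g|)).
    rewrite ler_wpM2r// ge0_ler_powR ?nnegrE//; first by slra.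
    - exact: ltW.
    - by rewrite (le_trans _ dx)// ltW.
  apply: (le_trans H); rewrite ler_pM2l//.
  rewrite -[leRHS]mulr1; apply: ler_pM; rewrite ?powR_ge0//.
    exact: sqrt_reg_sqdist_le_eps.
  have s0 : 0 <= s by slra.
  rewrite [leRHS](_ : 1 = 1 `^ s); last by rewrite powR1.
  apply: ge0_ler_powR; rewrite ?nnegrE//.
    by move: y1; rewrite /unit_ball/=; slra.
  by have := enorm_ge0 y; slra.
have w0 x : 0 < reg_sqdist e x y by rewrite /reg_sqdist ltr_wpDl// sqr_ge0.
have s1 : 1 - s <= s by slra.
pose B1 := (d `^ s)^-1 * (C1 * P); pose B2 := (d `^ s)^-1 * (C2 * P).
have B10 : 0 <= B1 by rewrite !mulr_ge0 ?invr_ge0 ?powR_ge0 ?(ltW C10).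
have B20 : 0 <= B2 by rewrite !mulr_ge0 ?invr_ge0 ?powR_ge0 ?(ltW C20).
have G1 x : K x -> `|green_reg s e x y| <= B1.
  move=> Kx; have [x1 _] := KB x Kx.
  exact: gen C10 Kx (H1 e s x y (ltW e0) e1 x1 y1 (w0 x) s1 (lexx s)).
have G2 x : K x -> `|green_dreg s e i x y| <= B2.
  move=> Kx; have [x1 _] := KB x Kx.
  exact: gen C20 Kx (H2 e s i x y (ltW e0) x1 y1 (w0 x) s1 (lexx s)).
have bm (g f b : R) : `|g| <= b -> `|f| <= M -> `|g * f| <= b * M.
  by move=> gb fM; rewrite normrM ler_pM.
apply: (@integral_derive_eq0 R n (fun x => green_reg s e x y * phi x) _ i ((B1 + B2) * M)).
- move=> x; have [Kx|nKx] := pselect (K x).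
    have [x1 _] := KB x Kx.
    apply: (is_derive_eq (is_deriveM (is_derive_green_reg n0 s_gt s_lt i e0 x1 y1) (dphi x))).
    by rewrite /GRing.scale/= [phi x * _]mulrC.
  (* Off [K] the kernel need not be differentiable, as x may lie outside the ball; but the product
     vanishes in a whole neighbourhood. *)
  suff H : is_derive x (delta_mx ord0 i) (fun x => green_reg s e x y * phi x) 0.
    apply: (is_derive_eq H); have [p1 p2] := phi0 x nKx.
    by rewrite p1 p2 !mulr0 addr0.
  have oK : open (~` K) by apply: closed_openC; exact: compact_closed.
  have nz : \forall z \near x, cst 0 z = green_reg s e z y * phi z.
    have : nbhs x (~` K) by apply: open_nbhs_nbhs.
    by apply: filterS => z /phi0[-> _]; rewrite mulr0.
  split; first by apply: (near_eq_derivable nz).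
  transitivity ('D_(delta_mx ord0 i) (cst 0) x : R); last exact: derive_cst.
  by apply/esym/near_eq_derive; exact: nz.
- exact: measurable_funM.
- by apply: measurable_funD; exact: measurable_funM.
- move=> x; have [Kx|nKx] := pselect (K x).
    have [p1 p2] := phiM x.
    rewrite (le_trans (ler_normD _ _))// mulrDl.
    by apply: lerD; apply: bm => //; [exact: G1|exact: G2].
  by have [-> ->] := phi0 x nKx; rewrite !mulr0 addr0 normr0 mulr_ge0// addr_ge0.
- move=> x; have [Kx|nKx] := pselect (K x).
    have [p1 p2] := phiM x.
    by apply: bm => //; rewrite (le_trans (G1 x Kx))// lerDl.
  by have [-> _] := phi0 x nKx; rewrite mulr0 normr0 mulr_ge0// addr_ge0.
- move=> x x1; have [//|-> _] := phi0 x; last by rewrite mulr0.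
  by move=> Kx; apply: x1; have [] := KB x Kx.
Qed.

Let a : R := n%:R + 1 - 2 * s.

Let a_gt0 : 0 < a.
Proof. by have n1 : (1 : R) <= n%:R; [rewrite ler1n|rewrite /a; slra]. Qed.

Let a_lt : a < n%:R.
Proof. by rewrite /a; slra. Qed.

Let edist (z : E * E) : R := enorm (z.1 - z.2).

Lemma edist_near (b rho : R) : 0 < b -> b < n%:R -> 0 < rho ->
  exists2 C : R, 0 < C & forall x : E,
  (\int[lam]_y (enorm (x - y) `^ (- b) * (enorm (x - y) < rho)%R%:R)%:E <= C%:E)%E.
Proof.
move=> b0 bn rho0.
have A0 : 0 < (2 ^+ n : R) by rewrite exprn_gt0.
have [C C0 HC] := @riesz_near _ _ R lam edist (2 ^+ n) n%:R measurable_edist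
   (fun z => enorm_ge0 _) (@upper_regular_lebesgue_rV R n) A0 b b0 bn.
exists (C * rho `^ (n%:R - b)); first by rewrite mulr_gt0// powR_gt0.
by move=> x; exact: HC.
Qed.

(** Cut off at 2, the diameter of the ball, the Riesz kernel is integrable over the whole space and
    unchanged between points of the ball. *)
Let K2 (y x : E) : R := enorm (x - y) `^ (- a) * (enorm (x - y) < 2)%R%:R.

Let mK2 y : measurable_fun setT (K2 y).
Proof.
have md : measurable_fun setT (fun x : E => enorm (x - y)).
  exact: (measurableT_comp measurable_edist (pair2_measurable y)).
apply: measurable_funM; first exact: (measurableT_comp (measurable_powR _) md).
by apply: measurable_bool_natr; exact: measurable_fun_ltr.
Qed.

Let iK2 y : lam.-integrable setT (EFin \o K2 y).
Proof.
apply/integrableP; split; first exact/measurable_EFinP.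
have [C C0 HC] := edist_near a_gt0 a_lt (ltr0n R 2).
apply: (le_lt_trans _ (ltry C)); apply: le_trans (HC y).
apply: eq_lee; apply: eq_integral => x _ /=.
by rewrite ger0_norm ?mulr_ge0 ?powR_ge0// /K2 enormBC.
Qed.

Lemma unit_ball_edist_lt2 (x y : E) : unit_ball x -> unit_ball y -> enorm (x - y) < 2.
Proof.
rewrite /unit_ball/= => x1 y1; have := ler_enormD x (- y); rewrite enormN; lra.
Qed.

Lemma one_minus_le1 (y : E) (r : R) : unit_ball y -> 0 <= r -> (1 - enorm y) `^ r <= 1.
Proof.
move=> y1 r0; rewrite [leRHS](_ : 1 = 1 `^ r); last by rewrite powR1.
apply: ge0_ler_powR; rewrite ?nnegrE//.
  by move: y1; rewrite /unit_ball/=; lra.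
by have := enorm_ge0 y; lra.
Qed.

(** The majorant (B1 + B2) [K2] serves all e at once, since the bounds in lam pass to |x - y|. They
    do so off x = y only, a null set because 0 < n. *)
Lemma green_by_parts (phi : E -> R) (i : 'I_n) (y : E) :
  unit_ball y -> test_function unit_ball phi ->
  [/\ lam.-integrable setT (fun x => (green_reg s 0 x y * pderiv i phi x)%:E),
    lam.-integrable setT (fun x => (green_dreg s 0 i x y * phi x)%:E) &
    (\int[lam]_x (green_reg s 0 x y * pderiv i phi x)%:E =
     - \int[lam]_x (green_dreg s 0 i x y * phi x)%:E)%E].
Proof.
move=> y1 tphi.
have [cphi cdphi dphi [K [d [M [cK d0 M0 KB [phi0 phiM]]]]]] := test_function_data i tphi.
have [C1 C10 H1] := green_reg_le n0 s_gt s_lt.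
have [C2 C20 H2] := green_dreg_le n0 s_gt s_lt.
have mphi := row_continuous_measurable cphi.
have mdphi := row_continuous_measurable cdphi.
have mG (e : R) : 0 <= e -> measurable_fun setT (fun x => green_reg s e x y * pderiv i phi x).
  move=> e0; apply: measurable_funM => //.
  exact: (measurableT_comp (measurable_green_reg n0 s_gt s_lt e0) (pair2_measurable y)).
have mdG (e : R) : 0 <= e -> measurable_fun setT (fun x => green_dreg s e i x y * phi x).
  move=> e0; apply: measurable_funM => //.
  exact: (measurableT_comp (measurable_green_dreg n0 s_gt s_lt i e0) (pair2_measurable y)).
have s1 : 1 - s <= s by slra.
have s0 : 0 <= s by slra.
have gen0 (C g f : R) (x : E) : 0 < C -> K x -> `|f| <= M ->
    (1 - enorm x) `^ s * `|g| <= C * (enorm (x - y) `^ (- a) * (1 - enorm y) `^ s) ->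
    `|g * f| <= (d `^ s)^-1 * C * M * K2 y x.
  move=> C0 Kx fM; have [x1 dx] := KB x Kx.
  move=> H; rewrite normrM [leRHS]mulrAC; apply: ler_pM => //.
  rewrite -mulrA ler_pdivlMl ?powR_gt0//.
  apply: (@le_trans _ _ ((1 - enorm x) `^ s * `|g|)).
    rewrite ler_wpM2r// ge0_ler_powR ?nnegrE//.
    - exact: ltW.
    - by rewrite (le_trans _ dx)// ltW.
  apply: (le_trans H); rewrite ler_pM2l// /K2 unit_ball_edist_lt2// mulr1.
  by rewrite -[leRHS]mulr1 ler_wpM2l ?powR_ge0// one_minus_le1.
have gen (C g f e : R) (x : E) : 0 < C -> K x -> 0 <= e -> x != y -> `|f| <= M ->
    (1 - enorm x) `^ s * `|g| <=
      C * (Num.sqrt (reg_sqdist e x y) `^ (- a) * (1 - enorm y) `^ s) ->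
    `|g * f| <= (d `^ s)^-1 * C * M * K2 y x.
  move=> C0 Kx e0 xy fM H; apply: (gen0 C g f x C0 Kx fM); apply: (le_trans H).
  by rewrite ler_pM2l// ler_wpM2r ?powR_ge0// sqrt_reg_sqdist_le.
have w0 e x : 0 <= e -> x != y -> 0 < reg_sqdist e x y.
  move=> e0 xy; rewrite /reg_sqdist ltr_wpDr// exprn_gt0// lt_neqAle enorm_ge0 andbT eq_sym.
  by apply: contra xy => /eqP/enorm_eq0/subr0_eq ->.
pose B1 := (d `^ s)^-1 * C1 * M; pose B2 := (d `^ s)^-1 * C2 * M.
have B10 : 0 <= B1 by rewrite !mulr_ge0 ?invr_ge0 ?powR_ge0 ?(ltW C10).
have B20 : 0 <= B2 by rewrite !mulr_ge0 ?invr_ge0 ?powR_ge0 ?(ltW C20).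
have K20 x : 0 <= K2 y x by rewrite mulr_ge0 ?powR_ge0.
have G1 (e : R) x : 0 <= e -> e <= 1 -> x != y ->
    `|green_reg s e x y * pderiv i phi x| <= B1 * K2 y x.
  move=> e0 e1 xy; have [Kx|nKx] := pselect (K x).
    have [x1 _] := KB x Kx; have [_ pM] := phiM x.
    exact: gen C10 Kx e0 xy pM (H1 e s x y e0 e1 x1 y1 (w0 e x e0 xy) s1 (lexx s)).
  by have [_ ->] := phi0 x nKx; rewrite mulr0 normr0 mulr_ge0.
have G2 (e : R) x : 0 <= e -> e <= 1 -> x != y ->
    `|green_dreg s e i x y * phi x| <= B2 * K2 y x.
  move=> e0 e1 xy; have [Kx|nKx] := pselect (K x).
    have [x1 _] := KB x Kx; have [pM _] := phiM x.
    exact: gen C20 Kx e0 xy pM (H2 e s i x y e0 x1 y1 (w0 e x e0 xy) s1 (lexx s)).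
  by have [-> _] := phi0 x nKx; rewrite mulr0 normr0 mulr_ge0.
have aexy : {ae lam, forall x, x != y}.
  exists [set y]; split; [|exact: (lebesgue_rV_set1 n0 y)|].
    by apply: row_compact_measurable; exact: compact_set1.
  by move=> x /= /negP; rewrite negbK => /eqP.
pose e k : R := k.+1%:R^-1.
have e_gt0 k : 0 < e k by rewrite invr_gt0.
have e_le1 k : e k <= 1 by rewrite invf_le1// ler1n.
have e_cvg : e @ \oo --> (0 : R) by exact: cvg_harmonic.
have iD c : lam.-integrable setT (fun x => (c * K2 y x)%:E).
  exact: (integrableZl measurableT c (iK2 y)).
have iG : lam.-integrable setT (fun x => (green_reg s 0 x y * pderiv i phi x)%:E).
  have [C C0 HC] := green_reg0_le n0 s_gt s_lt.
  apply: (le_integrable measurableT _ _ (iD ((d `^ s)^-1 * C * M))).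
    by apply/measurable_EFinP; exact: mG.
  move=> x _; rewrite /= lee_fin [leRHS]ger0_norm; last first.
    by rewrite mulr_ge0// !mulr_ge0 ?invr_ge0 ?powR_ge0 ?(ltW C0).
  have [Kx|nKx] := pselect (K x); last first.
    have [_ ->] := phi0 x nKx.
    by rewrite mulr0 normr0 mulr_ge0// !mulr_ge0 ?invr_ge0 ?powR_ge0 ?(ltW C0).
  have [x1 _] := KB x Kx; have [_ pM] := phiM x.
  exact: gen0 C0 Kx pM (HC s x y x1 y1 s1 (lexx s)).
have idG : lam.-integrable setT (fun x => (green_dreg s 0 i x y * phi x)%:E).
  have [C C0 HC] := green_dreg0_le n0 s_gt s_lt.
  apply: (le_integrable measurableT _ _ (iD ((d `^ s)^-1 * C * M))).
    by apply/measurable_EFinP; exact: mdG.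
  move=> x _; rewrite /= lee_fin [leRHS]ger0_norm; last first.
    by rewrite mulr_ge0// !mulr_ge0 ?invr_ge0 ?powR_ge0 ?(ltW C0).
  have [Kx|nKx] := pselect (K x); last first.
    have [-> _] := phi0 x nKx.
    by rewrite mulr0 normr0 mulr_ge0// !mulr_ge0 ?invr_ge0 ?powR_ge0 ?(ltW C0).
  have [x1 _] := KB x Kx; have [pM _] := phiM x.
  exact: gen0 C0 Kx pM (HC s i x y x1 y1 s1 (lexx s)).
split => //.
have H := @dominated_convergence _ _ R lam setT measurableT
  (fun k x => (green_reg s (e k) x y * pderiv i phi x + green_dreg s (e k) i x y * phi x)%:E)
  (fun x => (green_reg s 0 x y * pderiv i phi x + green_dreg s 0 i x y * phi x)%:E)
  (fun x => ((B1 + B2) * K2 y x)%:E).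
have [|||||_ _ H3] := H.
- by move=> k; apply/measurable_EFinP; apply: measurable_funD; [apply: mG|apply: mdG]; exact: ltW.
- by apply/measurable_EFinP; apply: measurable_funD; [exact: mG|exact: mdG].
- apply: filterS aexy => x xy _; apply: cvg_EFin; first by near=> k.
  have [Kx|nKx] := pselect (K x); last first.
    have [-> ->] := phi0 x nKx; rewrite !mulr0 addr0.
    by under eq_fun do rewrite !mulr0 addr0; exact: cvg_cst.
  have [x1 _] := KB x Kx.
  by apply: cvgD; apply: cvgM;
    [exact: cvg_green_reg|exact: cvg_cst|exact: cvg_green_dreg|exact: cvg_cst].
- exact: iD.
- apply: filterS aexy => x xy k _; rewrite /= lee_fin.
  rewrite (le_trans (ler_normD _ _))// mulrDl.
  by apply: lerD; [apply: G1|apply: G2] => //; exact: ltW.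
have z k : (\int[lam]_x (green_reg s (e k) x y * pderiv i phi x + green_dreg s (e k) i x y * phi x)%:E = 0)%E.
  exact: integral_green_reg.
have I0 : (\int[lam]_x (green_reg s 0 x y * pderiv i phi x + green_dreg s 0 i x y * phi x)%:E = 0)%E.
  apply: (cvg_unique _ H3) => //.
  rewrite (_ : [sequence _]_k = cst 0%E); first exact: cvg_cst.
  by apply/funext => k; exact: z.
move: I0; under eq_integral do rewrite EFinD.
rewrite integralD// => I0.
have fG := integrable_fin_num measurableT iG.
have fdG := integrable_fin_num measurableT idG.
move: I0; rewrite -(fineK fG) -(fineK fdG) -EFinD -EFinN => -[h].
by congr EFin; lra.
Unshelve. all: by end_near. Qed.

End green_integration_by_parts.

(** * Potentials of weighted Riesz type *)

Section kernel_potential.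
Context {R : realType} {n : nat}.
Local Notation E := 'rV[R]_n.
Local Notation lam := (@lebesgue_rV R n).
Local Notation B := (@unit_ball R n).

Definition weighted (r : R) (f : E -> R) (y : E) : R :=
  `|((fun x => bdist x `^ r * f x) \_ B) y|.

(** The kernel is left general so that the Green function and each component of its gradient are
    treated together. *)
Definition kernel_potential (Ker : E * E -> R) (f : E -> R) : E -> R :=
  (fun x => \int[lam]_(y in B) (Ker (x, y) * f y)) \_ B.

Lemma restrict_in (g : E -> R) x : B x -> (g \_ B) x = g x.
Proof. by move=> Bx; rewrite patchE mem_set. Qed.

Lemma restrict_out (g : E -> R) x : ~ B x -> (g \_ B) x = 0.
Proof. by move=> Bx; rewrite patchE memNset. Qed.

Hypothesis n0 : (0 < n)%N.

Lemma weighted_in r f y : B y -> weighted r f y = (1 - enorm y) `^ r * `|f y|.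
Proof.
by move=> By; rewrite /weighted restrict_in// bdistE// normrM ger0_norm// powR_ge0.
Qed.

Lemma weighted_out r f y : ~ B y -> weighted r f y = 0.
Proof. by move=> By; rewrite /weighted restrict_out// normr0. Qed.

Lemma measurable_restrict_ball (g : E -> R) : measurable_fun B g ->
  measurable_fun setT (g \_ B).
Proof. by move=> mg; apply: (measurable_restrictT _ _).1 => //; exact: measurable_unit_ball. Qed.

Lemma measurable_weighted r f : measurable_fun B f -> measurable_fun setT (weighted r f).
Proof.
move=> mf; apply: (measurableT_comp (@normr_measurable R setT)).
apply: measurable_restrict_ball.
have mw : measurable_fun B (fun x : E => (1 - enorm x) `^ r * f x).
  apply: measurable_funM => //; apply: (measurableT_comp (measurable_powR _)).
  by apply: measurable_funB => //; apply: measurable_funTS; exact: measurable_enorm.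
apply: eq_measurable_fun mw => x; rewrite inE => Bx.
by rewrite bdistE.
Qed.

Lemma weighted_ge0 r f y : 0 <= weighted r f y.
Proof. exact: normr_ge0. Qed.

Variables (Ker : E * E -> R) (a C r : R) (f : E -> R).
Hypothesis mKer : measurable_fun setT Ker.
Hypotheses (C0 : 0 < C) (r0 : 0 <= r) (a0 : 0 < a) (an : a < n%:R).
Hypothesis KerC : forall x y, B x -> B y ->
  (1 - enorm x) `^ r * `|Ker (x, y)| <= C * (enorm (x - y) `^ (- a) * (1 - enorm y) `^ r).
Hypothesis mf : measurable_fun B f.
Hypothesis foo : (\int[lam]_y (weighted r f y)%:E < +oo)%E.

Let ft := f \_ B.
Let mft : measurable_fun setT ft := measurable_restrict_ball mf.
Let F := weighted r f.
Let mF : measurable_fun setT F := measurable_weighted r mf.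
Let F0 y : 0 <= F y := weighted_ge0 r f y.

Let mft2 : measurable_fun setT (fun z : E * E => ft z.2).
Proof. exact: (measurableT_comp mft measurable_snd). Qed.

Let mW : measurable_fun setT (fun z : E * E => Ker z * ft z.2).
Proof. exact: measurable_funM. Qed.

Let mF2 : measurable_fun setT (fun z : E * E => F z.2).
Proof. exact: (measurableT_comp mF measurable_snd). Qed.

Let mk : measurable_fun setT (fun z : E * E => enorm (z.1 - z.2) `^ (- a)).
Proof. exact: (measurableT_comp (measurable_powR _) measurable_edist). Qed.

Let mkF : measurable_fun setT (fun z : E * E => (enorm (z.1 - z.2) `^ (- a) * F z.2)%:E).
Proof. by apply/measurable_EFinP; exact: measurable_funM. Qed.

Lemma kernel_potentialE x : B x ->
  kernel_potential Ker f x = fine (\int[lam]_y (Ker (x, y) * ft y)%:E)%E.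
Proof.
move=> Bx; rewrite /kernel_potential restrict_in// /Rintegral; congr fine.
rewrite integral_mkcond; apply: eq_integral => y _.
by rewrite /ft !patchE; case: ifP => // _; rewrite mulr0.
Qed.

Let KF x y : B x -> (1 - enorm x) `^ r * `|Ker (x, y) * ft y| <=
  C * (enorm (x - y) `^ (- a) * F y).
Proof.
move=> Bx; have [By|nBy] := pselect (B y); last first.
  by rewrite /F /ft restrict_out// weighted_out// mulr0 normr0 !mulr0.
rewrite /F /ft restrict_in// weighted_in// normrM.
by have := ler_wpM2r (normr_ge0 (f y)) (KerC Bx By); rewrite -!mulrA.
Qed.

Lemma kernel_potential_bound x : B x ->
  (((1 - enorm x) `^ r * `|kernel_potential Ker f x|)%:E <=
   C%:E * \int[lam]_y (enorm (x - y) `^ (- a) * F y)%:E)%E.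
Proof.
move=> Bx; rewrite kernel_potentialE//.
have mx : measurable_fun setT (fun y => (Ker (x, y) * ft y)%:E).
  by apply/measurable_EFinP; exact: (measurableT_comp mW (pair1_measurable x)).
rewrite EFinM.
apply: (@le_trans _ _ (((1 - enorm x) `^ r)%:E * \int[lam]_y `|(Ker (x, y) * ft y)%:E|)%E).
  rewrite lee_wpmul2l ?lee_fin ?powR_ge0//.
  apply: le_trans (le_abse_integral lam measurableT mx).
  (* [fine] sends infinite values to 0, so the bound also holds where the integral diverges. *)
  by case: (\int[lam]_y _)%E => [z||] //=; rewrite normr0 leey.
rewrite -ge0_integralZl_EFin ?powR_ge0//; last exact: measurableT_comp.
rewrite -ge0_integralZl_EFin ?(ltW C0)//; last 2 first.
- by move=> y _; rewrite lee_fin mulr_ge0 ?powR_ge0.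
- exact: (measurableT_comp mkF (pair1_measurable x)).
apply: ge0_le_integral => //.
- by move=> y _; rewrite mule_ge0// lee_fin powR_ge0.
- by apply: measurable_funeM; exact: measurableT_comp.
- by apply: measurable_funeM; exact: (measurableT_comp mkF (pair1_measurable x)).
by move=> y _; rewrite /= -!EFinM lee_fin; exact: KF.
Qed.

Lemma measurable_kernel_potential : measurable_fun setT (kernel_potential Ker f).
Proof.
apply: measurable_restrict_ball; apply: measurable_funTS.
have -> : (fun x => \int[lam]_(y in B) (Ker (x, y) * f y)) =
    (fun x => fine (\int[lam]_y (Ker (x, y) * ft y)%:E)%E).
  apply/funext => x; rewrite /Rintegral; congr fine.
  rewrite integral_mkcond; apply: eq_integral => y _.
  by rewrite /ft !patchE; case: ifP => // _; rewrite mulr0.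
apply: (measurableT_comp (@fine_measurable R setT measurableT)).
under eq_fun do rewrite integralE.
pose g z := (Ker z * ft z.2)%:E.
have mg : measurable_fun setT g by exact/measurable_EFinP.
apply: emeasurable_funB.
- have H := @measurable_fun_fubini_tonelli_F _ _ _ _ R lam (g^\+)%E (measurable_funepos mg) (funepos_ge0 g).
  apply: eq_measurable_fun H => x _; apply: eq_integral => y _.
  by rewrite [in LHS]unlock [in RHS]unlock.
- have H := @measurable_fun_fubini_tonelli_F _ _ _ _ R lam (g^\-)%E (measurable_funeneg mg) (funeneg_ge0 g).
  apply: eq_measurable_fun H => x _; apply: eq_integral => y _.
  by rewrite [in LHS]unlock [in RHS]unlock.
Qed.

Let K2 : exists2 c : R, 0 < c & forall y : E,
  (\int[lam]_x (enorm (x - y) `^ (- a) * (enorm (x - y) < 2)%R%:R)%:E <= c%:E)%E.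
Proof.
have [c c0 Hc] := edist_near a0 an (ltr0n R 2).
exists c; [exact: c0|move=> y].
apply: le_trans (Hc y); apply: eq_lee; apply: eq_integral => x _.
by rewrite enormBC.
Qed.

(** Between points of the ball the Riesz kernel agrees with its cutoff at 2, whose column integrals
    are uniformly bounded. *)
Lemma integral_riesz_ball : exists2 c : R, 0 < c &
  (\int[lam]_x ((\int[lam]_y (enorm (x - y) `^ (- a) * F y)%:E) * (\1_B x)%:E)
   <= c%:E * \int[lam]_y (F y)%:E)%E.
Proof.
have [c c0 Hc] := K2; exists c; first exact: c0.
pose w (z : E * E) : R := enorm (z.1 - z.2) `^ (- a) * (enorm (z.1 - z.2) < 2)%R%:R.
have mw : measurable_fun setT w.
  apply: measurable_funM => //; apply: measurable_bool_natr.
  by apply: measurable_fun_ltr => //; exact: measurable_edist.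
have w0 z : 0 <= w z by rewrite mulr_ge0 ?powR_ge0.
apply: le_trans (@le_integral_potential _ _ R lam w F c%:E mw w0 mF F0 _ Hc); last first.
  by rewrite lee_fin ltW.
apply: ge0_le_integral => //.
- move=> x _; rewrite mule_ge0//.
  by apply: integral_ge0 => y _; rewrite lee_fin mulr_ge0 ?powR_ge0.
- apply: emeasurable_funM; last by apply/measurable_EFinP; exact: measurable_indic measurable_unit_ball.
  apply: (measurable_fun_fubini_tonelli_F (fun z : E * E => (enorm (z.1 - z.2) `^ (- a) * F z.2)%:E)) => //.
  by move=> z; rewrite lee_fin mulr_ge0 ?powR_ge0.
- apply: (measurable_fun_fubini_tonelli_F (fun z : E * E => (w z * F z.2)%:E)).
    by apply/measurable_EFinP; exact: measurable_funM.
  by move=> z; rewrite lee_fin mulr_ge0.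
move=> x _; have [Bx|nBx] := pselect (B x); last first.
  rewrite indicE memNset// mule0; apply: integral_ge0 => y _.
  by rewrite lee_fin mulr_ge0.
rewrite indicE mem_set// mule1; apply: eq_lee; apply: eq_integral => y _.
have [By|nBy] := pselect (B y); last by rewrite /F weighted_out// !mulr0.
by rewrite /w /= unit_ball_edist_lt2// mulr1.
Qed.

Lemma integral_weighted_potential_lty :
  (\int[lam]_(x in B) ((1 - enorm x) `^ r * `|kernel_potential Ker f x|)%:E < +oo)%E.
Proof.
have [c c0 Hc] := integral_riesz_ball.
have mI : measurable_fun setT (fun x : E => (\int[lam]_y (enorm (x - y) `^ (- a) * F y)%:E)%E).
  apply: (measurable_fun_fubini_tonelli_F (fun z : E * E => (enorm (z.1 - z.2) `^ (- a) * F z.2)%:E)) => //.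
  by move=> z; rewrite lee_fin mulr_ge0 ?powR_ge0.
have I0 (x : E) : (0 <= \int[lam]_y (enorm (x - y) `^ (- a) * F y)%:E)%E.
  by apply: integral_ge0 => y _; rewrite lee_fin mulr_ge0 ?powR_ge0.
apply: (@le_lt_trans _ _ (\int[lam]_(x in B) (C%:E * \int[lam]_y (enorm (x - y) `^ (- a) * F y)%:E))%E).
  apply: ge0_le_integral => //.
  - exact: measurable_unit_ball.
  - by move=> x _; rewrite lee_fin mulr_ge0 ?powR_ge0.
  - apply/measurable_EFinP; apply: measurable_funM.
      apply: (measurableT_comp (measurable_powR _)); apply: measurable_funB => //.
      by apply: measurable_funTS; exact: measurable_enorm.
    apply: (measurableT_comp (@normr_measurable R setT)).
    by apply: measurable_funTS; exact: measurable_kernel_potential.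
  - by apply: measurable_funeM; exact: measurable_funTS.
  - by move=> x Bx; exact: kernel_potential_bound.
rewrite ge0_integralZl_EFin ?(ltW C0)//; last 2 first.
- exact: measurable_unit_ball.
- exact: measurable_funTS.
have -> : (\int[lam]_(x in B) \int[lam]_y (enorm (x - y) `^ (- a) * F y)%:E =
    \int[lam]_x ((\int[lam]_y (enorm (x - y) `^ (- a) * F y)%:E) * (\1_B x)%:E))%E.
  rewrite integral_mkcond; apply: eq_integral => x _.
  rewrite patchE indicE; case: ifPn => _; first by rewrite mule1.
  by rewrite mule0.
rewrite lte_mul_pinfty ?lee_fin ?(ltW C0)//.
apply: (le_lt_trans Hc); rewrite lte_mul_pinfty ?lee_fin ?(ltW c0)//.
Qed.

Lemma loc_integrable_of_weighted (g : E -> R) : measurable_fun B g ->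
  (\int[lam]_(x in B) ((1 - enorm x) `^ r * `|g x|)%:E < +oo)%E -> loc_integrable B g.
Proof.
move=> mg goo; split => // K KB cK.
have [d d0 Hd] := compact_ball_gap cK KB.
have mK := row_compact_measurable cK.
have mgK : measurable_fun K g by apply: measurable_funS mg => //; exact: measurable_unit_ball.
apply/integrableP; split; first exact/measurable_EFinP.
have mh (D : set E) : measurable_fun D g -> measurable_fun D (fun x => ((1 - enorm x) `^ r * `|g x|)%:E).
  move=> mD; apply/measurable_EFinP; apply: measurable_funM.
    apply: (measurableT_comp (measurable_powR _)); apply: measurable_funB => //.
    by apply: measurable_funTS; exact: measurable_enorm.
  exact: (measurableT_comp (@normr_measurable R setT)).
apply: (@le_lt_trans _ _ (\int[lam]_(x in K) ((d `^ r)^-1%:E * ((1 - enorm x) `^ r * `|g x|)%:E))%E).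
  apply: ge0_le_integral => //.
  - by apply/measurable_EFinP; exact: (measurableT_comp (@normr_measurable R setT)).
  - by apply: measurable_funeM; exact: mh.
  move=> x Kx; rewrite /= -EFinM lee_fin ler_pdivlMl ?powR_gt0//.
  rewrite ler_wpM2r// ge0_ler_powR ?nnegrE ?(ltW d0)//; last exact: Hd.
  by rewrite (le_trans (ltW d0))// Hd.
rewrite ge0_integralZl_EFin ?invr_ge0 ?powR_ge0//; last 2 first.
- by move=> x _; rewrite lee_fin mulr_ge0 ?powR_ge0.
- exact: mh.
rewrite lte_mul_pinfty ?lee_fin ?invr_ge0 ?powR_ge0//.
apply: le_lt_trans goo; apply: ge0_subset_integral => //.
- exact: measurable_unit_ball.
- exact: mh.
- by move=> x _; rewrite lee_fin mulr_ge0 ?powR_ge0.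
Qed.

Lemma loc_integrable_kernel_potential : loc_integrable B (kernel_potential Ker f).
Proof.
apply: loc_integrable_of_weighted; last exact: integral_weighted_potential_lty.
by apply: measurable_funTS; exact: measurable_kernel_potential.
Qed.

(** Fubini for Ker(x,y) f(y) theta(x): as theta lives at depth at least [d], this is at most a
    constant times the Riesz kernel times the weighted f. The order on the right leaves an inner
    integral in x, ready for [green_by_parts]. *)
Lemma kernel_potential_pairing (theta : E -> R) (d M : R) :
  measurable_fun setT theta -> 0 < d -> 0 <= M -> (forall x, `|theta x| <= M) ->
  (forall x, theta x != 0 -> B x /\ d <= 1 - enorm x) ->
  (forall y, B y -> lam.-integrable setT (fun x => (Ker (x, y) * theta x)%:E)) ->
  \int[lam]_(x in B) (kernel_potential Ker f x * theta x) =
  fine (\int[lam]_y ((ft y)%:E * \int[lam]_x (Ker (x, y) * theta x)%:E))%E.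
Proof.
move=> mth d0 M0 thM supp iKth.
pose g (z : E * E) : \bar R := (Ker z * ft z.2 * theta z.1)%:E.
have mg : measurable_fun setT g.
  apply/measurable_EFinP; apply: measurable_funM => //.
  exact: (measurableT_comp mth measurable_fst).
pose c1 : R := (d `^ r)^-1 * C * M.
have c10 : 0 <= c1 by rewrite !mulr_ge0 ?invr_ge0 ?powR_ge0 ?(ltW C0).
have gle x y : (`|g (x, y)| <= c1%:E * ((enorm (x - y) `^ (- a) * F y)%:E * (\1_B x)%:E))%E.
  rewrite /g /= -!EFinM lee_fin.
  have [->|th0] := eqVneq (theta x) 0.
    rewrite mulr0 normr0 (mulr_ge0 c10)// mulr_ge0// mulr_ge0 ?powR_ge0//.
  have [Bx dx] := supp x th0.
  rewrite indicE mem_set// mulr1 normrM /c1 [leRHS]mulrAC.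
  apply: ler_pM => //.
  rewrite -mulrA ler_pdivlMl ?powR_gt0//.
  apply: (le_trans _ (KF y Bx)).
  rewrite ler_wpM2r// ge0_ler_powR ?nnegrE ?(ltW d0)//.
  by rewrite (le_trans (ltW d0)).
have mR : measurable_fun setT (fun z : E * E => (enorm (z.1 - z.2) `^ (- a) * F z.2)%:E * (\1_B z.1)%:E)%E.
  apply: emeasurable_funM => //; apply/measurable_EFinP.
  exact: (measurableT_comp (measurable_indic measurable_unit_ball) measurable_fst).
have R0 x y : (0 <= (enorm (x - y) `^ (- a) * F y)%:E * (\1_B x)%:E)%E.
  by rewrite mule_ge0// lee_fin mulr_ge0 ?powR_ge0.
have ig : (lam \x lam)%E.-integrable setT g.
  apply/(integrable12ltyP lam lam mg).
  apply: (@le_lt_trans _ _ (\int[lam]_x (c1%:E * ((\int[lam]_y (enorm (x - y) `^ (- a) * F y)%:E) * (\1_B x)%:E)))%E).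
    apply: ge0_le_integral => //.
    - by move=> x _; apply: integral_ge0.
    - exact: (measurable_fun_fubini_tonelli_F (fun z => `|g z|%E) (measurableT_comp (@abse_measurable R setT) mg)).
    - apply: measurable_funeM; apply: emeasurable_funM; last first.
        by apply/measurable_EFinP; exact: measurable_indic measurable_unit_ball.
      apply: (measurable_fun_fubini_tonelli_F (fun z : E * E => (enorm (z.1 - z.2) `^ (- a) * F z.2)%:E)) => //.
      by move=> z; rewrite lee_fin mulr_ge0 ?powR_ge0.
    move=> x _.
    apply: (@le_trans _ _ (\int[lam]_y (c1%:E * ((enorm (x - y) `^ (- a) * F y)%:E * (\1_B x)%:E)))%E).
      apply: ge0_le_integral => //.
      - exact: (measurableT_comp (@abse_measurable R setT) (measurableT_comp mg (pair1_measurable x))).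
      - by apply: measurable_funeM; exact: (measurableT_comp mR (pair1_measurable x)).
    rewrite ge0_integralZl_EFin//; last exact: (measurableT_comp mR (pair1_measurable x)).
    rewrite lee_wpmul2l ?lee_fin//.
    rewrite ge0_integralZr//.
    - exact: (measurableT_comp mkF (pair1_measurable x)).
    - by move=> y _; rewrite lee_fin mulr_ge0 ?powR_ge0.
  have [c c0 Hc] := integral_riesz_ball.
  rewrite ge0_integralZl_EFin//; last 2 first.
  - move=> x _; rewrite mule_ge0//; apply: integral_ge0 => y _.
    by rewrite lee_fin mulr_ge0 ?powR_ge0.
  - apply: emeasurable_funM; last first.
      by apply/measurable_EFinP; exact: measurable_indic measurable_unit_ball.
    apply: (measurable_fun_fubini_tonelli_F (fun z : E * E => (enorm (z.1 - z.2) `^ (- a) * F z.2)%:E)) => //.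
    by move=> z; rewrite lee_fin mulr_ge0 ?powR_ge0.
  rewrite lte_mul_pinfty ?lee_fin//.
  by apply: (le_lt_trans Hc); rewrite lte_mul_pinfty ?lee_fin ?(ltW c0).
rewrite /Rintegral; congr fine.
transitivity (\int[lam]_x (kernel_potential Ker f x * theta x)%:E)%E.
  rewrite integral_mkcond; apply: eq_integral => x _; rewrite patchE.
  case: ifPn => // /negP nBx; rewrite /kernel_potential restrict_out ?mul0r//.
  by move=> Bx; apply: nBx; rewrite inE.
transitivity (\int[lam]_x \int[lam]_y g (x, y))%E.
  apply: ae_eq_integral => //.
  - apply/measurable_EFinP; apply: measurable_funM => //.
    exact: measurable_kernel_potential.
  - exact: (measurable_fubini_F ig).
  (* Where [theta x] is nonzero, dividing by it recovers the integrability of the kernel slice from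
     that of the product; elsewhere both sides are 0. *)
  have := ae_integrable1 ig; apply: filterS => x ix _.
  rewrite /g /=.
  have [thx|th0] := eqVneq (theta x) 0.
    rewrite thx mulr0 integral0_eq// => y _; by rewrite mulr0.
  have [Bx dx] := supp x th0.
  have iKf : lam.-integrable setT (fun y => (Ker (x, y) * ft y)%:E).
    have := integrableZl measurableT (theta x)^-1 ix.
    apply: eq_integrable => // y _; rewrite /g /= -EFinM; congr EFin.
    by rewrite mulrC mulfK.
  rewrite kernel_potentialE//.
  have iK := integrable_fin_num measurableT iKf.
  have H := integralZl measurableT iKf (theta x).
  rewrite EFinM (fineK iK) muleC -H.
  by apply: eq_integral => y _; rewrite -EFinM mulrC.
rewrite (Fubini ig); apply: eq_integral => y _; rewrite /g /=.
have [By|nBy] := pselect (B y); last first.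
  by rewrite /ft restrict_out// mul0e integral0_eq// => x _; rewrite mulr0 mul0r.
rewrite -integralZl//; last exact: iKth.
by apply: eq_integral => x _; rewrite -EFinM; congr EFin; ring.
Qed.

End kernel_potential.

(** * The weak gradient of the Green potential *)

(** No integrability is required: if the positive or the negative part has infinite integral, [fine]
    makes both sides 0. *)
Lemma fine_integralN d (T : measurableType d) (R : realType)
    (mu : {measure set T -> \bar R}) (D : set T) (g : T -> \bar R) :
  fine (\int[mu]_(x in D) - g x)%E = - fine (\int[mu]_(x in D) g x)%E.
Proof.
rewrite integralE [in RHS]integralE funeposN funenegN.
by case: (\int[mu]_(x in D) _)%E => [x||]; case: (\int[mu]_(x in D) _)%E => [y||] //=;
  rewrite ?oppr0// opprB.
Qed.

Definition green_gradient {R : realType} {n : nat} (s : R) (f : 'rV[R]_n -> R)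
    (x : 'rV[R]_n) : 'rV[R]_n :=
  \row_i kernel_potential (fun z => green_dreg s 0 i z.1 z.2) f x.

Section green_gradient.
Context {R : realType} {n : nat}.
Local Notation E := 'rV[R]_n.
Local Notation lam := (@lebesgue_rV R n).
Local Notation B := (@unit_ball R n).

Variables (s r : R) (f : E -> R).
Hypotheses (n0 : (0 < n)%N) (s_gt : 2^-1 < s) (s_lt : s < 1).
Hypotheses (r_ge : 1 - s <= r) (r_le : r <= s).
Hypothesis mf : measurable_fun B f.
Hypothesis foo : (\int[lam]_y (weighted r f y)%:E < +oo)%E.

Let r0 : 0 <= r.
Proof. by apply: le_trans r_ge; rewrite subr_ge0 ltW. Qed.

Let a : R := n%:R + 1 - 2 * s.

Let a0 : 0 < a.
Proof.
have := s_gt; have := s_lt; have n1 : (1 : R) <= n%:R by rewrite ler1n.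
rewrite /a; lra.
Qed.

Let an : a < n%:R.
Proof. by have := s_gt; rewrite /a; lra. Qed.

Lemma green_potentialE : green_potential s f =
  kernel_potential (fun z => green_reg s 0 z.1 z.2) f.
Proof.
rewrite /green_potential /kernel_potential; congr (_ \_ _); apply/funext => x.
by apply: eq_Rintegral => y _; rewrite green_regE.
Qed.

Lemma green_gradientE (i : 'I_n) : (fun x => green_gradient s f x ord0 i) =
  kernel_potential (fun z => green_dreg s 0 i z.1 z.2) f.
Proof. by apply/funext => x; rewrite mxE. Qed.

Let mG : measurable_fun setT (fun z : E * E => green_reg s 0 z.1 z.2).
Proof. exact: measurable_green_reg. Qed.

Let mdG i : measurable_fun setT (fun z : E * E => green_dreg s 0 i z.1 z.2).
Proof. exact: measurable_green_dreg. Qed.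

(** [kernel_potential_pairing], with theta a partial derivative of phi for the Green function and
    theta = phi for its gradient, turns both sides into integrals in y against f that agree
    integrand by integrand. *)
Lemma weak_gradient_green : weak_gradient (green_potential s f) (green_gradient s f).
Proof.
have [C C0 HC] := green_reg0_le n0 s_gt s_lt.
have [D D0 HD] := green_dreg0_le n0 s_gt s_lt.
have {}HC x y : B x -> B y -> _ := fun Bx By => HC r x y Bx By r_ge r_le.
have {}HD i x y : B x -> B y -> _ := fun Bx By => HD r i x y Bx By r_ge r_le.
rewrite green_potentialE; split.
- exact: (loc_integrable_kernel_potential n0 mG C0 r0 a0 an HC mf foo).
- move=> i; rewrite green_gradientE.
  exact: (loc_integrable_kernel_potential n0 (mdG i) D0 r0 a0 an (HD i) mf foo).
move=> phi tphi i.
have [cphi cdphi dphi [K [d [M [cK d0 M0 KB [phi0 phiM]]]]]] := test_function_data i tphi.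
have mphi := row_continuous_measurable cphi.
have mdphi := row_continuous_measurable cdphi.
have IBP y (By : B y) := green_by_parts n0 s_gt s_lt i By tphi.
rewrite (kernel_potential_pairing n0 mG C0 r0 a0 an HC mf foo mdphi d0 M0).
- have -> : (fun x => green_gradient s f x ord0 i * phi x) =
      (fun x => kernel_potential (fun z => green_dreg s 0 i z.1 z.2) f x * phi x).
    by rewrite -green_gradientE.
  rewrite (kernel_potential_pairing n0 (mdG i) D0 r0 a0 an (HD i) mf foo mphi d0 M0).
  + rewrite -fine_integralN; congr fine; apply: eq_integral => y _.
    have [By|nBy] := pselect (B y); last by rewrite restrict_out// !mul0e oppe0.
    by have [_ _ /= ->] := IBP y By; rewrite muleN.
  + by move=> x; have [] := phiM x.
  + move=> x /eqP phix; apply: KB; apply: contrapT => nK.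
    by apply: phix; have [] := phi0 x nK.
  + by move=> y By; have [] := IBP y By.
- by move=> x; have [] := phiM x.
- move=> x /eqP phix; apply: KB; apply: contrapT => nK.
  by apply: phix; have [] := phi0 x nK.
- by move=> y By; have [] := IBP y By.
Qed.

End green_gradient.

(** * Weighted Lebesgue norms of the gradient *)

Section weighted_norm.
Context {R : realType} {n : nat}.
Local Notation E := 'rV[R]_n.
Local Notation lam := (@lebesgue_rV R n).
Local Notation B := (@unit_ball R n).
Implicit Types (r : R) (f : E -> R).

Lemma wnormE (p : R) r f :
  (wnorm p%:E r f = (\int[lam]_y (weighted r f y `^ p)%:E) `^ p^-1)%E.
Proof. by rewrite /wnorm unlock. Qed.

Lemma wnorm1E r f : (wnorm 1%:E r f = \int[lam]_y (weighted r f y)%:E)%E.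
Proof. by rewrite /wnorm Lnorm1. Qed.

Lemma wnorm_ge0 p r f : (0 <= wnorm p r f)%E.
Proof. exact: Lnorm_ge0. Qed.

Lemma wnormy_le r f (M : \bar R) : (0 <= M)%E ->
  (forall x, ((weighted r f x)%:E <= M)%E) -> (wnorm +oo%E r f <= M)%E.
Proof.
move=> M0 fM; rewrite /wnorm unlock; case: ifP => // _.
by apply/ess_supP; apply: nearW => x; exact: fM.
Qed.

Lemma ae_weighted_le_wnormy r f :
  {ae lam, forall y, ((weighted r f y)%:E <= wnorm +oo%E r f)%E}.
Proof.
rewrite /wnorm unlock; case: ifPn => [_|].
  exact: ess_sup_ge.
(* On a space of total measure 0 the supremum norm is 0 by definition; the whole space is then the
   exceptional null set. *)
rewrite -leNgt => le0; exists setT; split => //.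
by apply/eqP; rewrite eq_le le0 measure_ge0.
Qed.

Hypothesis n0 : (0 < n)%N.

Lemma integral_weighted_le_wnormy r f (k : E -> R) : measurable_fun B f ->
  measurable_fun setT k -> (forall y, 0 <= k y) ->
  (\int[lam]_y (k y * weighted r f y)%:E <= wnorm +oo%E r f * \int[lam]_y (k y)%:E)%E.
Proof.
move=> mf mk k0.
rewrite -ge0_integralZl//; last 3 first.
- exact/measurable_EFinP.
- by move=> y _; rewrite lee_fin.
- exact: wnorm_ge0.
apply: ae_ge0_le_integral => //.
- by move=> y _; rewrite lee_fin mulr_ge0 ?weighted_ge0.
- by apply/measurable_EFinP; apply: measurable_funM => //; exact: measurable_weighted.
- by move=> y _; rewrite mule_ge0 ?wnorm_ge0// lee_fin.
- by apply: emeasurable_funM => //; exact/measurable_EFinP.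
have := ae_weighted_le_wnormy r f; apply: filterS => y H _.
by rewrite EFinM muleC lee_wpmul2r// lee_fin.
Qed.

Lemma weighted_indic r f y : \1_B y * weighted r f y = weighted r f y.
Proof.
have [By|nBy] := pselect (B y); first by rewrite indicE mem_set// mul1r.
by rewrite weighted_out// mulr0.
Qed.

(** The ball has finite measure, so Hoelder's inequality against its indicator embeds the weighted
    L^p into the weighted L^1, which is all the integrability of f that the weak gradient
    requires. *)
Lemma integral_weighted_lty (p : \bar R) r f : (1 <= p)%E -> measurable_fun B f ->
  (wnorm p r f < +oo)%E -> (\int[lam]_y (weighted r f y)%:E < +oo)%E.
Proof.
move=> p1 mf.
have mF := measurable_weighted n0 r mf.
have m1 : measurable_fun setT (\1_B : E -> R) by exact: measurable_indic measurable_unit_ball.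
have I1 : (\int[lam]_y (\1_B y)%:E = lam B)%E.
  by rewrite integral_indic ?setIT//; exact: measurable_unit_ball.
have -> : (\int[lam]_y (weighted r f y)%:E = \int[lam]_y (\1_B y * weighted r f y)%:E)%E.
  by apply: eq_integral => y _; rewrite weighted_indic.
have lB := @lebesgue_rV_ball_lty R n.
case: p p1 => [p| |]; rewrite ?leeNy_eq//; last first.
  move=> _ foo.
  apply: le_lt_trans (integral_weighted_le_wnormy r mf m1 _) _ => //.
  by rewrite I1 lte_mul_pinfty ?wnorm_ge0// ge0_fin_numE ?wnorm_ge0.
rewrite lee_fin le_eqVlt => /predU1P[<-|p1].
  by rewrite wnorm1E; under [X in _ -> (X < _)%E]eq_integral do rewrite weighted_indic.
rewrite wnormE => foo.
have p0 : 0 < p by lra.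
pose p' := p / (p - 1).
have p'0 : 0 < p' by rewrite divr_gt0// subr_gt0.
have pp' : p'^-1 + p^-1 = 1.
  by rewrite /p' invf_div; field; rewrite ?gt_eqF//= subr_gt0.
apply: le_lt_trans (ge0_hoelder lam m1 mF _ (weighted_ge0 r f) p'0 p0 pp') _ => //.
apply: lte_mul_pinfty; rewrite ?poweR_ge0//.
  rewrite ge0_fin_numE ?poweR_ge0// poweR_lty//.
  rewrite (_ : (\int[lam]_x _)%E = lam B)// -I1; apply: eq_integral => y _.
  rewrite indicE; case: (y \in B); first by rewrite powR1.
  by rewrite powR0// gt_eqF.
Qed.

Lemma wLfun_of_wnorm (p : \bar R) r f : (1 <= p)%E -> 0 <= r -> measurable_fun B f ->
  (wnorm p r f < +oo)%E -> wLfun p r f.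
Proof.
move=> p1 r0 mf foo; split=> //.
apply: (loc_integrable_of_weighted r0 mf).
apply: le_lt_trans (integral_weighted_lty p1 mf foo).
rewrite integral_mkcond; apply: eq_lee; apply: eq_integral => y _; rewrite patchE.
case: ifPn => [|/negP]; rewrite inE => By; first by rewrite weighted_in.
by rewrite weighted_out.
Qed.

End weighted_norm.

(** * Norm bounds for the explicit gradient in the three ranges of p *)

Section gradient_bounds.
Context {R : realType} {n : nat}.
Local Notation E := 'rV[R]_n.
Local Notation lam := (@lebesgue_rV R n).
Local Notation B := (@unit_ball R n).

Lemma enorm_le_sum (v : E) : enorm v <= \sum_i `|v ord0 i|.
Proof.
have S0 : 0 <= \sum_i `|v ord0 i| by apply: sumr_ge0.
rewrite -(ler_pXn2r (n := 2)) ?nnegrE ?enorm_ge0// enorm_sqr [leRHS]expr2 mulr_suml.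
apply: ler_sum => i _; rewrite -real_normK ?num_real// expr2 ler_wpM2l//.
by rewrite (bigD1 i)//= lerDl sumr_ge0.
Qed.

Variable s : R.
Hypotheses (n0 : (0 < n)%N) (s_gt : 2^-1 < s) (s_lt : s < 1).

Let a : R := n%:R + 1 - 2 * s.

Let a0 : 0 < a.
Proof.
have := s_gt; have := s_lt; have n1 : (1 : R) <= n%:R by rewrite ler1n.
rewrite /a; lra.
Qed.

Let an : a < n%:R.
Proof. by have := s_gt; rewrite /a; lra. Qed.

Let nR0 : 0 < n%:R :> R.
Proof. by rewrite ltr0n. Qed.

Lemma measurable_enorm_gradient (f : E -> R) : measurable_fun B f ->
  measurable_fun setT (fun x => enorm (green_gradient s f x)).
Proof.
move=> mf; apply: (measurableT_comp measurable_enorm).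
apply/measurable_fun_rowP => i; rewrite green_gradientE.
by apply: measurable_kernel_potential => //; exact: measurable_green_dreg.
Qed.

(** The cutoff at 2 costs nothing between points of the ball and gives the kernel the global
    integrability behind the Young and Hoelder cases. The factor n comes from bounding the Euclidean
    norm by the sum of the components. *)
Lemma weighted_gradient_le : exists2 C : R, 0 < C &
  forall (r : R) (f : E -> R), 1 - s <= r -> r <= s -> measurable_fun B f ->
  forall x, ((weighted r (fun x => enorm (green_gradient s f x)) x)%:E <=
    C%:E * \int[lam]_y (enorm (x - y) `^ (- a) * (enorm (x - y) < 2)%R%:R * weighted r f y)%:E)%E.
Proof.
have [D D0 HD] := green_dreg0_le n0 s_gt s_lt.
exists (n%:R * D); first exact: mulr_gt0.
move=> r f r1 rs mf x.
have r0 : 0 <= r by apply: le_trans r1; rewrite subr_ge0 ltW.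
have I0 : (0 <= \int[lam]_y (enorm (x - y) `^ (- a) * (enorm (x - y) < 2)%R%:R * weighted r f y)%:E)%E.
  by apply: integral_ge0 => y _; rewrite lee_fin !mulr_ge0 ?powR_ge0 ?weighted_ge0.
have [Bx|nBx] := pselect (B x); last first.
  by rewrite weighted_out// mule_ge0// lee_fin mulr_ge0 ?ltW.
rewrite weighted_in// (ger0_norm (enorm_ge0 _)).
apply: (@le_trans _ _ (\sum_(i < n) ((1 - enorm x) `^ r *
    `|kernel_potential (fun z => green_dreg s 0 i z.1 z.2) f x|)%:E)%E).
  rewrite sumEFin lee_fin -mulr_sumr ler_wpM2l ?powR_ge0//.
  apply: le_trans (enorm_le_sum _) _; apply: ler_sum => i _.
  by rewrite mxE.
have -> : ((n%:R * D)%:E * \int[lam]_y (enorm (x - y) `^ (- a) * (enorm (x - y) < 2)%R%:R * weighted r f y)%:E =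
    \sum_(i < n) (D%:E * \int[lam]_y (enorm (x - y) `^ (- a) * weighted r f y)%:E))%E.
  rewrite -ge0_sume_distrl; last by move=> i _; rewrite lee_fin ltW.
  rewrite sumEFin sumr_const card_ord mulr_natl; congr (_ * _)%E.
  apply: eq_integral => y _; congr EFin.
  have [By|nBy] := pselect (B y); last by rewrite weighted_out// !mulr0.
  by rewrite unit_ball_edist_lt2// mulr1.
apply: lee_sum => i _.
have mi := measurable_green_dreg n0 s_gt s_lt i (lexx 0).
have HDi x1 x2 : B x1 -> B x2 -> _ := fun B1 B2 => HD r i x1 x2 B1 B2 r1 rs.
exact: (kernel_potential_bound n0 mi D0 HDi mf Bx).
Qed.

(** [C] precedes [r] and [f], hence depends on n, s, p and q only. *)
Definition weighted_gradient_bound (p q : \bar R) : Prop :=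
  exists2 C : R, 0 < C & forall (r : R) (f : E -> R),
  1 - s <= r -> r <= s -> wLfun p r f ->
  (wnorm q r (fun x => enorm (green_gradient s f x)) <= C%:E * wnorm p r f)%E.

Let mW r (f : E -> R) : measurable_fun B f ->
  measurable_fun setT (weighted r (fun x => enorm (green_gradient s f x))).
Proof.
by move=> mf; apply: (measurable_weighted n0); apply: measurable_funTS; exact: measurable_enorm_gradient.
Qed.

Let edist (z : E * E) : R := enorm (z.1 - z.2).

Let medist : measurable_fun setT edist.
Proof. exact: measurable_edist. Qed.

Let edist0 z : 0 <= edist z.
Proof. exact: enorm_ge0. Qed.

Let edistC x y : edist (x, y) = edist (y, x).
Proof. exact: enormBC. Qed.

Let A0 : 0 < (2 ^+ n : R).
Proof. by rewrite exprn_gt0. Qed.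

(** The upper limit on q says exactly a q < n, that is, local integrability of the q-th power of the
    kernel. *)
Lemma weighted_gradient_bound_L1 (q : R) : 1 <= q -> q < n%:R / (n%:R - 2 * s + 1) ->
  weighted_gradient_bound 1%:E q%:E.
Proof.
move=> q1; rewrite (_ : n%:R - 2 * s + 1 = a); last by rewrite /a; ring.
rewrite ltr_pdivlMr// => qa.
have q0 : 0 < q by lra.
have [C C0 HC] := weighted_gradient_le.
have aq : a * q < n%:R by rewrite mulrC.
have [c c0 Hc] := @edist_near R n (a * q) 2 (mulr_gt0 a0 q0) aq (ltr0n R 2).
pose K := C `^ q * c.
have K0 : 0 < K by rewrite mulr_gt0// powR_gt0.
exists (K `^ q^-1); first by rewrite powR_gt0.
move=> r f r1 rs [[mf _] foo].
have F0 := @weighted_ge0 R n r f.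
have mF := measurable_weighted n0 r mf.
pose w (z : E * E) := C * (edist z `^ (- a) * (edist z < 2)%R%:R).
have mk : measurable_fun setT (fun z : E * E => edist z `^ (- a) * (edist z < 2)%R%:R).
  apply: measurable_funM; first exact: (measurableT_comp (measurable_powR _) medist).
  by apply: measurable_bool_natr; exact: measurable_fun_ltr.
have mw : measurable_fun setT w by exact: measurable_funM.
have k0 z : 0 <= edist z `^ (- a) * (edist z < 2)%R%:R by rewrite mulr_ge0 ?powR_ge0.
have w0 z : 0 <= w z by exact: (mulr_ge0 (ltW C0)).
have wq y : (\int[lam]_x (w (x, y) `^ q)%:E <= K%:E)%E.
  rewrite /K EFinM.
  apply: le_trans (lee_wpmul2l _ (Hc y)); last by rewrite lee_fin powR_ge0.
  rewrite -ge0_integralZl_EFin ?powR_ge0//; last 2 first.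
  - by move=> x _; rewrite lee_fin mulr_ge0 ?powR_ge0.
  - apply/measurable_EFinP; apply: measurable_funM.
      apply: (measurableT_comp (measurable_powR _)).
      exact: (measurableT_comp measurable_edist (pair1_measurable y)).
    apply: measurable_bool_natr; apply: measurable_fun_ltr => //.
    exact: (measurableT_comp measurable_edist (pair1_measurable y)).
  apply: eq_lee; apply: eq_integral => x _; rewrite -EFinM; congr EFin.
  rewrite /w edistC powRM ?(ltW C0)//; congr (_ * _).
  rewrite powRM ?powR_ge0// -powRrM mulNr; congr (_ * _).
  by case: (_ < _); rewrite ?powR1// powR0// gt_eqF.
rewrite wnormE wnorm1E.
have foo1 : (\int[lam]_y (weighted r f y)%:E < +oo)%E by rewrite -wnorm1E.
have gw (x : E) : ((weighted r (fun x => enorm (green_gradient s f x)) x)%:E <=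
    \int[lam]_y (w (x, y) * weighted r f y)%:E)%E.
  apply: le_trans (HC r f r1 rs mf x) _.
  rewrite -ge0_integralZl_EFin ?(ltW C0)//; last 2 first.
  - by move=> y _; rewrite lee_fin; exact: (mulr_ge0 (k0 (x, y)) (F0 y)).
  - apply/measurable_EFinP; apply: measurable_funM => //.
    exact: (measurableT_comp mk (pair1_measurable x)).
  by apply: eq_lee; apply: eq_integral => y _; rewrite -EFinM mulrA.
have KE0 : (0 <= K%:E)%E by rewrite lee_fin ltW.
have H := young_potential mw w0 mF F0 (mW r mf) (weighted_ge0 r _) KE0 q1 wq gw foo1.
have I0 : (0 <= \int[lam]_y (weighted r f y)%:E)%E.
  by apply: integral_ge0 => y _; rewrite lee_fin.
apply: le_trans (lee_poweR _ _ H) _; rewrite ?invr_ge0 ?(ltW q0)//.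
  by apply: integral_ge0 => y _; rewrite lee_fin powR_ge0.
rewrite poweRM ?poweR_ge0 ?lee_fin ?(ltW K0)// -poweRrM mulfV ?gt_eqF// poweRe1//.
Qed.

(** Here D = n and D - a = 2 s - 1 in [riesz_hls]. The cutoff is dropped, as that inequality
    controls the kernel at infinity too. *)
Lemma weighted_gradient_bound_Lp (p : R) : 1 < p -> p < n%:R / (2 * s - 1) ->
  weighted_gradient_bound p%:E (n%:R * p / (n%:R - (2 * s - 1) * p))%:E.
Proof.
move=> p1; have al : n%:R - a = 2 * s - 1 by rewrite /a; ring.
have al0 : 0 < 2 * s - 1 by have := s_gt; lra.
rewrite ltr_pdivlMr// mulrC -al => pn.
have p0 : 0 < p by lra.
have [C C0 HC] := weighted_gradient_le.
have [c c0 Hc] := @riesz_hls _ _ R lam edist (2 ^+ n) n%:R a medist edist0 edistC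
  (@upper_regular_lebesgue_rV R n) A0 a0 an C p C0 p1 pn.
exists c; [exact: c0|move=> r f r1 rs [[mf _] foo]].
have F0 := @weighted_ge0 R n r f.
have mF := measurable_weighted n0 r mf.
rewrite !wnormE in foo *.
apply: Hc => //.
- exact: mW.
- by move=> y; exact: weighted_ge0.
- have I0 : (0 <= \int[lam]_y (weighted r f y `^ p)%:E)%E.
    by apply: integral_ge0 => y _; rewrite lee_fin powR_ge0.
  rewrite -[ltLHS]poweRe1// -(mulVf (lt0r_neq0 p0)) poweRrM.
  exact: poweR_lty.
move=> x; apply: le_trans (HC r f r1 rs mf x) _.
rewrite lee_wpmul2l ?lee_fin ?(ltW C0)//.
have mk : measurable_fun setT (fun y : E => enorm (x - y) `^ (- a)).
  apply: (measurableT_comp (measurable_powR _)).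
  exact: (measurableT_comp measurable_edist (pair1_measurable x)).
apply: ge0_le_integral => //.
- by move=> y _; rewrite lee_fin !mulr_ge0 ?powR_ge0.
- apply/measurable_EFinP; apply: measurable_funM => //; apply: measurable_funM => //.
  apply: measurable_bool_natr; apply: measurable_fun_ltr => //.
  exact: (measurableT_comp measurable_edist (pair1_measurable x)).
- by apply/measurable_EFinP; exact: measurable_funM.
move=> y _; rewrite lee_fin ler_wpM2r// ler_piMr ?powR_ge0//.
by case: (_ < _).
Qed.

(** For finite p the hypothesis is that of [riesz_hoelder] with D - a = 2 s - 1; for p infinite,
    integrability of the cutoff kernel is enough. *)
Lemma weighted_gradient_bound_Linfty (p : \bar R) :
  ((n%:R / (2 * s - 1))%:E < p)%E -> weighted_gradient_bound p +oo%E.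
Proof.
have al : n%:R - a = 2 * s - 1 by rewrite /a; ring.
have al0 : 0 < 2 * s - 1 by have := s_gt; lra.
have [C C0 HC] := weighted_gradient_le.
move=> pn.
suff [c c0 Hc] : exists2 c : R, 0 < c & forall r f, measurable_fun B f -> forall x : E,
    (\int[lam]_y (enorm (x - y) `^ (- a) * (enorm (x - y) < 2)%R%:R * weighted r f y)%:E
     <= c%:E * wnorm p r f)%E.
  exists (C * c); [exact: mulr_gt0|move=> r f r1 rs [[mf _] foo]].
  apply: wnormy_le => [|x].
    by rewrite mule_ge0 ?wnorm_ge0// lee_fin mulr_ge0 ?ltW.
  apply: le_trans (HC r f r1 rs mf x) _.
  by rewrite EFinM -muleA lee_wpmul2l ?lee_fin ?(ltW C0)// Hc.
case: p pn => [p| |]; rewrite ?ltNge ?leNye//; last first.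
  move=> _; have [c c0 Hc] := @edist_near R n a 2 a0 an (ltr0n R 2).
  exists c; [exact: c0|move=> r f mf x].
  have mk : measurable_fun setT (fun y : E => enorm (x - y) `^ (- a) * (enorm (x - y) < 2)%R%:R).
    apply: measurable_funM.
      apply: (measurableT_comp (measurable_powR _)).
      exact: (measurableT_comp measurable_edist (pair1_measurable x)).
    apply: measurable_bool_natr; apply: measurable_fun_ltr => //.
    exact: (measurableT_comp measurable_edist (pair1_measurable x)).
  have k0 (y : E) : 0 <= enorm (x - y) `^ (- a) * (enorm (x - y) < 2)%R%:R.
    by rewrite mulr_ge0 ?powR_ge0.
  apply: le_trans (integral_weighted_le_wnormy n0 r mf mk k0) _.
  by rewrite muleC lee_wpmul2r ?wnorm_ge0.
rewrite -ltNge lte_fin ltr_pdivrMr// mulrC -al => pn.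
(* The threshold n / (2 s - 1) exceeds 1, because 2 s - 1 < 1 <= n. *)
have p1 : 1 < p.
  have n1 : (1 : R) <= n%:R by rewrite ler1n.
  rewrite -(ltr_pM2l al0) mulr1 -al; apply: lt_trans pn.
  by rewrite al; have := s_lt; lra.
have [c c0 Hc] := @riesz_hoelder _ _ R lam edist (2 ^+ n) n%:R a medist edist0
  (@upper_regular_lebesgue_rV R n) A0 a0 p 2 (ltr0n R 2) p1 pn.
exists c; [exact: c0|move=> r f mf x].
rewrite wnormE; apply: Hc.
- exact: measurable_weighted.
- exact: weighted_ge0.
Qed.

End gradient_bounds.

(** The weak gradient is [green_gradient] whatever the exponents, so the three cases differ only in
    the norm bound fed in here. *)
Lemma weighted_gradient_boundP {R : realType} {n : nat} (s : R) (p q : \bar R) :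
  (0 < n)%N -> 2^-1 < s -> s < 1 -> (1 <= p)%E -> (1 <= q)%E ->
  @weighted_gradient_bound R n s p q ->
  exists2 C : R, 0 < C & forall (r : R) (f u : 'rV[R]_n -> R),
    1 - s <= r -> r <= s -> wLfun p r f -> u = green_potential s f ->
    exists Du : 'rV[R]_n -> 'rV[R]_n,
      [/\ weak_gradient u Du, wLfun q r (fun x => enorm (Du x)) &
          (wnorm q r (fun x => enorm (Du x)) <= C%:E * wnorm p r f)%E].
Proof.
move=> n0 s_gt s_lt p1 q1 [C C0 HC]; exists C => // r f _ r1 rs fp ->.
have r0 : 0 <= r by apply: le_trans r1; rewrite subr_ge0 ltW.
have HCf := HC r f r1 rs fp; have [[mf _] foo] := fp.
exists (green_gradient s f); split => //.
  exact: (weak_gradient_green n0 s_gt s_lt r1 rs mf (integral_weighted_lty n0 p1 mf foo)).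
apply: wLfun_of_wnorm => //.
  by apply: measurable_funTS; exact: measurable_enorm_gradient.
apply: (le_lt_trans HCf); apply: lte_mul_pinfty; rewrite ?lee_fin ?(ltW C0)//.
Qed.

Theorem theorem4p4 (R : realType) (n : nat) (s : R) :
  (0 < n)%N -> 2^-1 < s -> s < 1 ->
  [/\ forall q : R, 1 <= q -> q < n%:R / (n%:R - 2 * s + 1) ->
        exists2 C : R, 0 < C &
        forall (r : R) (f u : 'rV[R]_n -> R),
          1 - s <= r -> r <= s ->
          wLfun 1%:E r f -> u = green_potential s f ->
          exists Du : 'rV[R]_n -> 'rV[R]_n,
            [/\ weak_gradient u Du,
                wLfun q%:E r (fun x => enorm (Du x)) &
                (wnorm q%:E r (fun x => enorm (Du x)) <=
                 C%:E * wnorm 1%:E r f)%E],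
      forall p : R, 1 < p -> p < n%:R / (2 * s - 1) ->
        exists2 C : R, 0 < C &
        forall (r : R) (f u : 'rV[R]_n -> R),
          1 - s <= r -> r <= s ->
          wLfun p%:E r f -> u = green_potential s f ->
          let q := n%:R * p / (n%:R - (2 * s - 1) * p) in
          exists Du : 'rV[R]_n -> 'rV[R]_n,
            [/\ weak_gradient u Du,
                wLfun q%:E r (fun x => enorm (Du x)) &
                (wnorm q%:E r (fun x => enorm (Du x)) <=
                 C%:E * wnorm p%:E r f)%E] &
      forall p : \bar R, (1 <= p)%E -> ((n%:R / (2 * s - 1))%:E < p)%E ->
        exists2 C : R, 0 < C &
        forall (r : R) (f u : 'rV[R]_n -> R),
          1 - s <= r -> r <= s ->
          wLfun p r f -> u = green_potential s f ->
          exists Du : 'rV[R]_n -> 'rV[R]_n,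
            [/\ weak_gradient u Du,
                wLfun +oo%E r (fun x => enorm (Du x)) &
                (wnorm +oo%E r (fun x => enorm (Du x)) <=
                 C%:E * wnorm p r f)%E]].
Proof.
move=> n0 s_gt s_lt; split.
- move=> q q1 qn; apply: weighted_gradient_boundP => //.
  exact: weighted_gradient_bound_L1.
- move=> p p1 pn; apply: weighted_gradient_boundP => //; first by rewrite lee_fin ltW.
    (* The target exponent is at least 1, since n - (2 s - 1) p <= n <= n p. *)
    have al0 : 0 < 2 * s - 1 by lra.
    have nR0 : 0 < n%:R :> R by rewrite ltr0n.
    rewrite lee_fin; move: pn; rewrite ltr_pdivlMr// mulrC => pn.
    by rewrite ler_pdivlMr ?subr_gt0//; nra.
  exact: weighted_gradient_bound_Lp.
- move=> p p1 pn; apply: weighted_gradient_boundP => //; first exact: leey.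
  exact: weighted_gradient_bound_Linfty.
Qed.
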